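(* Let $Q\ge2$ and let $\Delta$ be the combinatorial Laplacian on the homogeneous tree $\mathbb{T}_Q$. Let $0<\alpha\le2$ and $2<q,\tilde q\le\infty$. Then, for $t\in\mathbb{R}\setminus\{0\}$, $$\bigl\|e^{it(-\Delta)^{\alpha/2}}\bigr\|_{\ell^{q'}(\mathbb{T}_Q)\to\ell^{\tilde q}(\mathbb{T}_Q)}\lesssim(1+|t|)^{-\frac32}.$$
   Context: $\mathbb{T}_Q$ is the set of vertices of the homogeneous tree of degree $Q+1$ (the infinite connected graph without loops in which every vertex has exactly $Q+1$ neighbours), with the counting measure and the graph distance $d$. The combinatorial Laplacian is $\Delta f(x)=\frac1{Q+1}\sum_{d(y,x)=1}f(y)-f(x)$, a bounded self-adjoint operator on $\ell^2(\mathbb{T}_Q)$ with $-\Delta\ge0$; functions of $-\Delta$ are defined by the spectral theorem. $q'$ is the conjugate exponent of $q$. $A\lesssim B$ means $A\le CB$ with a constant $C>0$ independent of $t$ (it may depend on $Q,\alpha,q,\tilde q$). *)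

(* Defs.v *)
From HB Require Import structures.
From mathcomp Require Import all_boot all_order all_algebra.
From mathcomp Require Import complex.
From mathcomp Require Import all_classical all_reals all_analysis.
Set Implicit Arguments.
Unset Strict Implicit.
Unset Printing Implicit Defensive.
Import Order.TTheory GRing.Theory Num.Theory.
Import numFieldNormedType.Exports.
Local Open Scope classical_set_scope.
Local Open Scope ring_scope.
Local Open Scope complex_scope.

Section tree.
Context {V : pointedType}.

Definition walk (adj : rel V) (x y : V) (n : nat) : Prop :=
  exists p : seq V, [/\ size p = n, path adj x p & last x p = y].

Definition connected_graph (adj : rel V) : Prop :=
  forall x y : V, exists n, walk adj x y n.

(* The value 0 for vertices in distinct components plays no role: the graph
   is always assumed to be connected. *)
Definition gdist (adj : rel V) (x y : V) : nat :=
  xget 0%N [set n | walk adj x y n /\ forall m, walk adj x y m -> (n <= m)%N].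

(* [ucycle] accepts the back-and-forth cycle along a single edge, whence the
   restriction to length at least 3; the cycles of length 1 are excluded by
   irreflexivity. *)
Definition homogeneous_tree (Q : nat) (adj : rel V) : Prop :=
  [/\ symmetric adj /\ irreflexive adj,
      connected_graph adj /\ infinite_set [set: V],
      (forall c : seq V, (2 < size c)%N -> ~ ucycle adj c) &
      (forall x : V, ([set y | adj x y] #= `I_Q.+1)%card)].

End tree.

(* V with all its subsets measurable, so that [counting] is a measure on it. *)
Definition discrete (V : Type) : Type := V.
HB.instance Definition _ (V : pointedType) := Pointed.on (discrete V).
HB.instance Definition _ (V : pointedType) :=
  @isMeasurable.Build default_measure_display (discrete V)
    discrete_measurable discrete_measurable0
    discrete_measurableC discrete_measurableU.

Definition Cintegral d (T : measurableType d) (R : realType)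
    (mu : {measure set T -> \bar R}) (f : T -> R[i]) : R[i] :=
  Rintegral mu setT (fun x => complex.Re (f x)) +i*
  Rintegral mu setT (fun x => complex.Im (f x)).

Definition Cintegrable d (T : measurableType d) (R : realType)
    (mu : {measure set T -> \bar R}) (f : T -> R[i]) : Prop :=
  mu.-integrable setT (fun x => (complex.Re (f x))%:E) /\
  mu.-integrable setT (fun x => (complex.Im (f x))%:E).

Section ell.
Context {R : realType} {V : pointedType}.

Local Notation count_meas := (@counting (discrete V) R).

Definition lnorm (p : \bar R) (u : V -> R[i]) : \bar R :=
  Lnorm count_meas p (fun x : discrete V => (Normc.normc (u x))%:E).

Definition ell2 (u : V -> R[i]) : Prop := (lnorm 2%:E u < +oo)%E.

Definition inner (u v : V -> R[i]) : R[i] :=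
  Cintegral count_meas (fun x : discrete V => u x * (v x)^*).

Definition bounded_op (A : (V -> R[i]) -> (V -> R[i])) : Prop :=
  [/\ forall u, ell2 u -> ell2 (A u),
      forall (a : R[i]) u v, ell2 u -> ell2 v ->
        A (fun x => a * u x + v x) = (fun x => a * A u x + A v x) &
      exists M : R, forall u, ell2 u ->
        (lnorm 2%:E (A u) <= M%:E * lnorm 2%:E u)%E].

(* The measure B |-> <P(B) u, u>. *)
Definition diag_measure (P : set R -> (V -> R[i]) -> (V -> R[i]))
    (u : V -> R[i]) (mu : {measure set (measurableTypeR R) -> \bar R}) : Prop :=
  forall B : set (measurableTypeR R), measurable B ->
    mu B = (complex.Re (inner (P B u) u))%:E.

(* Resolution of the identity on the Borel sets of the real line, with values
   in the orthogonal projections of ell^2(V).  By polarization, it suffices to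
   require countable additivity of B |-> <P(B) u, v> for u = v. *)
Definition projection_valued_measure
    (P : set R -> (V -> R[i]) -> (V -> R[i])) : Prop :=
  [/\ forall B : set (measurableTypeR R), measurable B ->
        [/\ bounded_op (P B),
            forall u, ell2 u -> P B (P B u) = P B u &
            forall u v, ell2 u -> ell2 v ->
              inner (P B u) v = inner u (P B v)],
      forall u, ell2 u -> P setT u = u,
      forall B C : set (measurableTypeR R), measurable B -> measurable C ->
        forall u, ell2 u -> P (B `&` C) u = P B (P C u) &
      forall u, ell2 u ->
        exists mu : {measure set (measurableTypeR R) -> \bar R},
          diag_measure P u mu].

(* T is the bounded operator \int f dP, defined weakly; by polarization, the
   diagonal entries <T u, u> determine T. *)
Definition spectral_integral (P : set R -> (V -> R[i]) -> (V -> R[i]))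
    (f : R -> R[i]) (T : (V -> R[i]) -> (V -> R[i])) : Prop :=
  bounded_op T /\
  forall u, ell2 u ->
  forall mu : {measure set (measurableTypeR R) -> \bar R},
    diag_measure P u mu ->
    Cintegrable mu (f : measurableTypeR R -> R[i]) /\
    inner (T u) u = Cintegral mu (f : measurableTypeR R -> R[i]).

(* T = f(A), for A bounded and self-adjoint on ell^2(V): the spectral theorem
   provides a unique P with A = \int l dP(l), and f(A) is \int f dP. *)
Definition spectral_function (A : (V -> R[i]) -> (V -> R[i]))
    (f : R -> R[i]) (T : (V -> R[i]) -> (V -> R[i])) : Prop :=
  exists P : set R -> (V -> R[i]) -> (V -> R[i]),
    [/\ projection_valued_measure P,
        spectral_integral P (fun l => l%:C) A &
        spectral_integral P f T].

(* For p <= 2, ell^p(V) is contained in ell^2(V), so that an operator on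
   ell^2(V) is defined on all of ell^p(V). *)
Definition opnorm (p r : \bar R) (T : (V -> R[i]) -> (V -> R[i])) : \bar R :=
  ereal_sup [set lnorm r (T u) | u in [set u | (lnorm p u <= 1)%E]].

Definition laplacian (Q : nat) (adj : rel V) (u : V -> R[i]) : V -> R[i] :=
  fun x => (Q.+1%:R)^-1 * (\sum_(y \in [set y | gdist adj y x = 1%N]) u y)
           - u x.

End ell.

Definition expi {R : realType} (x : R) : R[i] := cos x +i* sin x.

(* Main.v *)
Require Import Defs.
From mathcomp Require Import all_boot all_order all_algebra.
From mathcomp Require Import finmap complex.
From mathcomp Require Import all_classical all_reals all_analysis ess_sup_inf.
From mathcomp Require Import ring lra zify.
Set Implicit Arguments.
Unset Strict Implicit.
Unset Printing Implicit Defensive.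
Import Order.TTheory GRing.Theory Num.Theory.
Import numFieldNormedType.Exports.
Local Open Scope classical_set_scope.
Local Open Scope ring_scope.

(* With gam = 2 sqrt(Q) / (Q + 1) and B = (1 + Laplacian) / gam, the spectrum of B
   lies in [-1, 1] and T = g(B) with g(cos x) = exp(i t (1 - gam cos x)^(alpha / 2)).
   Expanding g = \sum_n L_n U_n in Chebyshev polynomials of the second kind is
   efficient on a tree: the kernel of U_n(B) is Q^(-n/2) times the indicator of
   d(x, y) <= n, d(x, y) = n mod 2.  It is bounded by Q^(-n/2) from l^1 to l^oo and,
   by Schur's test against the spherical function, by n + 1 on l^2; hence it is
   exponentially small in n from l^r' to l^r for every r > 2.  On the other hand
   L_n = (2 / pi) \int_0^pi g(cos x) sin x sin((n + 1) x) dx has a phase whose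
   stationary points 0 and pi are nondegenerate and where the amplitude vanishes
   to second order, so L_n = O(n^2 |t|^(-3/2)).  The expansion is only ever used for
   polynomials approximating g on the spectrum, the error being controlled by the
   spectral measures. *)

(** * Geometry of the tree *)

(** The quadratic loss in the coefficients is affordable because the kernel bound at level n is (n +
    1) rho^n with rho < 1: only the convergence of \sum n^3 rho^n is needed, and rho < 1 is exactly
    the condition r > 2. A single estimate from l^r' to l^r, with r at most q and qt, suffices: on a
    discrete set l^q' embeds in l^r', and l^r in l^qt, with norm at most 1. The main obstacle is
    that T is given only through its diagonal entries against some resolution of the identity P,
    itself tied to the Laplacian by the same weak formula. It has to be proved that P is carried by
    a compact interval away from 0, where l^(alpha / 2) is Lipschitz, that the moments of the
    spectral measures are the diagonal entries of the powers of the Laplacian, and that diagonal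
    bounds yield off-diagonal ones. For a polynomial the expansion is a finite identity, valid for
    every function on the vertices. The degree grows as the error shrinks, so every bound is made
    uniform in the degree. *)

Section tree_geometry.
Context {V : pointedType} (Q : nat) (adj : rel V).
Hypothesis ht : homogeneous_tree Q adj.

Local Notation d := (gdist adj).

Lemma tree_sym : symmetric adj. Proof. by case: ht => [[]]. Qed.

Lemma tree_irr : irreflexive adj. Proof. by case: ht => [[]]. Qed.

Lemma gdist_walk x y : walk adj x y (d x y).
Proof.
have [_ [hc _] _ _] := ht; have [n wn] := hc x y.
have ex : exists n, `[< walk adj x y n >] by exists n; apply/asboolP.
suff [] : [set n | walk adj x y n /\ forall m, walk adj x y m -> (n <= m)%N]
   (d x y) by [].
apply: xgetPex; case: (ex_minnP ex) => m /asboolP wm hm; exists m; split=> //.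
by move=> k /asboolP/hm.
Qed.

Lemma gdist_le x y n : walk adj x y n -> (d x y <= n)%N.
Proof.
move=> wn; have ex : exists n, `[< walk adj x y n >] by exists n; apply/asboolP.
suff [_ h] : [set n | walk adj x y n /\ forall m, walk adj x y m -> (n <= m)%N]
   (d x y) by apply: h.
apply: xgetPex; case: (ex_minnP ex) => m /asboolP wm hm; exists m; split=> //.
by move=> k /asboolP/hm.
Qed.

Lemma gdistxx x : d x x = 0%N.
Proof. by apply/eqP; rewrite -leqn0; apply: gdist_le; exists [::]. Qed.

Lemma gdist_eq0 x y : (d x y == 0%N) = (x == y).
Proof.
apply/eqP/eqP => [h|->]; last exact: gdistxx.
by have [p [/eqP]] := gdist_walk x y; rewrite h size_eq0 => /eqP -> /=.
Qed.

Lemma gdist_sym x y : d x y = d y x.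
Proof.
suff h a b : (d a b <= d b a)%N by apply/eqP; rewrite eqn_leq !h.
have [p [sp pp lp]] := gdist_walk b a.
apply: gdist_le; exists (rev (belast b p)); split.
- by rewrite size_rev size_belast.
- rewrite -lp rev_path; apply: sub_path pp => u v /=; by rewrite tree_sym.
- case: p {sp pp} lp => [|c p] lp; first by [].
  by rewrite /= rev_cons last_rcons.
Qed.

Lemma gdist_adj_le x z y : adj x z -> (d x y <= (d z y).+1)%N.
Proof.
move=> xz; have [p [sp pp lp]] := gdist_walk z y.
by apply: gdist_le; exists (z :: p); rewrite /= sp xz.
Qed.

Lemma gdist_closer x y : x != y -> exists2 z, adj x z & d x y = (d z y).+1.
Proof.
move=> xy; have [[|z p] [sp pp lp]] := gdist_walk x y.
  by rewrite /= in lp; rewrite lp eqxx in xy.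
move: pp => /= /andP[xz pp]; exists z => //.
apply/eqP; rewrite eqn_leq gdist_adj_le //= -sp /= ltnS.
by apply: gdist_le; exists p.
Qed.

(** A geodesic from z to y through x would contain a path from x to y strictly shorter than d z y,
    hence shorter than d x y. *)
Lemma geodesic_avoids x z y : x != z -> (d z y <= d x y)%N ->
  exists p, [/\ path adj z p, last z p = y & x \notin z :: p].
Proof.
move=> xz zx; have [p [sp pp lp]] := gdist_walk z y; exists p; split=> //.
rewrite inE negb_or xz /=; apply/negP => xp.
have xp' : x \in z :: p by rewrite inE xp orbT.
case/splitPl: p / xp' xp sp pp lp => p1 p2 h1 _.
rewrite size_cat cat_path last_cat h1 => sp /andP[_ pp2] lp2.
have : (d x y <= size p2)%N by apply: gdist_le; exists p2.
case: p1 h1 sp => [|c p1] /= h1 sp; first by rewrite h1 eqxx in xz.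
lia.
Qed.

(* Two such neighbours would be joined by a path avoiding x, and x would close
   it up to a cycle. *)
Lemma closer_uniq x y z1 z2 : adj x z1 -> adj x z2 ->
  (d z1 y <= d x y)%N -> (d z2 y <= d x y)%N -> z1 = z2.
Proof.
move=> a1 a2 l1 l2; apply/eqP; apply/negP => /negP ne.
have n1 : x != z1 by apply: contraTneq a1 => <-; rewrite tree_irr.
have n2 : x != z2 by apply: contraTneq a2 => <-; rewrite tree_irr.
have [p1 [pp1 lp1 xp1]] := geodesic_avoids n1 l1.
have [p2 [pp2 lp2 xp2]] := geodesic_avoids n2 l2.
pose p := p1 ++ rev (belast z2 p2).
have lp : last z1 p = z2.
  rewrite last_cat lp1; case: (p2) lp2 => [|c r] //=.
  by rewrite rev_cons last_rcons.
have pp : path adj z1 p.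
  rewrite cat_path pp1 lp1 -lp2 rev_path.
  by apply: sub_path pp2 => u v /=; rewrite tree_sym.
have xp : x \notin z1 :: p.
  rewrite -cat_cons mem_cat negb_or xp1 mem_rev.
  by apply: contra xp2 => /mem_belast.
(* The concatenation of the two geodesics may repeat vertices, while [ucycle] requires a simple
   path. *)
move: lp; case/shortenP: pp => p' pp' up' sub lp'.
have xp' : x \notin z1 :: p'.
  apply: contra xp; rewrite !inE => /orP[->//|/sub ->]; by rewrite orbT.
have [_ _ acyc _] := ht.
apply: (acyc (x :: z1 :: p')).
  by case: (p') lp' => [|c r] //= e; rewrite e eqxx in ne.
rewrite /ucycle; apply/andP; split; last by rewrite cons_uniq xp' up'.
by rewrite /cycle rcons_cons /= a1 rcons_path pp' lp' tree_sym.
Qed.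

Definition nbrs (x : V) : seq V := fset_set [set y | adj x y].

Lemma nbrs_finite x : finite_set [set y | adj x y].
Proof. by have [_ _ _ /(_ x) h] := ht; exists Q.+1. Qed.

Lemma mem_nbrs x y : (y \in nbrs x) = adj x y.
Proof.
rewrite /nbrs in_fset_set; last exact: nbrs_finite.
by apply/idP/idP => [/set_mem|/mem_set].
Qed.

Lemma uniq_nbrs x : uniq (nbrs x).
Proof. exact: fset_uniq. Qed.

Lemma size_nbrs x : size (nbrs x) = Q.+1.
Proof. by have [_ _ _ /(_ x)] := ht; exact: card_fset_set. Qed.

(** One neighbour of x is closer to y and the Q others are farther: as [closer_uniq] is stated with
    <=, it also excludes a neighbour at equal distance. This describes the adjacency operator on
    radial functions. *)
Lemma sum_nbrs (K : nzRingType) (F : nat -> K) x y : x != y ->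
  \sum_(z <- nbrs x) F (d z y) = F (d x y).-1 + Q%:R * F (d x y).+1.
Proof.
move=> xy; have [z0 a0 e0] := gdist_closer xy.
have far z : adj x z -> z != z0 -> d z y = (d x y).+1.
  move=> az zz0; apply/eqP; rewrite eqn_leq.
  have -> /= : (d z y <= (d x y).+1)%N by apply: gdist_adj_le; rewrite tree_sym.
  rewrite ltnNge; apply: contra zz0 => le; apply/eqP.
  by apply: (closer_uniq az a0 le); rewrite e0.
rewrite (bigD1_seq z0) ?uniq_nbrs ?mem_nbrs //= e0 /=; congr (_ + _).
rewrite -e0 big_seq_cond (eq_bigr (fun=> F (d x y).+1)); last first.
  by move=> z /andP[]; rewrite mem_nbrs => az zz; rewrite (far z).
rewrite -big_seq_cond big_const_seq iter_addr_0 mulr_natl; congr (_ *+ _).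
have := count_predC (pred1 z0) (nbrs x).
rewrite count_uniq_mem ?uniq_nbrs // mem_nbrs a0 size_nbrs => -[<-].
by apply: eq_count => z.
Qed.

Lemma sum_nbrs_root (K : nzRingType) (F : nat -> K) x :
  \sum_(z <- nbrs x) F (d z x) = Q.+1%:R * F 1%N.
Proof.
rewrite big_seq (eq_bigr (fun=> F 1%N)); last first.
  move=> z; rewrite mem_nbrs => az; congr F; apply/eqP; rewrite eqn_leq.
  have -> /= : (d z x <= 1)%N.
    by rewrite -(gdistxx x); apply: gdist_adj_le; rewrite tree_sym.
  rewrite lt0n gdist_eq0.
  by apply: contraTneq az => ->; rewrite tree_irr.
by rewrite -big_seq big_const_seq count_predT size_nbrs iter_addr_0 mulr_natl.
Qed.

Lemma gdist1 x y : (d x y == 1%N) = adj x y.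
Proof.
apply/eqP/idP => [h|a]; last first.
  apply/eqP; rewrite eqn_leq.
  have -> /= : (d x y <= 1)%N by rewrite -(gdistxx y); apply: gdist_adj_le.
  rewrite lt0n gdist_eq0.
  by apply: contraTneq a => ->; rewrite tree_irr.
by have [[|z [|? ?]] []] := gdist_walk x y; rewrite h // => _ /= /andP[a _] <-.
Qed.

(** The list may have repetitions; all that matters is that it contains the metric ball, since
    kernel sums may range over any duplicate-free list that covers the ball. *)
Fixpoint ball n (x : V) : seq V :=
  if n is n'.+1 then x :: flatten [seq ball n' z | z <- nbrs x] else [:: x].

Lemma mem_ball n x y : (d x y <= n)%N -> y \in ball n x.
Proof.
elim: n x => [|n IH] x /=; first by rewrite leqn0 gdist_eq0 inE eq_sym.
have [->|xy] := eqVneq x y; first by rewrite inE eqxx.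
have [z az e] := gdist_closer xy; rewrite e ltnS => /IH hz.
rewrite inE; apply/orP; right; apply/flatten_mapP; exists z => //.
by rewrite mem_nbrs.
Qed.

Section operators.
Context {K : comNzRingType}.

Definition adjop (f : V -> K) (x : V) : K := \sum_(z <- nbrs x) f z.

(** Carrying two consecutive terms makes the three-term recursion structural. The normalization by
    Q^(n/2) removes the square root, so that any commutative ring of scalars is allowed. *)
Fixpoint chebU_pair n (f : V -> K) : (V -> K) * (V -> K) :=
  if n is n'.+1 then
    let: (g, h) := chebU_pair n' f in
    (h, fun x => adjop h x - Q%:R * g x)
  else (f, adjop f).

(* Q^(n/2) U_n(B), where 2 sqrt(Q) B is the adjacency operator. *)
Definition chebU n (f : V -> K) : V -> K := (chebU_pair n f).1.

Lemma chebU0 f : chebU 0 f = f. Proof. by []. Qed.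

Lemma chebU1 f : chebU 1 f = adjop f. Proof. by []. Qed.

Lemma chebUSS n f x :
  chebU n.+2 f x = adjop (chebU n.+1 f) x - Q%:R * chebU n f x.
Proof. by rewrite /chebU /=; case: (chebU_pair n f) => g h. Qed.

Definition level n m : K := ((m <= n)%N && ~~ odd (n - m)%N)%:R.

Definition treeker n x y : K := level n (d x y).

Lemma treeker0 x y : treeker 0 x y = (x == y)%:R.
Proof. by rewrite /treeker /level leqn0 sub0n andbT gdist_eq0. Qed.

Lemma treeker_sym n x y : treeker n x y = treeker n y x.
Proof. by rewrite /treeker gdist_sym. Qed.

Lemma sum_treeker1 x y : \sum_(z <- nbrs x) treeker 0 z y = treeker 1 x y.
Proof.
rewrite /treeker; have [->|xy] := eqVneq x y.
  by rewrite sum_nbrs_root gdistxx /level /= mulr0.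
rewrite sum_nbrs // /level /= mulr0 addr0.
by move: xy; rewrite -gdist_eq0; case: (d x y) => [|[|?]].
Qed.

(** [level] is unchanged when both arguments are shifted by one. Hence the closer neighbour
    contributes the kernel of index n + 2, and the Q farther ones contribute Q times that of index
    n: the recursion of [chebU], read on kernels. *)
Lemma sum_treeker n x y :
  \sum_(z <- nbrs x) treeker n.+1 z y = treeker n.+2 x y + Q%:R * treeker n x y.
Proof.
rewrite /treeker; have [->|xy] := eqVneq x y.
  rewrite sum_nbrs_root gdistxx /level !subn0 /= negbK subSS subn0.
  by rewrite -natr1 mulrDl mul1r addrC.
rewrite sum_nbrs //; move: xy; rewrite -gdist_eq0; case: (d x y) => // m _.
Qed.

(** No summability of f is assumed, every value being a finite sum; the formula is applied to the
    ground state, which is not in l^2, as well as to l^2 functions. *)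
Lemma chebU_kernel n f x (L : seq V) : uniq L ->
  (forall y, (d x y <= n)%N -> y \in L) ->
  chebU n f x = \sum_(y <- L) treeker n x y * f y.
Proof.
move=> uL.
have base x0 : x0 \in L -> chebU 0 f x0 = \sum_(y <- L) treeker 0 x0 y * f y.
  move=> h; rewrite (bigD1_seq x0) //= treeker0 eqxx mul1r big1 ?addr0 //.
  by move=> y; rewrite eq_sym treeker0 => /negbTE ->; rewrite mul0r.
have step m x0 : (forall z, adj x0 z ->
    chebU m f z = \sum_(y <- L) treeker m z y * f y) ->
    adjop (chebU m f) x0 =
    \sum_(y <- L) (\sum_(z <- nbrs x0) treeker m z y) * f y.
  move=> h; rewrite /adjop big_seq.
  rewrite (eq_bigr (fun z => \sum_(y <- L) treeker m z y * f y)).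
    by rewrite -big_seq exchange_big; apply: eq_bigr => y _; rewrite -mulr_suml.
  by move=> z; rewrite mem_nbrs => /h.
have near m x0 z y : adj x0 z -> (d z y <= m)%N -> (d x0 y <= m.+1)%N.
  by move=> az le; apply: leq_trans (gdist_adj_le y az) _.
(* The recursion looks two steps back, so two consecutive indices are proved together, under the
   covering condition of the larger one. *)
suff main m x0 : (forall y, (d x0 y <= m.+1)%N -> y \in L) ->
    chebU m f x0 = \sum_(y <- L) treeker m x0 y * f y /\
    chebU m.+1 f x0 = \sum_(y <- L) treeker m.+1 x0 y * f y.
  case: n => [|n] h; last by have [] := main n x h.
  by apply: base; apply: h; rewrite gdistxx.
elim: m x0 => [|m IH] x0 h.
  split; first by apply: base; apply: h; rewrite gdistxx.
  rewrite chebU1 (step 0%N); first by apply: eq_bigr => y _; rewrite sum_treeker1.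
  by move=> z az; apply: base; apply: h; apply: near az _; rewrite gdistxx.
have [hm hm1] : _ /\ _ := IH x0 (fun y hy => h y (leqW hy)); split=> //.
rewrite chebUSS step; last first.
  by move=> z az; have [] := IH z (fun y hy => h y (near _ _ _ _ az hy)).
rewrite hm mulr_sumr -sumrB; apply: eq_bigr => y _.
by rewrite sum_treeker mulrDl mulrA addrK.
Qed.

End operators.
End tree_geometry.

(** * Kernel estimates on the tree *)

Section polynomial_times_geometric.
Context {R : realType}.

(** Multiplying the left-hand sum by 1 - rho leaves the differences of a, as a 0 = 0, and a boundary
    term of favourable sign. Each use lowers the degree of a polynomial by one. *)
Lemma summation_by_parts_le (a b : nat -> R) (rho : R) N : 0 <= rho < 1 ->
  a 0%N = 0 -> (forall n, 0 <= a n) -> (forall n, a n.+1 - a n <= b n) ->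
  \sum_(n < N) a n.+1 * rho ^+ n <= (1 - rho)^-1 * \sum_(n < N) b n * rho ^+ n.
Proof.
move=> /andP[r0 r1] a0 age ab; have r1' : 0 < 1 - rho by rewrite subr_gt0.
rewrite ler_pdivlMl // mulrBl mul1r.
have -> : rho * \sum_(n < N) a n.+1 * rho ^+ n =
    \sum_(n < N) a n * rho ^+ n + a N * rho ^+ N.
  rewrite -(big_ord_recr N (fun n : 'I_N.+1 => a n * rho ^+ n)) /=.
  rewrite big_ord_recl /= a0 mul0r add0r mulr_sumr.
  by apply: eq_bigr => i _; rewrite exprS /bump /=; ring.
rewrite opprD addrA -sumrB lerBlDr ler_wpDr ?mulr_ge0 ?exprn_ge0 //.
by apply: ler_sum => i _; rewrite -mulrBl ler_wpM2r ?exprn_ge0.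
Qed.

Lemma cubic_geometric_bounded (rho : R) : 0 <= rho < 1 ->
  exists2 C, 0 < C & forall N, \sum_(n < N) n.+1%:R ^+ 3 * rho ^+ n <= C.
Proof.
move=> hr; have /andP[r0 r1] := hr; set c := (1 - rho)^-1.
have c0 : 0 < c by rewrite invr_gt0 subr_gt0.
(* The factors 3 and 2 come from (n + 1)^3 - n^3 <= 3 (n + 1)^2 and (n + 1)^2 - n^2 <= 2 (n + 1);
   each summation by parts adds a factor c, and 1 + c dominates the geometric series. *)
exists (c * (3 * (c * (2 * (c * (1 + c))))))%R.
  by rewrite !(mulr_gt0, addr_gt0).
move=> N; have h := @summation_by_parts_le (fun n => n%:R ^+ 3)
  (fun n => 3 * n.+1%:R ^+ 2) rho N hr.
apply: le_trans (h _ _ _) _; rewrite ?expr0n //.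
  by move=> n; rewrite -natr1; have := ler0n R n; nra.
rewrite ler_wpM2l ?(ltW c0) //.
under eq_bigr do rewrite -mulrA.
rewrite -mulr_sumr ler_wpM2l //; clear h.
have h := @summation_by_parts_le (fun n => n%:R ^+ 2)
  (fun n => 2 * n.+1%:R) rho N hr.
apply: le_trans (h _ _ _) _; rewrite ?expr0n //.
  by move=> n; rewrite -natr1; have := ler0n R n; nra.
rewrite ler_wpM2l ?(ltW c0) //.
under eq_bigr do rewrite -mulrA.
rewrite -mulr_sumr ler_wpM2l //; clear h.
have h := @summation_by_parts_le (fun n => n%:R) (fun n => 1) rho N hr.
apply: le_trans (h _ _ _) _; rewrite ?expr0n //.
  by move=> n; rewrite -natr1; lra.
rewrite ler_wpM2l ?(ltW c0) //.
under eq_bigr do rewrite mul1r.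
have -> : \sum_(n < N) rho ^+ n = c * (1 - rho ^+ N).
  have := subrX1 rho N; rewrite /c => e.
  rewrite -[1 - rho ^+ N]opprB e -mulNr opprB mulrA mulVf ?mul1r //.
  by rewrite subr_eq0 gt_eqF.
apply: (@le_trans _ _ c); last by rewrite lerDr.
by rewrite -[leRHS]mulr1 ler_wpM2l ?(ltW c0) // gerBl exprn_ge0.
Qed.

End polynomial_times_geometric.

(** * Schur's test against the spherical function *)

Section kernel_estimates.
Context {R : realType} {V : pointedType} (Q : nat) (adj : rel V).
Hypotheses (Q2 : (2 <= Q)%N) (ht : homogeneous_tree Q adj).

Local Notation s := (Num.sqrt (Q%:R : R)).
Local Notation ker n x y := (treeker (K := R) adj n x y).

Lemma sqrtQ_gt1 : 1 < s.
Proof. 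
have Q1 : (1 : R) < Q%:R by rewrite ltr1n.
by rewrite -[ltLHS]sqrtr1 ltr_sqrt // (lt_trans ltr01).
 Qed.

Lemma sqrtQ_gt0 : 0 < s.
Proof. exact: lt_trans sqrtQ_gt1. Qed.

Lemma sqr_sqrtQ : s ^+ 2 = Q%:R.
Proof. by rewrite sqr_sqrtr. Qed.

(* The spherical function at the bottom of the l^2 spectrum. *)
Definition ground_state (o x : V) : R :=
  (1 + (gdist adj x o)%:R * ((Q%:R - 1) / (Q%:R + 1))) * s ^- (gdist adj x o).

Lemma ground_state_gt0 o x : 0 < ground_state o x.
Proof.
rewrite mulr_gt0 ?invr_gt0 ?exprn_gt0 ?sqrtQ_gt0 //.
have Q1 : (0 : R) <= Q%:R - 1 by rewrite subr_ge0 ler1n ltnW.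
by rewrite ltr_pwDl // mulr_ge0 // divr_ge0 // addr_ge0.
Qed.

(** Away from the root, any affine function of the distance times s^-d satisfies the equation, 2 s
    being a double-root eigenvalue of the radial recursion; the slope (Q - 1) / (Q + 1) is forced by
    the equation at the root. *)
Lemma adjop_ground_state o x :
  adjop adj (ground_state o) x = 2 * s * ground_state o x.
Proof.
have s0 : s != 0 by rewrite gt_eqF // sqrtQ_gt0.
have Qs : (Q%:R : R) = s * s by rewrite -expr2 sqr_sqrtQ.
have Q1 : (s * s + 1 : R) != 0.
  by rewrite gt_eqF // ltr_wpDl ?mulr_ge0 ?ltr01 ?sqrtr_ge0.
pose F m := (1 + m%:R * ((Q%:R - 1) / (Q%:R + 1))) * s ^- m : R.
rewrite /adjop /ground_state; have [->|xo] := eqVneq x o.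
  rewrite (sum_nbrs_root ht F) gdistxx /F.
  rewrite -[Q.+1%:R]natr1 expr1 expr0.
  move: {F} s s0 Qs Q1 => r r0 -> Q1; field.
  by rewrite r0 Q1.
rewrite (sum_nbrs ht F xo); move: xo; rewrite -(gdist_eq0 ht).
case: (gdist adj x o) => // m _; rewrite {}/F /= !exprS -!natr1.
move: s s0 Qs Q1 => r r0 -> Q1; field.
by rewrite expf_neq0 // r0 Q1.
Qed.

(** The normalized adjacency operator B acts on the ground state as the scalar 1, and U_n(1) = n +
    1. *)
Lemma chebU_ground_state n o x :
  chebU Q adj n (ground_state o) x = n.+1%:R * s ^+ n * ground_state o x.
Proof.
suff main : (forall x, chebU Q adj n (ground_state o) x =
    n.+1%:R * s ^+ n * ground_state o x) /\
  (forall x, chebU Q adj n.+1 (ground_state o) x =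
    n.+2%:R * s ^+ n.+1 * ground_state o x) by case: main.
elim: n {x} => [|n [IH0 IH1]].
  by split=> x; rewrite ?chebU1 ?adjop_ground_state ?expr1 ?chebU0 ?expr0 ?mul1r.
split=> // x; rewrite chebUSS IH0.
have -> : adjop adj (chebU Q adj n.+1 (ground_state o)) x =
   n.+2%:R * s ^+ n.+1 * adjop adj (ground_state o) x.
  by rewrite /adjop mulr_sumr; apply: eq_bigr.
rewrite adjop_ground_state; move: s sqr_sqrtQ => r <-.
by rewrite !exprS -!natr1; ring.
Qed.

Lemma treeker_ge0 n x y : 0 <= ker n x y.
Proof. by rewrite /treeker /level ler0n. Qed.

Lemma treeker_le1 n x y : ker n x y <= 1.
Proof. by rewrite /treeker /level; case: (_ && _). Qed.

Lemma treeker_ground_state n o x (F : seq V) : uniq F ->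
  \sum_(y <- F) ker n x y * ground_state o y <=
  n.+1%:R * s ^+ n * ground_state o x.
Proof.
move=> uF; pose L := undup (F ++ ball adj n x).
have sub : {subset F <= L} by move=> y; rewrite mem_undup mem_cat => ->.
have uL : uniq L by exact: undup_uniq.
rewrite -chebU_ground_state (chebU_kernel ht _ uL); last first.
  by move=> y /(mem_ball ht) h; rewrite mem_undup mem_cat h orbT.
rewrite [leRHS](bigID (mem F) predT) /= -[leLHS]addr0 lerD //; last first.
  by rewrite sumr_ge0 // => y _; rewrite mulr_ge0 ?treeker_ge0 ?ltW ?ground_state_gt0.
rewrite -[leRHS]big_filter (perm_big [seq i <- L | i \in F]) //=.
apply: uniq_perm; rewrite ?filter_uniq // => y; rewrite mem_filter.
by apply/idP/andP => [h|[]//]; split=> //; exact: sub.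
Qed.

(** The bracket is the AM-GM majorant of the square root of A y * B x, weighted by the ground state.
    In each of its two halves one variable can be summed by [treeker_ground_state], the kernel being
    symmetric. *)
Lemma treeker_schur n o (A B : V -> R) (F G : seq V) : uniq F -> uniq G ->
  (forall x, 0 <= A x) -> (forall x, 0 <= B x) ->
  \sum_(x <- G) \sum_(y <- F) ker n x y *
     ((A y * (ground_state o x / ground_state o y) +
       B x * (ground_state o y / ground_state o x)) / 2) <=
  n.+1%:R * s ^+ n * ((\sum_(y <- F) A y + \sum_(x <- G) B x) / 2).
Proof.
move=> uF uG A0 B0; set w := ground_state o.
have w0 x : w x != 0 by rewrite gt_eqF // ground_state_gt0.
have wp x : 0 < w x by exact: ground_state_gt0.
have -> : \sum_(x <- G) \sum_(y <- F) ker n x y *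
     ((A y * (w x / w y) + B x * (w y / w x)) / 2) =
  (\sum_(y <- F) A y / w y * (\sum_(x <- G) ker n y x * w x) +
   \sum_(x <- G) B x / w x * (\sum_(y <- F) ker n x y * w y)) / 2.
  under [X in X + _]eq_bigr do rewrite mulr_sumr.
  under [X in _ + X]eq_bigr do rewrite mulr_sumr.
  rewrite [X in X + _]exchange_big -big_split mulr_suml; apply: eq_bigr => x _ /=.
  rewrite -big_split mulr_suml; apply: eq_bigr => y _ /=.
  by rewrite (treeker_sym ht n y x); ring.
rewrite mulrA ler_pM2r ?invr_gt0 // mulrDr lerD // mulr_sumr ler_sum // => x _.
- apply: (@le_trans _ _ (A x / w x * (n.+1%:R * s ^+ n * w x))).
    apply: ler_wpM2l; last exact: treeker_ground_state.
    by apply: divr_ge0 => //; exact: ltW.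
  by rewrite [leLHS](_ : _ = n.+1%:R * s ^+ n * A x) //; field.
- apply: (@le_trans _ _ (B x / w x * (n.+1%:R * s ^+ n * w x))).
    apply: ler_wpM2l; last exact: treeker_ground_state.
    by apply: divr_ge0 => //; exact: ltW.
  by rewrite [leLHS](_ : _ = n.+1%:R * s ^+ n * B x) //; field.
Qed.

End kernel_estimates.

(** Young's inequality with exponents 1 / (1 - th) and 1 / th. The powers of lam cancel in the
    product on the left, so lam is free to balance the two terms on the right. *)
Lemma weighted_amgm {R : realType} (X Y th lam : R) :
  0 <= X -> 0 <= Y -> 0 < th < 1 -> 0 < lam ->
  X `^ (1 - th) * Y `^ th <=
  (1 - th) * (lam `^ th * X) + th * (lam `^ (th - 1) * Y).
Proof.
move=> X0 Y0 /andP[t0 t1] l0; have t1' : 0 < 1 - th by rewrite subr_gt0.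
have := @conjugate_powR R ((lam `^ th * X) `^ (1 - th))
  ((lam `^ (th - 1) * Y) `^ th) (1 - th)^-1 th^-1.
rewrite !powR_ge0 !invr_gt0 !invrK -!powRrM !mulfV ?gt_eqF // !powRr1;
  try by rewrite mulr_ge0 // powR_ge0.
rewrite ![_ * (1 - th)]mulrC ![_ * th]mulrC => /(_ isT isT t1' t0).
move=> /(_ (subrK _ _)); apply: le_trans; rewrite le_eqVlt; apply/orP; left.
rewrite !powRM ?powR_ge0 // -!powRrM mulrACA -powRD ?(gt_eqF l0) ?implybT //.
by rewrite [X in lam `^ X](_ : _ = 0) ?powRr0 ?mul1r //; ring.
Qed.

(** * Interpolation between the two kernel bounds *)

Section interpolation.
Context {R : realType} {V : pointedType} (Q : nat) (adj : rel V).
Hypotheses (Q2 : (2 <= Q)%N) (ht : homogeneous_tree Q adj).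

Local Notation s := (Num.sqrt (Q%:R : R)).
Local Notation ker n x y := (treeker (K := R) adj n x y).

(* Complex interpolation between the bound s^-n from l^1 to l^oo and Schur's
   bound (n + 1) on l^2, done by hand with the weighted AM-GM inequality. *)
Lemma treeker_interpolation n (th : R) (A B : V -> R) (F G : seq V) :
  0 < th < 1 -> uniq F -> uniq G ->
  (forall x, 0 <= A x) -> (forall x, 0 <= B x) ->
  \sum_(y <- F) A y <= 1 -> \sum_(x <- G) B x <= 1 ->
  s ^- n * \sum_(x <- G) \sum_(y <- F) ker n x y * (A y * B x) `^ (1 - th / 2)
    <= n.+1%:R * (s `^ (th - 1)) ^+ n.
Proof.
move=> th01 uF uG A0 B0 A1 B1; have /andP[t0 t1] := th01.
have s0 : 0 < s by apply: sqrtQ_gt0.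
pose o : V := point; pose w := ground_state (R := R) Q adj o.
have wp x : 0 < w x by apply: ground_state_gt0.
(* For this lam the two terms of the AM-GM split balance: the bound ker <= 1 on the first and
   Schur's bound on the second give lam^th, up to the factors 1 - th and th (n + 1). *)
pose lam := s ^+ n; have l0 : 0 < lam by rewrite exprn_gt0.
pose Y x y := (A y * (w x / w y) + B x * (w y / w x)) / 2.
have Y0 x y : 0 <= Y x y.
  by rewrite divr_ge0 // addr_ge0 // mulr_ge0 // divr_ge0 // ltW.
(* The exponent splits as (1 - th) + th / 2. The power th then falls on the square root of A y * B
   x, which is at most Y x y because the two ground state ratios are inverse to each other. *)
have pt x y : (A y * B x) `^ (1 - th / 2) <=
    (1 - th) * (lam `^ th * (A y * B x)) + th * (lam `^ (th - 1) * Y x y).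
  have AB0 : 0 <= A y * B x by rewrite mulr_ge0.
  apply: le_trans (weighted_amgm AB0 (Y0 x y) th01 l0).
  have -> : 1 - th / 2 = (1 - th) + 2^-1 * th by field.
  rewrite powRD; last by rewrite gt_eqF //; lra.
  rewrite ler_wpM2l ?powR_ge0 // powRrM ge0_ler_powR ?nnegrE ?powR_ge0 ?(ltW t0) //.
  rewrite powR12_sqrt // -(@ler_pXn2r _ 2) ?nnegrE ?sqrtr_ge0 // sqr_sqrtr //.
  have rr : (w x / w y) * (w y / w x) = 1 by field; rewrite !gt_eqF.
  have -> : A y * B x = (A y * (w x / w y)) * (B x * (w y / w x)).
    by rewrite mulrACA rr mulr1.
  rewrite /Y; set a := A y * _; set b := B x * _.
  have := sqr_ge0 (a - b); nra.
have kt1 : lam `^ (th - 1) = (s `^ (th - 1)) ^+ n.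
  rewrite /lam -(powR_mulrn n (ltW s0)) -powRrM.
  by rewrite -(powR_mulrn n (powR_ge0 _ _)) -powRrM mulrC.
have kl : lam `^ th = lam * lam `^ (th - 1).
  by rewrite -[X in X * _](powRr1 (ltW l0)) -powRD ?(gt_eqF l0) ?implybT // addrC subrK.
rewrite -kt1; set kap := lam `^ (th - 1); have kap0 : 0 <= kap by apply: powR_ge0.
rewrite ler_pdivrMl //.
apply: (@le_trans _ _ (\sum_(x <- G) \sum_(y <- F)
   ((1 - th) * (lam * kap) * (A y * B x) + th * kap * (ker n x y * Y x y)))).
  apply: ler_sum => x _; apply: ler_sum => y _.
  have k0 := treeker_ge0 (R := R) adj n x y.
  have k1 := treeker_le1 (R := R) adj n x y.
  apply: le_trans (ler_wpM2l k0 (pt x y)) _; rewrite kl mulrDr lerD //; last first.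
    by rewrite le_eqVlt; apply/orP; left; apply/eqP; rewrite /kap; ring.
  have h0 : 0 <= (1 - th) * (lam * kap) * (A y * B x).
    by rewrite mulr_ge0 // mulr_ge0 ?mulr_ge0 // ?subr_ge0 ltW.
  rewrite (_ : (1 - th) * (_ * _) = (1 - th) * (lam * kap) * (A y * B x)).
    by rewrite -[leRHS]mul1r ler_wpM2r.
  by rewrite /kap; ring.
set S := \sum_(x <- G) \sum_(y <- F) ker n x y * Y x y.
rewrite (_ : \sum_(x <- G) _ = (1 - th) * (lam * kap) *
    ((\sum_(y <- F) A y) * (\sum_(x <- G) B x)) + th * kap * S); last first.
  under eq_bigr do rewrite big_split -!mulr_sumr /=.
  rewrite big_split -!mulr_sumr /=; congr (_ * _ + _).
  by rewrite mulr_sumr; apply: eq_bigr => x _; rewrite mulr_suml.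
have AB : (\sum_(y <- F) A y) * (\sum_(x <- G) B x) <= 1.
  by rewrite -[leRHS]mulr1 ler_pM // sumr_ge0.
have Sb : S <= n.+1%:R * lam.
  apply: le_trans (treeker_schur Q2 ht n o uF uG A0 B0) _.
  rewrite -[leRHS]mulr1 ler_wpM2l ?mulr_ge0 ?(ltW l0) //; lra.
have lk0 : 0 <= (1 - th) * (lam * kap) by rewrite mulr_ge0 ?mulr_ge0 // ?subr_ge0 ltW.
apply: le_trans (lerD (ler_wpM2l lk0 AB) (ler_wpM2l _ Sb)) _.
  by rewrite mulr_ge0 // ltW.
have n0 := ler0n R n; have kl0 : 0 <= lam * kap by rewrite mulr_ge0 // ltW.
rewrite mulr1 (_ : _ + _ = (lam * kap) * (1 + th * n%:R)); last by rewrite -natr1; ring.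
rewrite [leRHS](_ : _ = (lam * kap) * n.+1%:R); last by rewrite /kap /lam; ring.
by rewrite ler_wpM2l // -natr1; nra.
Qed.

End interpolation.

(** * Oscillatory integrals *)

Section calculus.
Context {R : realType}.
Implicit Types f g F G : R -> R.

(** Differentiability is asked on the whole line: all functions integrated over [0, pi] have it, and
    no one-sided derivative arises at the endpoints. *)
Definition derives F f := forall x : R, is_derive x (1 : R) F (f x).

Lemma derives_eq F f g : derives F f -> f =1 g -> derives F g.
Proof. by move=> h e x; apply: is_derive_eq (h x) (e x). Qed.

Lemma derives_cst (a : R) : derives (fun=> a) (fun=> 0).
Proof. by move=> x; apply: is_derive_cst. Qed.

Lemma derives_id : derives (fun x => x) (fun=> 1).
Proof. by move=> x; apply: is_derive_id. Qed.

Lemma derivesD F f G g : derives F f -> derives G g ->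
  derives (fun x => F x + G x) (fun x => f x + g x).
Proof. by move=> hF hG x; apply: is_deriveD. Qed.

Lemma derivesN F f : derives F f -> derives (fun x => - F x) (fun x => - f x).
Proof. by move=> hF x; apply: is_deriveN. Qed.

Lemma derivesM F f G g : derives F f -> derives G g ->
  derives (fun x => F x * G x) (fun x => f x * G x + F x * g x).
Proof.
move=> hF hG x; apply: is_derive_eq (is_deriveM (hF x) (hG x)) _.
by rewrite addrC [_ *: f x]mulrC.
Qed.

Lemma derivesV F f : (forall x, F x != 0) -> derives F f ->
  derives (fun x => (F x)^-1) (fun x => - f x / F x ^+ 2).
Proof.
move=> F0 hF x; apply: is_derive_eq (is_deriveV (F0 x) (hF x)) _.
by rewrite mulNr mulrC scaleNr.
Qed.

Lemma derives_comp F f G g : derives F f -> derives G g ->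
  derives (fun x => F (G x)) (fun x => f (G x) * g x).
Proof. by move=> hF hG x; apply: (is_derive1_comp (hF _) (hG x)). Qed.

Lemma derives_sin : derives (@sin R) (@cos R).
Proof. by move=> x; apply: is_derive_sin. Qed.

Lemma derives_cos : derives (@cos R) (fun x => - sin x).
Proof. by move=> x; apply: is_derive_cos. Qed.

Lemma derives_atan : derives (@atan R) (fun x => (1 + x ^+ 2)^-1).
Proof. by move=> x; apply: is_derive1_atan. Qed.

Lemma derives_powR a F f : (forall x, 0 < F x) -> derives F f ->
  derives (fun x => F x `^ a) (fun x => a * F x `^ (a - 1) * f x).
Proof.
move=> F0 hF x.
exact: (is_derive1_comp (is_derive1_powR a (F0 x)) (hF x)).
Qed.

Lemma derives_continuous F f : derives F f -> continuous F.
Proof.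
move=> hF x; apply: differentiable_continuous; apply/derivable1_diffP.
exact: ex_derive.
Qed.

Lemma fun_continuousD f g : continuous f -> continuous g ->
  continuous (fun x => f x + g x).
Proof. by move=> hf hg x; apply: cvgD; [apply: hf | apply: hg]. Qed.

Lemma fun_continuousN f : continuous f -> continuous (fun x => - f x).
Proof. by move=> hf x; apply: cvgN; apply: hf. Qed.

Lemma fun_continuousM f g : continuous f -> continuous g ->
  continuous (fun x => f x * g x).
Proof. by move=> hf hg x; apply: cvgM; [apply: hf | apply: hg]. Qed.

Lemma fun_continuousV f : (forall x, f x != 0) -> continuous f ->
  continuous (fun x => (f x)^-1).
Proof. by move=> f0 hf x; apply: cvgV => //; apply: hf. Qed.

Lemma fun_continuous_comp f g : continuous f -> continuous g ->
  continuous (fun x => f (g x)).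
Proof. by move=> hf hg x; apply: continuous_comp; [apply: hg | apply: hf]. Qed.

Lemma fun_continuous_norm f : continuous f -> continuous (fun x => `|f x|).
Proof. by move=> hf x; apply: cvg_norm; apply: hf. Qed.

Definition int0pi f : R := Rintegral lebesgue_measure `[0, pi]%classic f.

Lemma int0pi_integrable f : continuous f ->
  lebesgue_measure.-integrable `[0, (pi : R)]%classic (EFin \o f).
Proof.
move=> cf; apply: continuous_compact_integrable; first exact: segment_compact.
exact: continuous_subspaceT.
Qed.

Lemma int0piD f g : continuous f -> continuous g ->
  int0pi (fun x => f x + g x) = int0pi f + int0pi g.
Proof. by move=> cf cg; apply: RintegralD => //; apply: int0pi_integrable. Qed.

Lemma int0piZ a f : continuous f -> int0pi (fun x => a * f x) = a * int0pi f.
Proof. by move=> cf; apply: RintegralZl => //; apply: int0pi_integrable. Qed.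

Lemma int0pi_le f g : continuous f -> continuous g ->
  (forall x, 0 <= x <= pi -> f x <= g x) -> int0pi f <= int0pi g.
Proof.
move=> cf cg h; apply: le_Rintegral => //; try exact: int0pi_integrable.
Qed.

Lemma int0pi_norm f g : continuous f -> continuous g ->
  (forall x, 0 <= x <= pi -> `|f x| <= g x) -> `|int0pi f| <= int0pi g.
Proof.
move=> cf cg h.
apply: le_trans (le_normr_Rintegral _ (int0pi_integrable cf)) _ => //.
by apply: int0pi_le => //; apply: fun_continuous_norm.
Qed.

Lemma eq_int0pi f g : f =1 g -> int0pi f = int0pi g.
Proof. by move=> /funext ->. Qed.

Lemma int0pi_derives F f : derives F f -> continuous f ->
  int0pi f = F pi - F 0.
Proof.
move=> hF cf; rewrite /int0pi /Rintegral (@continuous_FTC2 _ f F) ?pi_gt0 //.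
- exact: continuous_subspaceT.
- have cF := derives_continuous hF; split.
  + by move=> x _; apply: ex_derive.
  + by apply: cvg_at_right_filter; apply: cF.
  + by apply: cvg_at_left_filter; apply: cF.
- by move=> x _; rewrite derive1E; apply: derive_val.
Qed.

Lemma int0pi_cst (a : R) : int0pi (fun=> a) = a * pi.
Proof.
rewrite (@int0pi_derives (fun x => a * x)) ?mulr0 ?subr0 //.
  by apply: derives_eq (derivesM (derives_cst a) derives_id) _ => x /=; ring.
exact: cst_continuous.
Qed.

End calculus.

(** * Stationary phase at the two endpoints *)

Section oscillatory_integral.
Context {R : realType}.

Let D (delta x : R) := sin x ^+ 2 + delta ^+ 2.

Let D_gt0 delta x : 0 < delta -> 0 < D delta x.
Proof. by move=> d0; rewrite ltr_wpDl ?sqr_ge0 ?exprn_gt0. Qed.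

Let derivesD2 delta : derives (D delta) (fun x => 2 * sin x * cos x).
Proof.
apply: derives_eq (derivesD (derivesM derives_sin derives_sin)
  (derives_cst (delta ^+ 2))) _ => x.
by ring.
Qed.

Let cD delta : continuous (D delta).
Proof. exact: derives_continuous (derivesD2 delta). Qed.

Let csin : continuous (@sin R). Proof. exact: derives_continuous derives_sin. Qed.

Let ccos : continuous (@cos R). Proof. exact: derives_continuous derives_cos. Qed.

Let catan : continuous (@atan R). Proof. exact: derives_continuous derives_atan. Qed.

Let prod_le (a b A B : R) : `|a| <= A -> `|b| <= B -> `|a * b| <= A * B.
Proof. by move=> ha hb; rewrite normrM ler_pM. Qed.

(** The integrand is compared with the derivative of cos x * atan (sin x / delta) / delta, which
    integrates to 0 since sin vanishes at both ends. Its leading term cos^2 / D is (1 + delta^2) / D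
    - 1, and the remaining one is at most pi / delta. *)
Lemma int0pi_inv_sin2 (delta : R) : 0 < delta -> delta <= 1 ->
  int0pi (fun x => (sin x ^+ 2 + delta ^+ 2)^-1) <= (1 + pi) * pi / delta.
Proof.
move=> d0 d1; have dn : delta != 0 by rewrite gt_eqF.
have Dn x : D delta x != 0 by rewrite gt_eqF // D_gt0.
have cDV : continuous (fun x => (D delta x)^-1) by apply: fun_continuousV.
pose f x := cos x ^+ 2 / D delta x - sin x * atan (sin x / delta) / delta.
have hF : derives (fun x => cos x * atan (sin x / delta) / delta) f.
  have hs := derives_comp derives_atan
    (derivesM derives_sin (derives_cst delta^-1)).
  apply: derives_eq (derivesM (derivesM derives_cos hs) (derives_cst _)) _ => x /=.
  rewrite /f; have := Dn x; rewrite /D => Dx.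
  have -> : (1 + (sin x / delta) ^+ 2)^-1 = delta ^+ 2 / (sin x ^+ 2 + delta ^+ 2).
    have -> : sin x ^+ 2 + delta ^+ 2 = delta ^+ 2 * (1 + (sin x / delta) ^+ 2).
      by field.
    rewrite invfM mulrA mulfV ?mul1r // expf_neq0 //.
  by field; rewrite dn.
have cf : continuous f.
  apply: fun_continuousD; first by apply: fun_continuousM => //; apply: fun_continuousM.
  apply: fun_continuousN; apply: fun_continuousM; last exact: cst_continuous.
  apply: fun_continuousM => //.
  apply: (@fun_continuous_comp _ _ (fun x => sin x / delta)) => //.
  by apply: fun_continuousM => //; exact: cst_continuous.
have -> : (1 + pi) * pi / delta = int0pi f + int0pi (fun=> (1 + pi) / delta).
  rewrite (int0pi_derives hF cf) int0pi_cst sinpi sin0 !mul0r atan0 !mulr0 !mul0r.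
  by rewrite subr0 add0r; ring.
rewrite -int0piD //; last exact: cst_continuous.
apply: int0pi_le => //; first by apply: fun_continuousD => //; exact: cst_continuous.
move=> x _; rewrite -/(D delta x) /f.
have Dp := @D_gt0 delta x d0.
have e : cos x ^+ 2 / D delta x = (1 + delta ^+ 2) / D delta x - 1.
  have -> : cos x ^+ 2 = (1 + delta ^+ 2) - D delta x.
    by rewrite /D -(cos2Dsin2 x); ring.
  by rewrite mulrBl mulfV.
rewrite e.
have h1 : (D delta x)^-1 <= (1 + delta ^+ 2) / D delta x.
  by rewrite ler_peMl ?invr_ge0 ?(ltW Dp) // lerDl sqr_ge0.
have h2 : sin x * atan (sin x / delta) / delta <= pi / delta.
  rewrite ler_pM2r ?invr_gt0 //.
  apply: le_trans (ler_norm _) _; rewrite normrM -[leRHS]mul1r ler_pM //.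
    by rewrite ler_norml sin_geN1 sin_le1.
  have := @atan_ltpi2 R (sin x / delta); have := @atan_gtNpi2 R (sin x / delta).
  by have := @pi_gt0 R; rewrite ler_norml; lra.
have h3 : 1 <= delta^-1 by rewrite invf_ge1.
rewrite [(1 + pi) / delta]mulrDl mul1r; lra.
Qed.

Variables (psi psi1 m m1 m2 : R -> R) (K : R).
Hypotheses (hpsi : derives psi psi1) (hm : derives m m1) (hm1 : derives m1 m2).
Hypotheses (cm2 : continuous m2) (psim : forall x, psi1 x * m x = sin x).
Hypotheses (mK : forall x, `|m x| <= K) (m1K : forall x, `|m1 x| <= K)
  (m2K : forall x, `|m2 x| <= K).

(* Two integrations by parts.  The first one uses up the factor sin; in the
   second one the missing factor sin^2 is created by splitting
   1 = sin^2 / D + delta^2 / D with D = sin^2 + delta^2 and t delta^2 = 1. *)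
Lemma stationary_endpoints_bound (e0 e1 e2 : R -> R) (N : R) (t : R) :
  1 <= N -> 1 <= t ->
  derives e1 (fun x => t * psi1 x * e0 x) ->
  derives e2 (fun x => t * psi1 x * e1 x) ->
  continuous e0 ->
  (forall x, `|e1 x| <= 1) -> (forall x, `|e2 x| <= 1) ->
  sin (N * pi) = 0 ->
  `|int0pi (fun x => e0 x * (sin x * sin (N * x)))| <=
  (2 + 8 * K) * K * (1 + pi) * pi * N ^+ 2 * (t * Num.sqrt t)^-1.
Proof.
move=> N1 t1 he1 he2 ce0 e11 e21 sN.
have K0 : 0 <= K by apply: le_trans (mK 0).
have t0 : 0 < t by apply: lt_le_trans t1.
have ce1 := derives_continuous he1; have ce2 := derives_continuous he2.
have cm := derives_continuous hm; have cm1 := derives_continuous hm1.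
pose S x := sin (N * x); pose C x := cos (N * x).
have hNx : derives (fun x => N * x) (fun=> N).
  by apply: derives_eq (derivesM (derives_cst N) derives_id) _ => x; ring.
have hS : derives S (fun x => C x * N) := derives_comp derives_sin hNx.
have hC : derives C (fun x => - S x * N) := derives_comp derives_cos hNx.
have cS := derives_continuous hS; have cC := derives_continuous hC.
have S1 x : `|S x| <= 1 by rewrite ler_norml sin_geN1 sin_le1.
have C1 x : `|C x| <= 1 by rewrite ler_norml cos_geN1 cos_le1.
have s1 x : `|sin x : R| <= 1 by rewrite ler_norml sin_geN1 sin_le1.
have c1 x : `|cos x : R| <= 1 by rewrite ler_norml cos_geN1 cos_le1.
(* h is the derivative of m S, and h1 that of h. Each derivative of S costs a factor N, whence the
   N^2 of the final bound. *)
pose h x := m1 x * S x + m x * (C x * N).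
pose h1 x := m2 x * S x + m1 x * (C x * N) + (m1 x * (C x * N) + m x * ((- S x * N) * N)).
have hh : derives h h1.
  apply: derives_eq (derivesD (derivesM hm1 hS)
     (derivesM hm (derivesM hC (derives_cst N)))) _ => x.
  by rewrite /h1 mulr0 addr0.
have ch := derives_continuous hh.
have ch1 : continuous h1.
  repeat first [assumption | apply: fun_continuousD | apply: fun_continuousM
    | apply: fun_continuousN | exact: cst_continuous].
have N0 : 0 <= N by apply: le_trans N1.
have hb x : `|h x| <= 2 * K * N.
  apply: le_trans (ler_normD _ _) _.
  have := prod_le (m1K x) (S1 x).
  have : `|m x * (C x * N)| <= K * (1 * N).
    by apply: prod_le => //; apply: prod_le => //; rewrite ger0_norm.
  nra.
have h1b x : `|h1 x| <= 4 * K * N ^+ 2.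
  have a1 : `|m2 x * S x| <= K * 1 by apply: prod_le.
  have a2 : `|m1 x * (C x * N)| <= K * (1 * N).
    by apply: prod_le => //; apply: prod_le => //; rewrite ger0_norm.
  have a3 : `|m x * ((- S x * N) * N)| <= K * ((1 * N) * N).
    by repeat (apply: prod_le => //); rewrite ?normrN // ger0_norm.
  have : `|h1 x| <= K * 1 + K * (1 * N) + (K * (1 * N) + K * (1 * N * N)).
    apply: le_trans (ler_normD _ _) _; apply: lerD.
      by apply: le_trans (ler_normD _ _) _; apply: lerD.
    by apply: le_trans (ler_normD _ _) _; apply: lerD.
  move=> /le_trans; apply.
  have N2 : N <= N ^+ 2 by rewrite expr2; nra.
  have := ler_wpM2l K0 N2; have := ler_wpM2l K0 (le_trans N1 N2); nra.
(* As psi1 m = sin, the product e1 m S has derivative t e0 sin S + e1 h. It vanishes at 0 and pi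
   together with S, which is what sin (N pi) = 0 is for. *)
have ibp1 : t * int0pi (fun x => e0 x * (sin x * S x)) = - int0pi (fun x => e1 x * h x).
  have hP := derivesM he1 (derivesM hm hS).
  have cP : continuous (fun x => t * (e0 x * (sin x * S x)) + e1 x * h x).
    repeat first [assumption | apply: fun_continuousD | apply: fun_continuousM
      | apply: fun_continuousN | exact: cst_continuous].
  have hP' := derives_eq hP (_ : _ =1 (fun x => t * (e0 x * (sin x * S x)) + e1 x * h x)).
  have := int0pi_derives (hP' _) cP.
  rewrite int0piD; last 2 first.
  - repeat first [assumption | apply: fun_continuousM | exact: cst_continuous].
  - exact: fun_continuousM.
  rewrite int0piZ; last by repeat first [assumption | apply: fun_continuousM].
  rewrite /S sN !mulr0 sin0 !mulr0 subrr => e.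
  apply/eqP; rewrite -subr_eq0 opprK; apply/eqP/e => x.
  by rewrite -[sin x]psim /h /S; ring.
pose delta := (Num.sqrt t)^-1.
have st0 : 0 < Num.sqrt t by rewrite sqrtr_gt0.
have d0 : 0 < delta by rewrite invr_gt0.
have d1 : delta <= 1.
  by rewrite invf_le1 // -[leLHS]sqrtr1 ler_wsqrtr.
have td : t * delta ^+ 2 = 1.
  by rewrite /delta exprVn sqr_sqrtr ?mulfV ?gt_eqF // ltW.
have Dn x : D delta x != 0 by rewrite gt_eqF // D_gt0.
have cDV : continuous (fun x => (D delta x)^-1) by apply: fun_continuousV.
(* k is the derivative of m h sin / D, which again vanishes at both ends. It is O(N^2 / D), so that
   [int0pi_inv_sin2] bounds its integral. *)
pose k x := (m1 x * h x + m x * h1 x) * (sin x / D delta x)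
  + m x * h x * (cos x * (delta ^+ 2 - sin x ^+ 2) / D delta x ^+ 2).
have hk : derives (fun x => m x * h x * (sin x / D delta x)) k.
  apply: derives_eq (derivesM (derivesM hm hh)
    (derivesM derives_sin (derivesV Dn (derivesD2 delta)))) _ => x; rewrite /k; congr (_ + _ * _).
  by have := Dn x; rewrite /D => Dx; field.
have cDV2 : continuous (fun x => D delta x ^- 2).
  have -> : (fun x => D delta x ^- 2) = (fun x => (D delta x)^-1 * (D delta x)^-1).
    by apply: funext => x; rewrite expr2 invfM.
  exact: fun_continuousM.
have ck : continuous k.
  repeat first [assumption | apply: fun_continuousD | apply: fun_continuousM
    | apply: fun_continuousN | exact: cst_continuous].
have ibp2 : t * int0pi (fun x => e1 x * h x) =
    int0pi (fun x => e1 x * h x / D delta x - e2 x * k x).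
  rewrite -int0piZ; last exact: fun_continuousM.
  have hP := derivesM he2 hk.
  pose r x := e1 x * h x / D delta x - e2 x * k x.
  have cr : continuous r.
    repeat first [assumption | apply: fun_continuousD | apply: fun_continuousM
    | apply: fun_continuousN | exact: cst_continuous].
  have e x : t * (e1 x * h x) = (t * psi1 x * e1 x * (m x * h x * (sin x / D delta x))
     + e2 x * k x) + r x.
    rewrite (_ : t * psi1 x * _ * _ = t * e1 x * h x * (psi1 x * m x) * (sin x / D delta x));
      last by ring.
    rewrite psim /r.
    have -> : e1 x * h x / D delta x = (t * delta ^+ 2) * (e1 x * h x / D delta x).
      by rewrite td mul1r.
    by have := Dn x; rewrite /D => Dx; field.
  have cA : continuous (fun x => t * psi1 x * e1 x * (m x * h x * (sin x / D delta x))
     + e2 x * k x).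
    have -> : (fun x => t * psi1 x * e1 x * (m x * h x * (sin x / D delta x)) + e2 x * k x) =
      (fun x => t * (e1 x * h x) - r x) by apply: funext => x; rewrite e addrK.
    repeat first [assumption | apply: fun_continuousD | apply: fun_continuousM
    | apply: fun_continuousN | exact: cst_continuous].
  apply: etrans (eq_int0pi e) _; rewrite int0piD // (int0pi_derives hP) //.
  by rewrite sinpi sin0 !mul0r !mulr0 subrr add0r.
have kb x : `|k x| <= (8 * K) * K * N ^+ 2 / D delta x.
  have Dp := @D_gt0 delta x d0.
  have Dnn : `|(D delta x)^-1| <= (D delta x)^-1.
    by rewrite ger0_norm // invr_ge0 ltW.
  have b1 : `|sin x / D delta x| <= 1 * (D delta x)^-1 by apply: prod_le.
  have b2 : `|cos x * (delta ^+ 2 - sin x ^+ 2) / D delta x ^+ 2| <= 1 * (D delta x)^-1.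
    have -> : cos x * (delta ^+ 2 - sin x ^+ 2) / D delta x ^+ 2 =
       cos x * ((delta ^+ 2 - sin x ^+ 2) / D delta x) * (D delta x)^-1.
      by field.
    apply: prod_le => //; rewrite -[leRHS]mulr1; apply: prod_le => //.
    have Dv : 0 <= (D delta x)^-1 by rewrite invr_ge0 ltW.
    rewrite normrM (ger0_norm Dv) ler_pdivrMr // mul1r.
    rewrite ler_norml /D; have := sqr_ge0 (sin x); have := sqr_ge0 delta; lra.
  have b3 : `|m1 x * h x + m x * h1 x| <= K * (2 * K * N) + K * (4 * K * N ^+ 2).
    by apply: le_trans (ler_normD _ _) _; apply: lerD; apply: prod_le.
  have b4 : `|m x * h x| <= K * (2 * K * N) by apply: prod_le.
  apply: le_trans (ler_normD _ _) _.
  apply: le_trans (lerD (prod_le b3 b1) (prod_le b4 b2)) _.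
  rewrite mul1r -mulrDl ler_pM2r ?invr_gt0 //.
  have N2 : N <= N ^+ 2 by rewrite expr2; nra.
  have := ler_wpM2l (mulr_ge0 K0 K0) N2; nra.
have key : `|t * int0pi (fun x => e1 x * h x)| <=
    (2 + 8 * K) * K * N ^+ 2 * ((1 + pi) * pi / delta).
  rewrite ibp2.
  apply: le_trans (_ : int0pi (fun x => (2 + 8 * K) * K * N ^+ 2 * (D delta x)^-1) <= _).
    apply: int0pi_norm.
    - repeat first [assumption | apply: fun_continuousD | apply: fun_continuousM
      | apply: fun_continuousN | exact: cst_continuous].
    - by apply: fun_continuousM => //; exact: cst_continuous.
    move=> x _; apply: le_trans (ler_normB _ _) _.
    have Dp := @D_gt0 delta x d0.
    have a1 : `|e1 x * h x / D delta x| <= 1 * (2 * K * N) * (D delta x)^-1.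
      apply: prod_le; first exact: prod_le.
      by rewrite ger0_norm // invr_ge0 ltW.
    have a2 : `|e2 x * k x| <= 1 * (8 * K * K * N ^+ 2 / D delta x) by apply: prod_le.
    apply: le_trans (lerD a1 a2) _.
    rewrite !mul1r -mulrDl ler_pM2r ?invr_gt0 //.
    have N2 : N <= N ^+ 2 by rewrite expr2; nra.
    have := ler_wpM2l K0 N2; nra.
  rewrite int0piZ //; apply: ler_wpM2l; last exact: int0pi_inv_sin2.
  by rewrite !mulr_ge0 ?addr_ge0 ?mulr_ge0 ?exprn_ge0.
(* By [key], t times the integral of e1 h is O(N^2 / delta) with 1 / delta the square root of t;
   dividing by t^2 leaves t^(-3/2). *)
have -> : int0pi (fun x => e0 x * (sin x * sin (N * x))) =
   - (t * int0pi (fun x => e1 x * h x)) / (t * t).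
  by rewrite -mulrN -ibp1; field; rewrite gt_eqF.
rewrite mulNr normrN normrM (ger0_norm (_ : 0 <= (t * t)^-1)); last first.
  by rewrite invr_ge0 mulr_ge0 // ltW.
apply: le_trans (ler_wpM2r _ key) _; first by rewrite invr_ge0 mulr_ge0 // ltW.
rewrite le_eqVlt; apply/orP; left; apply/eqP; rewrite /delta.
have tt : t = Num.sqrt t * Num.sqrt t by rewrite -expr2 sqr_sqrtr // ltW.
move: (Num.sqrt t) st0 tt => w w0 ->; field.
by rewrite gt_eqF.
Qed.

End oscillatory_integral.

(** The power is monotone in a direction that depends on the sign of e; the sum of the two endpoint
    values covers both cases. *)
Lemma powR_le_endpoints {R : realType} (a b v e : R) : 0 < a -> a <= v -> v <= b ->
  v `^ e <= a `^ e + b `^ e.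
Proof.
move=> a0 av vb; have v0 : 0 < v by apply: lt_le_trans av.
have b0 : 0 < b by apply: lt_le_trans vb.
have [e0|e0] := leP 0 e.
  apply: ler_wpDl; first exact: powR_ge0.
  by apply: ge0_ler_powR => //; rewrite nnegrE ltW.
apply: ler_wpDr; first exact: powR_ge0.
rewrite -[e]opprK !(powRN _ (- e)) lef_pV2 ?posrE ?powR_gt0 //.
by apply: ge0_ler_powR => //; rewrite ?nnegrE ?oppr_ge0 ltW.
Qed.

Lemma sin_natmul_pi {R : realType} n : sin (n%:R * pi) = 0 :> R.
Proof.
elim: n => [|n IH]; first by rewrite mul0r sin0.
by rewrite -natr1 mulrDl mul1r sinDpi IH oppr0.
Qed.

Lemma powRN32 {R : realType} (x : R) : 0 < x -> x `^ (- (3 / 2)) = (x * Num.sqrt x)^-1.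
Proof.
move=> x0; rewrite powRN (_ : 3 / 2 = 1 + 2^-1); last by field.
by rewrite powRD ?(gt_eqF x0) ?implybT // powRr1 ?ltW // powR12_sqrt // ltW.
Qed.

(** * Decay of the Chebyshev coefficients *)

Section dispersion.
Context {R : realType} (gam alpha : R).
Hypotheses (gam01 : 0 < gam < 1) (alpha02 : 0 < alpha <= 2).

Let phase (x : R) := (1 - gam * cos x) `^ (alpha / 2).

Let base_bounds x : 1 - gam <= 1 - gam * cos x <= 1 + gam.
Proof.
have /andP[g0 _] := gam01.
by have := @cos_geN1 R x; have := @cos_le1 R x; nra.
Qed.

Let base_gt0 x : 0 < 1 - gam * cos x.
Proof.
have /andP[_ g1] := gam01; have /andP[h _] := base_bounds x.
by apply: lt_le_trans h; rewrite subr_gt0.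
Qed.

Let derives_base : derives (fun x => 1 - gam * cos x) (fun x => gam * sin x).
Proof.
apply: derives_eq (derivesD (derives_cst 1)
  (derivesN (derivesM (derives_cst gam) derives_cos))) _ => x; ring.
Qed.

Let base_powR_bounded (e : R) : exists2 K, 0 <= K &
  forall x, `|(1 - gam * cos x) `^ e| <= K.
Proof.
exists ((1 - gam) `^ e + (1 + gam) `^ e); first by rewrite addr_ge0 ?powR_ge0.
move=> x; rewrite ger0_norm ?powR_ge0 //; have /andP[h1 h2] := base_bounds x.
by apply: powR_le_endpoints => //; have /andP[_ g1] := gam01; rewrite subr_gt0.
Qed.

(** Since gam < 1, the base 1 - gam cos x stays in a compact part of the positive half-line, and all
    its powers, of either sign, are bounded. The phase derivative is then sin times a nowhere
    vanishing smooth factor. *)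
Lemma dispersive_coefficients : exists2 C : R, 0 < C & forall (t : R) (n : nat),
  `|int0pi (fun x => cos (t * phase x) * (sin x * sin (n.+1%:R * x)))| <=
    C * n.+1%:R ^+ 2 * (1 + `|t|) `^ (- (3 / 2)) /\
  `|int0pi (fun x => sin (t * phase x) * (sin x * sin (n.+1%:R * x)))| <=
    C * n.+1%:R ^+ 2 * (1 + `|t|) `^ (- (3 / 2)).
Proof.
have /andP[g0 g1] := gam01; have /andP[a0 a2] := alpha02.
pose v x := 1 - gam * cos x; pose b := 1 - alpha / 2.
(* m is the quotient of sin by psi1, written so that it makes sense at the zeros of sin; m1 and m2
   are its first two derivatives. *)
pose kap := 2 / (alpha * gam).
pose psi1 x := alpha / 2 * v x `^ (alpha / 2 - 1) * (gam * sin x).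
pose m x := kap * v x `^ b.
pose m1 x := kap * (b * v x `^ (b - 1) * (gam * sin x)).
pose m2 x := kap * (b * ((b - 1) * v x `^ (b - 1 - 1) * (gam * sin x) * (gam * sin x)
   + v x `^ (b - 1) * (gam * cos x))).
have hpsi : derives phase psi1 := derives_powR (alpha / 2) base_gt0 derives_base.
have hs : derives (fun x => gam * sin x) (fun x => gam * cos x).
  by apply: derives_eq (derivesM (derives_cst gam) derives_sin) _ => x; ring.
have hm : derives m m1.
  apply: derives_eq (derivesM (derives_cst kap)
    (derives_powR b base_gt0 derives_base)) _ => x; rewrite /m1 /v; ring.
have hm1 : derives m1 m2.
  apply: derives_eq (derivesM (derives_cst kap) (derivesM (derivesM (derives_cst b)
    (derives_powR (b - 1) base_gt0 derives_base)) hs)) _ => x; rewrite /m2 /v; ring.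
have cv e : continuous (fun x => v x `^ e).
  exact: derives_continuous (derives_powR e base_gt0 derives_base).
have csin := derives_continuous (@derives_sin R).
have ccos := derives_continuous (@derives_cos R).
have cm2 : continuous m2.
  repeat first [apply: cv | assumption | apply: fun_continuousD | apply: fun_continuousM
      | apply: fun_continuousN | exact: cst_continuous].
have psim x : psi1 x * m x = sin x.
  rewrite /psi1 /m (_ : _ * _ = (v x `^ (alpha / 2 - 1) * v x `^ b) *
     (alpha * gam / 2 * kap) * sin x); last by ring.
  rewrite -powRD ?(gt_eqF (base_gt0 x)) ?implybT //.
  rewrite (_ : _ + b = 0) ?powRr0; last by rewrite /b; ring.
  by rewrite /kap; field; rewrite !gt_eqF.
have [K0 K00 hK0] := base_powR_bounded b.
have [K1 K10 hK1] := base_powR_bounded (b - 1).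
have [K2 K20 hK2] := base_powR_bounded (b - 1 - 1).
have kap0 : 0 <= kap by rewrite divr_ge0 // ltW // mulr_gt0.
have b0 : 0 <= b by rewrite /b; lra.
have b1 : b <= 1 by rewrite /b; lra.
pose K := kap * (K0 + K1 + 2 * K2).
have s1 x : `|sin x : R| <= 1 by rewrite ler_norml sin_geN1 sin_le1.
have c1 x : `|cos x : R| <= 1 by rewrite ler_norml cos_geN1 cos_le1.
have gs x : `|gam * sin x| <= 1.
  by rewrite normrM -[leRHS]mulr1 ler_pM // ger0_norm ltW.
have gc x : `|gam * cos x| <= 1.
  by rewrite normrM -[leRHS]mulr1 ler_pM // ger0_norm ltW.
have nb : `|b| <= 1 by rewrite ger0_norm.
have nb1 : `|b - 1| <= 1 by rewrite ler_norml; lra.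
have prod_le (x y A B : R) : `|x| <= A -> `|y| <= B -> `|x * y| <= A * B.
  by move=> ha hb; rewrite normrM ler_pM.
have kapE (y B : R) : `|y| <= B -> B <= K0 + K1 + 2 * K2 -> `|kap * y| <= K.
  by move=> h1 h2; rewrite normrM ger0_norm // ler_wpM2l // (le_trans h1).
have mK x : `|m x| <= K by apply: (kapE _ _ (hK0 x)); lra.
have m1K x : `|m1 x| <= K.
  apply: (kapE _ _ (prod_le _ _ _ _ (prod_le _ _ _ _ nb (hK1 x)) (gs x))); lra.
have m2K x : `|m2 x| <= K.
  apply: (kapE _ _ (prod_le _ _ _ _ nb (le_trans (ler_normD _ _) (lerD
   (prod_le _ _ _ _ (prod_le _ _ _ _ (prod_le _ _ _ _ nb1 (hK2 x)) (gs x)) (gs x))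
   (prod_le _ _ _ _ (hK1 x) (gc x)))))); lra.
have KK : 0 <= K by rewrite mulr_ge0 // !addr_ge0 // mulr_ge0.
pose C0 := (2 + 8 * K) * K * (1 + pi) * pi.
have pi0 := pi_gt0 R.
have C00 : 0 <= C0.
  have h1 : 0 <= 2 + 8 * K by lra.
  have h2 : 0 <= 1 + pi :> R by lra.
  rewrite /C0; exact: mulr_ge0 (mulr_ge0 (mulr_ge0 h1 KK) h2) (ltW pi0).
(* pi is the trivial bound, used when |t| < 1, and C0 the one from the integrations by parts. The 4
   bounds (1 + r)^(3/2) by 4 in the first case and by 4 r^(3/2) in the second. *)
exists (4 * (C0 + pi)) => [|t n].
  by rewrite mulr_gt0 // ltr_wpDl // pi_gt0.
have cphase := derives_continuous hpsi.
have cN : continuous (fun x : R => sin (n.+1%:R * x) : R).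
  apply: (fun_continuous_comp csin); apply: fun_continuousM; first exact: cst_continuous.
  exact: derives_continuous derives_id.
have ctp (r : R) : continuous (fun x : R => r * phase x).
  by apply: fun_continuousM => //; exact: cst_continuous.
(* cos is even and sin odd, so negating t preserves both absolute values. *)
suff main (r : R) : 0 <= r ->
  `|int0pi (fun x => cos (r * phase x) * (sin x * sin (n.+1%:R * x)))| <=
    4 * (C0 + pi) * n.+1%:R ^+ 2 * (1 + r) `^ (- (3 / 2)) /\
  `|int0pi (fun x => sin (r * phase x) * (sin x * sin (n.+1%:R * x)))| <=
    4 * (C0 + pi) * n.+1%:R ^+ 2 * (1 + r) `^ (- (3 / 2)).
  have [t0|t0] := leP 0 t; first by rewrite (ger0_norm t0); apply: main.
  have nt : 0 <= - t by rewrite oppr_ge0 ltW.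
  have [h1 h2] := main _ nt; rewrite (ltr0_norm t0); split.
    apply: le_trans h1; rewrite le_eqVlt; apply/orP; left; apply/eqP; congr `|_|.
    by apply: eq_int0pi => x; rewrite mulNr cosN.
  apply: le_trans h2; rewrite le_eqVlt; apply/orP; left; apply/eqP.
  rewrite -[in RHS]normrN; congr `|_|; rewrite -[RHS]mulN1r -int0piZ.
    by apply: eq_int0pi => x; rewrite [- t * _]mulNr sinN; ring.
  apply: fun_continuousM; last exact: fun_continuousM.
  exact: (fun_continuous_comp csin).
move=> r0; have r1 : 0 < 1 + r by rewrite ltr_pwDl.
have n1 : 1 <= n.+1%:R :> R by rewrite ler1n.
have n2 : 1 <= n.+1%:R ^+ 2 :> R by rewrite exprn_ege1.
rewrite powRN32 //; set w := ((1 + r) * _)^-1.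
have w0 : 0 < w by rewrite invr_gt0 mulr_gt0 // sqrtr_gt0.
have wE : w * ((1 + r) * Num.sqrt (1 + r)) = 1.
  by rewrite mulVf // gt_eqF // mulr_gt0 // sqrtr_gt0.
have [r_small|r_big] := ltP r 1.
  have w4 : 1 <= 4 * w.
    rewrite -wE mulrC ler_wpM2r ?(ltW w0) //.
    have : Num.sqrt (1 + r) <= 2.
      by rewrite -(@ler_pXn2r _ 2) ?nnegrE ?sqrtr_ge0 // sqr_sqrtr ?(ltW r1) //; lra.
    have := sqrtr_ge0 (1 + r); nra.
  have fin (e : R -> R) : continuous e -> (forall x, `|e x| <= 1) ->
     `|int0pi (fun x => e x * (sin x * sin (n.+1%:R * x)))| <=
    4 * (C0 + pi) * n.+1%:R ^+ 2 * w.
    move=> ce he; apply: (@le_trans _ _ (int0pi (fun=> 1))).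
      apply: int0pi_norm; last 1 first.
      - by move=> x _; rewrite -[leRHS]mulr1; apply: (prod_le) => //;
          rewrite -[leRHS]mulr1; apply: (prod_le).
      - by apply: fun_continuousM => //; apply: fun_continuousM.
      - exact: cst_continuous.
    rewrite int0pi_cst mul1r.
    have h1 : pi <= (C0 + pi) * (4 * w).
      by rewrite -[leLHS]mulr1 ler_pM ?(ltW pi0) // lerDr.
    have := ler_wpM2l (le_trans (ltW pi0) h1) n2; rewrite mulr1 => h2.
    apply: le_trans (le_trans h1 h2) _; rewrite le_eqVlt; apply/orP; left.
    by apply/eqP; ring.
  split; apply: fin => //; exact: fun_continuous_comp.
have w4 : (r * Num.sqrt r)^-1 <= 4 * w.
  have r0' : 0 < r by apply: lt_le_trans r_big.
  have sr : 0 < Num.sqrt r by rewrite sqrtr_gt0.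
  have h : Num.sqrt (1 + r) <= 2 * Num.sqrt r.
    rewrite -(@ler_pXn2r _ 2) ?nnegrE ?sqrtr_ge0 ?mulr_ge0 ?sqrtr_ge0 //.
    by rewrite exprMn !sqr_sqrtr ?ltW //; lra.
  rewrite -[leLHS]mulr1 ler_pdivrMl ?mulr_gt0 // -[leLHS]wE.
  rewrite [leRHS]mulrA [leLHS]mulrC ler_wpM2r ?(ltW w0) //.
  rewrite (_ : r * Num.sqrt r * 4 = (2 * r) * (2 * Num.sqrt r)); last by ring.
  by apply: ler_pM => //; [exact: ltW | lra].
have fin (e0 e1 e2 : R -> R) : derives e1 (fun x => r * psi1 x * e0 x) ->
   derives e2 (fun x => r * psi1 x * e1 x) -> continuous e0 ->
   (forall x, `|e1 x| <= 1) -> (forall x, `|e2 x| <= 1) ->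
   `|int0pi (fun x => e0 x * (sin x * sin (n.+1%:R * x)))| <=
    4 * (C0 + pi) * n.+1%:R ^+ 2 * w.
  move=> h1 h2 h3 h4 h5.
  apply: le_trans (stationary_endpoints_bound hm hm1 cm2 psim mK m1K m2K n1 r_big
    h1 h2 h3 h4 h5 (sin_natmul_pi _)) _.
  rewrite -/C0; apply: le_trans (ler_wpM2l _ w4) _.
    by rewrite mulr_ge0 // exprn_ge0.
  rewrite [leLHS](_ : _ = 4 * C0 * n.+1%:R ^+ 2 * w); last by ring.
  rewrite ler_wpM2r ?(ltW w0) // ler_wpM2r ?exprn_ge0 // ler_wpM2l // lerDl ltW //.
have hr : derives (fun x => r * phase x) (fun x => r * psi1 x).
  by apply: derives_eq (derivesM (derives_cst r) hpsi) _ => x; ring.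
have hsin := derives_comp derives_sin hr; have hcos := derives_comp derives_cos hr.
split.
  apply: (fin _ (fun x => sin (r * phase x)) (fun x => - cos (r * phase x))) => //.
  - by apply: derives_eq hsin _ => x; ring.
  - by apply: derives_eq (derivesN hcos) _ => x; ring.
  - exact: derives_continuous hcos.
  - by move=> x; rewrite normrN.
apply: (fin _ (fun x => - cos (r * phase x)) (fun x => - sin (r * phase x))) => //.
- by apply: derives_eq (derivesN hcos) _ => x; ring.
- by apply: derives_eq (derivesN hsin) _ => x; ring.
- exact: derives_continuous hsin.
- by move=> x; rewrite normrN.
- by move=> x; rewrite normrN.
Qed.

End dispersion.

(** * Polynomial approximation and Chebyshev coefficients *)

Section bernstein.
Context {R : realType}.
Implicit Types (phi : nat -> R) (y : R).

(* \sum_(k <= n) phi k * 'C(n, k) * 'X^k * (1 - 'X)^(n - k), through Pascal's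
   rule: the expectation of phi under the binomial law. *)
Fixpoint bernstein n phi : {poly R} :=
  if n is n'.+1 then
    'X * bernstein n' (phi \o S) + (1 - 'X) * bernstein n' phi
  else (phi 0%N)%:P.

Lemma horner_bernsteinS n phi y :
  (bernstein n.+1 phi).[y] =
  y * (bernstein n (phi \o S)).[y] + (1 - y) * (bernstein n phi).[y].
Proof. by rewrite /= !hornerE. Qed.

(** The Bernstein operator averages with nonnegative weights of total mass 1, so it fixes constants
    and preserves inequalities. *)
Lemma bernstein_shift_le n phi chi c y : 0 <= y <= 1 ->
  (forall k, `|phi k - c| <= chi k) ->
  `|(bernstein n phi).[y] - c| <= (bernstein n chi).[y].
Proof.
move=> /andP[y0 y1]; elim: n phi chi => [|n IH] phi chi h.
  by rewrite !hornerC.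
rewrite !horner_bernsteinS.
set u := (bernstein n (phi \o S)).[y]; set v := (bernstein n phi).[y].
have -> : y * u + (1 - y) * v - c = y * (u - c) + (1 - y) * (v - c) by ring.
apply: le_trans (ler_normD _ _) _; rewrite !normrM (ger0_norm y0).
rewrite (ger0_norm (_ : 0 <= 1 - y)) ?subr_ge0 //; apply: lerD.
  by apply: ler_wpM2l => //; apply: IH => k; apply: h.
by apply: ler_wpM2l; rewrite ?subr_ge0 //; apply: IH.
Qed.

(** Mean n y and variance n y (1 - y) of the binomial law. The centre c is left free because the
    shift by [S] in the recursion turns it into c - 1. *)
Lemma bernstein_quadratic n (A B c : R) y :
  (bernstein n (fun k => A + B * (k%:R - c) ^+ 2)).[y] =
  A + B * (n%:R * y * (1 - y) + (n%:R * y - c) ^+ 2).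
Proof.
elim: n c => [|n IH] c; first by rewrite hornerC; ring.
rewrite horner_bernsteinS IH.
have -> : (fun k => A + B * (k%:R - c) ^+ 2) \o S =
    (fun k => A + B * (k%:R - (c - 1)) ^+ 2).
  by apply: funext => k /=; rewrite -natr1; ring.
by rewrite IH -natr1; ring.
Qed.

Lemma lipschitz_poly_approx (f : R -> R) (a b L eps : R) : a < b -> 0 <= L ->
  0 < eps -> (forall x y, a <= x -> a <= y -> `|f x - f y| <= L * `|x - y|) ->
  exists p : {poly R}, forall x, a <= x <= b -> `|f x - p.[x]| <= eps.
Proof.
move=> ab L0 e0 fL; have ba : 0 < b - a by rewrite subr_gt0.
pose M := L * (b - a); have M0 : 0 <= M by rewrite mulr_ge0 // ltW.
(* This n makes the variance contribution B n y (1 - y) at most eps / 2. *)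
pose n := (Num.trunc (M ^+ 2 / eps ^+ 2)).+1.
have n0 : 0 < n%:R :> R by rewrite ltr0n.
have nM : M ^+ 2 / eps ^+ 2 <= n%:R.
  by apply/ltW/truncnS_gt.
pose phi k := f (a + (b - a) * (k%:R / n%:R)).
exists (bernstein n phi \Po ((b - a)^-1 *: ('X - a%:P))) => x /andP[ax xb].
rewrite horner_comp hornerZ hornerXsubC; set y := (b - a)^-1 * (x - a).
have y01 : 0 <= y <= 1.
  rewrite /y mulr_ge0 ?invr_ge0 ?(ltW ba) ?subr_ge0 //=.
  by rewrite ler_pdivrMl // mulr1 lerD2r.
have xy : x = a + (b - a) * y by rewrite /y mulrA mulfV ?gt_eqF // mul1r addrC subrK.
rewrite distrC.
(* By AM-GM, M d <= eps / 2 + (M d)^2 / (2 eps). This trades the Lipschitz bound for one quadratic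
   in k, whose Bernstein polynomial is explicit. *)
pose B := M ^+ 2 / (2 * eps * n%:R ^+ 2).
apply: (@le_trans _ _
    (bernstein n (fun k => eps / 2 + B * (k%:R - n%:R * y) ^+ 2)).[y]).
  apply: bernstein_shift_le => // k.
  have /andP[y0 y1] := y01.
  have fk : `|phi k - f x| <= M * `|k%:R / n%:R - y|.
    apply: le_trans (fL _ _ _ ax) _.
      by rewrite lerDl mulr_ge0 ?(ltW ba) // divr_ge0.
    rewrite {1}xy (_ : _ - _ = (b - a) * (k%:R / n%:R - y)); last by ring.
    by rewrite normrM (ger0_norm (ltW ba)) mulrA.
  apply: le_trans fk _; set d := `|_|.
  have -> : B * (k%:R - n%:R * y) ^+ 2 = (M * d) ^+ 2 / (2 * eps).
    rewrite exprMn real_normK ?num_real // /B; field.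
    by rewrite !gt_eqF.
  have h := sqr_ge0 (M * d - eps).
  rewrite -subr_ge0 (_ : _ - _ = (M * d - eps) ^+ 2 / (2 * eps)).
    by rewrite divr_ge0 // mulr_ge0 // ltW.
  by field; rewrite gt_eqF.
rewrite bernstein_quadratic subrr expr0n addr0 /=.
have /andP[y0 y1] := y01.
have B0 : 0 <= B by rewrite divr_ge0 ?sqr_ge0 // !mulr_ge0 ?sqr_ge0 // ltW.
have yy : n%:R * y * (1 - y) <= n%:R by rewrite -mulrA -[leRHS]mulr1 ler_pM2l //; nra.
have := ler_wpM2l B0 yy.
have : B * n%:R <= eps / 2.
  rewrite /B; move: nM; rewrite !ler_pdivrMr ?exprn_gt0 // => h.
  rewrite (_ : _ * n%:R = M ^+ 2 / (2 * eps * n%:R)); last by field; rewrite !gt_eqF.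
  rewrite ler_pdivrMr ?mulr_gt0 //.
  rewrite (_ : _ / 2 * _ = n%:R * eps ^+ 2) //; by field.
lra.
Qed.

End bernstein.

Section lipschitz.
Context {R : realType} (a t c : R).
Hypotheses (a0 : 0 < a) (c01 : 0 < c <= 1).

(** As c - 1 <= 0, the derivative c x^(c - 1) is largest at the left end a. This is why the spectrum
    has to be localized away from 0. *)
Lemma lipschitz_oscillation (F f : R -> R) : derives F f -> (forall x, `|f x| <= 1) ->
  exists2 L, 0 <= L & forall x y, a <= x -> a <= y ->
    `|F (t * x `^ c) - F (t * y `^ c)| <= L * `|x - y|.
Proof.
move=> hF f1; have /andP[c0 c1] := c01.
pose L := `|t| * (c * a `^ (c - 1)); exists L.
  by rewrite mulr_ge0 // mulr_ge0 ?powR_ge0 // ltW.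
pose g x := F (t * x `^ c).
pose dg x := f (t * x `^ c) * (t * (c * x `^ (c - 1))).
have hg (x : R) : 0 < x -> is_derive x (1 : R) g (dg x).
  move=> x0; apply: (is_derive1_comp (f := F) (g := fun x => t * x `^ c)) => //.
  by apply: is_derive_eq; [exact: is_deriveZ (is_derive1_powR c x0) |].
have dgL (x : R) : a <= x -> `|dg x| <= L.
  move=> ax; have x0 : 0 < x by apply: lt_le_trans ax.
  rewrite normrM -[leRHS]mul1r ler_pM // normrM ler_wpM2l //.
  rewrite ger0_norm ?mulr_ge0 ?powR_ge0 ?(ltW c0) // ler_wpM2l ?(ltW c0) //.
  rewrite -[c - 1]opprK !(powRN _ (- (c - 1))) lef_pV2 ?posrE ?powR_gt0 //.
  by apply: ge0_ler_powR; rewrite ?nnegrE ?oppr_ge0 ?subr_le0 // ltW.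
suff main (x y : R) : a <= x -> x < y -> `|g x - g y| <= L * `|x - y|.
  move=> x y ax ay; have [xy|xy|->] := ltgtP x y.
  - exact: main.
  - by rewrite distrC [X in _ <= _ * X]distrC; apply: main.
  - by rewrite !subrr !normr0 mulr0.
move=> ax xy; rewrite distrC [X in _ <= _ * X]distrC.
have [z /andP[zx zy] ->] : exists2 z, x < z < y & g y - g x = dg z * (y - x).
  have [||z] := @MVT R g dg x y xy.
  - move=> z; rewrite in_itv /= => /andP[xz _]; apply: hg.
    by apply: lt_trans xz; apply: lt_le_trans ax.
  - apply: derivable_within_continuous => z; rewrite in_itv /= => /andP[xz _].
    apply: (@ex_derive _ _ _ _ _ _ (dg z)); apply: hg.
    by apply: lt_le_trans xz; apply: lt_le_trans ax.
  - by rewrite in_itv /=; exists z.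
by rewrite normrM ler_wpM2r // dgL // (le_trans ax) // ltW.
Qed.

End lipschitz.

(** * Coefficients in the Chebyshev basis of the second kind *)

Section chebyshev_coefficients.
Context {R : realType} (gam : R).
Hypothesis gam01 : 0 < gam < 1.
Implicit Types (h k : R -> R).

(* The coefficient of U_(n - 1) in the Chebyshev expansion of
   x |-> h (1 - gam * x). *)
Definition cheb_coef n (h : R -> R) : R := 2 / pi *
  int0pi (fun x => h (1 - gam * cos x) * (sin x * sin (n%:R * x))).

Let c_sin (n : nat) : continuous (fun x : R => sin x * sin (n%:R * x)).
Proof.
have cs := derives_continuous (@derives_sin R).
apply: fun_continuousM => //; apply: (fun_continuous_comp cs).
by apply: fun_continuousM; [exact: cst_continuous | exact: derives_continuous derives_id].
Qed.

Let c_base : continuous (fun x : R => 1 - gam * cos x).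
Proof.
apply: fun_continuousD; first exact: cst_continuous.
apply: fun_continuousN; apply: fun_continuousM; first exact: cst_continuous.
exact: derives_continuous derives_cos.
Qed.

Let c_integrand n (h : R -> R) : continuous h ->
  continuous (fun x : R => h (1 - gam * cos x) * (sin x * sin (n%:R * x))).
Proof.
by move=> ch; apply: fun_continuousM => //; apply: (fun_continuous_comp ch).
Qed.

Let base_bounds (x : R) : 1 - gam <= 1 - gam * cos x <= 1 + gam.
Proof.
have /andP[g0 _] := gam01.
by have := @cos_geN1 R x; have := @cos_le1 R x; nra.
Qed.

(** Index 0 stands for U_(-1) = 0; with this value [cheb_coef_mul] needs no special case at n =
    0. *)
Lemma cheb_coef0 h : cheb_coef 0 h = 0.
Proof.
rewrite /cheb_coef (eq_int0pi (g := fun=> 0)) ?int0pi_cst ?mul0r ?mulr0 //.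
by move=> x; rewrite mul0r sin0 !mulr0.
Qed.

Lemma cheb_coefD n h k : continuous h -> continuous k ->
  cheb_coef n (fun l => h l + k l) = cheb_coef n h + cheb_coef n k.
Proof.
move=> ch ck; rewrite /cheb_coef -mulrDr -(int0piD (@c_integrand n _ ch) (@c_integrand n _ ck)).
by congr (_ * _); apply: eq_int0pi => x; rewrite mulrDl.
Qed.

Lemma cheb_coefZ n a h : continuous h ->
  cheb_coef n (fun l => a * h l) = a * cheb_coef n h.
Proof.
move=> ch; rewrite /cheb_coef mulrCA -(int0piZ _ (@c_integrand n _ ch)).
by congr (_ * _); apply: eq_int0pi => x; rewrite -mulrA.
Qed.

(** From sin((n + 2) x) + sin(n x) = 2 cos x sin((n + 1) x). Multiplication by l thus acts on
    coefficients by the transpose of the recursion that [neg_laplacian] satisfies on [chebW]. *)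
Lemma cheb_coef_mul n h : continuous h ->
  cheb_coef n.+1 (fun l => l * h l) =
  cheb_coef n.+1 h - gam / 2 * (cheb_coef n.+2 h + cheb_coef n h).
Proof.
move=> ch; rewrite /cheb_coef -mulrDr mulrCA -mulrBr; congr (_ * _).
rewrite -(int0piD (@c_integrand n.+2 _ ch) (@c_integrand n _ ch)).
have cg := fun_continuousD (@c_integrand n.+2 _ ch) (@c_integrand n _ ch).
rewrite -[- (_ * _)]mulNr -(int0piZ _ cg) -(int0piD (@c_integrand n.+1 _ ch)
  (fun_continuousM (@cst_continuous _ _ _) cg)).
apply: eq_int0pi => x.
have -> : n.+2%:R * x = n.+1%:R * x + x by rewrite -[n.+2%:R]natr1; ring.
have -> : n%:R * x = n.+1%:R * x - x by rewrite -[n.+1%:R]natr1; ring.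
by rewrite sinD sinB; field.
Qed.

Lemma int0pi_cos n : int0pi (fun x => cos (n%:R * x)) = if n == 0%N then pi else 0 :> R.
Proof.
case: n => [|n] /=.
  rewrite (eq_int0pi (g := fun=> 1)) ?int0pi_cst ?mul1r // => x.
  by rewrite mul0r cos0.
have n0 : n.+1%:R != 0 :> R by rewrite pnatr_eq0.
have hn : derives (fun x : R => n.+1%:R * x) (fun=> n.+1%:R).
  by apply: derives_eq (derivesM (derives_cst _) derives_id) _ => x; ring.
rewrite (@int0pi_derives _ (fun x => n.+1%:R^-1 * sin (n.+1%:R * x))).
- by rewrite sin_natmul_pi !mulr0 sin0 mulr0 subrr.
- apply: derives_eq (derivesM (derives_cst _) (derives_comp derives_sin hn)) _ => x.
  by rewrite mul0r add0r mulrCA mulVf // mulr1.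
- exact: derives_continuous (derives_comp derives_cos hn).
Qed.

Lemma cheb_coef1 n : cheb_coef n.+1 (fun=> 1) = (n == 0%N)%:R.
Proof.
rewrite /cheb_coef (eq_int0pi
   (g := fun x => 2^-1 * (cos (n%:R * x) + -1 * cos (n.+2%:R * x)))); last first.
  move=> x; have -> : n.+2%:R * x = n.+1%:R * x + x by rewrite -[n.+2%:R]natr1; ring.
  have -> : n%:R * x = n.+1%:R * x - x by rewrite -[n.+1%:R]natr1; ring.
  by rewrite cosB cosD; field.
have cc m : continuous (fun x : R => cos (m%:R * x) : R).
  have ccos := derives_continuous (@derives_cos R).
  apply: (fun_continuous_comp ccos); apply: fun_continuousM.
    exact: cst_continuous.
  exact: derives_continuous derives_id.
rewrite int0piZ; last first.
  by apply: fun_continuousD => //; apply: fun_continuousM => //; exact: cst_continuous.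
rewrite int0piD ?int0piZ // ?int0pi_cos; last first.
  by apply: fun_continuousM => //; exact: cst_continuous.
rewrite /= mulr0 addr0; have [_|_] := eqVneq n 0%N; last by rewrite !mulr0.
by rewrite mulrCA mulfVK ?mulVf // gt_eqF // pi_gt0.
Qed.

(** The weight is at most 1 and 2 / pi times the length pi is 2, so the loss is uniform in n.
    Continuity of h is asked only along 1 - gam cos x because [powR] is regular only at positive
    arguments. *)
Lemma cheb_coef_close n h k eps :
  continuous (fun x : R => h (1 - gam * cos x)) -> continuous k ->
  (forall l, 1 - gam <= l <= 1 + gam -> `|h l - k l| <= eps) ->
  `|cheb_coef n h - cheb_coef n k| <= 2 * eps.
Proof.
move=> ch ck hk; have pi0 := pi_gt0 R.
have cA := fun_continuousM ch (@c_sin n).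
have cB : continuous (fun x : R => -1 * (k (1 - gam * cos x) * (sin x * sin (n%:R * x)))).
  by apply: fun_continuousM; [exact: cst_continuous | exact: c_integrand].
rewrite /cheb_coef -mulrBr -mulN1r -int0piZ; last exact: c_integrand.
rewrite -(int0piD cA cB) normrM ger0_norm ?divr_ge0 ?(ltW pi0) //.
rewrite -ler_pdivlMl ?divr_gt0 // (_ : (2 / pi)^-1 * (2 * eps) = eps * pi); last first.
  have e (z : R) : z != 0 -> (2 / z)^-1 * (2 * eps) = eps * z by move=> z0; field.
  by apply: e; rewrite gt_eqF.
rewrite -int0pi_cst; apply: int0pi_norm.
- exact: fun_continuousD cA cB.
- exact: cst_continuous.
move=> x _; rewrite mulN1r -mulrBl normrM -[leRHS]mulr1 ler_pM // ?hk //.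
by rewrite normrM -[leRHS]mulr1 ler_pM // ler_norml ?sin_geN1 ?sin_le1.
Qed.

Lemma continuous_horner (p : {poly R}) : continuous (fun l : R => p.[l]).
Proof.
elim/poly_ind: p => [|p c IH].
  rewrite (_ : (fun l => _) = fun=> 0); first exact: cst_continuous.
  by apply: funext => l; rewrite horner0.
rewrite (_ : (fun l => _) = (fun l => p.[l] * l + c)).
  apply: fun_continuousD; last exact: cst_continuous.
  by apply: fun_continuousM => //; exact: derives_continuous derives_id.
by apply: funext => l; rewrite !hornerE.
Qed.

Lemma cheb_coef_horner n (p : {poly R}) :
  cheb_coef n (fun l => p.[l]) =
  \sum_(i < size p) p`_i * cheb_coef n (fun l => l ^+ i).
Proof.
have cX i : continuous (fun l : R => l ^+ i).
  have := @continuous_horner 'X^i; rewrite (_ : (fun l => _) = (fun l => l ^+ i)) //.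
  by apply: funext => l; rewrite hornerXn.
suff main N : cheb_coef n (fun l => \sum_(i < N) p`_i * l ^+ i) =
    \sum_(i < N) p`_i * cheb_coef n (fun l => l ^+ i).
  by rewrite -main; congr cheb_coef; apply: funext => l; rewrite horner_coef.
have cS M : continuous (fun l : R => \sum_(i < M) p`_i * l ^+ i).
  elim: M => [|M IH].
    rewrite (_ : (fun l => _) = fun=> 0); first exact: cst_continuous.
    by apply: funext => l; rewrite big_ord0.
  rewrite (_ : (fun l => _) = (fun l => \sum_(i < M) p`_i * l ^+ i + p`_M * l ^+ M)).
    apply: fun_continuousD => //.
    by apply: fun_continuousM => //; exact: cst_continuous.
  by apply: funext => l; rewrite big_ord_recr.
elim: N => [|N IH].
  rewrite big_ord0 (_ : (fun l => _) = (fun l => 0 * 1)) ?cheb_coefZ ?mul0r //.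
    exact: cst_continuous.
  by apply: funext => l; rewrite ?big_ord0 ?mul0r.
rewrite big_ord_recr /= -IH -cheb_coefZ // -cheb_coefD //.
  by congr cheb_coef; apply: funext => l; rewrite big_ord_recr.
by apply: fun_continuousM => //; exact: cst_continuous.
Qed.

End chebyshev_coefficients.

Local Open Scope complex_scope.

(** * Polynomials in the Laplacian *)

Section laplacian_polynomials.
Context {R : realType} {V : pointedType} (Q : nat) (adj : rel V).
Hypotheses (Q2 : (2 <= Q)%N) (ht : homogeneous_tree Q adj).

Local Notation s := (Num.sqrt (Q%:R : R)).
Local Notation C := R[i].

Definition neg_laplacian (u : V -> C) : V -> C := fun x => - laplacian Q adj u x.

(** This is the spectral radius of the averaging operator over neighbours; the gap at the bottom of
    the spectrum of minus the Laplacian is 1 - gam. *)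
Definition spectral_gap : R := 2 * s / (Q%:R + 1).
Local Notation gam := spectral_gap.

Lemma spectral_gap01 : 0 < gam < 1.
Proof.
have s1 := sqrtQ_gt1 (R := R) Q2; have s0 := sqrtQ_gt0 (R := R) Q2.
have ss := sqr_sqrtQ (R := R) Q.
have Q1 : 0 < Q%:R + 1 :> R by rewrite ltr_wpDl.
rewrite /gam divr_gt0 ?mulr_gt0 //= ltr_pdivrMr // mul1r.
move: s s1 ss => r r1 <-; have : 0 < (r - 1) ^+ 2 by rewrite exprn_gt0 // subr_gt0.
by rewrite !expr2; lra.
Qed.

Lemma neg_laplacianE (u : V -> C) x :
  neg_laplacian u x = u x - (Q.+1%:R)^-1 * adjop adj u x.
Proof.
have e : [set y | gdist adj y x = 1%N] = [set` nbrs adj x].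
  apply/seteqP; split => y /=.
    by move=> h; rewrite (mem_nbrs ht) -(gdist1 ht) (gdist_sym ht) h.
  by rewrite (mem_nbrs ht) -(gdist1 ht) (gdist_sym ht) => /eqP.
by rewrite /neg_laplacian /laplacian opprB e -fsbig_seq ?uniq_nbrs.
Qed.

Definition chebW n (u : V -> C) (x : V) : C := (s ^- n)%:C * chebU Q adj n u x.

Lemma neg_laplacian_lin (I : Type) (r : seq I) (c : I -> C) (f : I -> V -> C) x :
  neg_laplacian (fun x => \sum_(i <- r) c i * f i x) x =
  \sum_(i <- r) c i * neg_laplacian (f i) x.
Proof.
rewrite neg_laplacianE.
under [RHS]eq_bigr do rewrite neg_laplacianE mulrBr.
rewrite sumrB; congr (_ - _); rewrite /adjop exchange_big mulr_sumr.
apply: eq_bigr => i _; rewrite mulrCA; congr (_ * _).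
by rewrite mulr_sumr.
Qed.

Let s0 : s != 0. Proof. by rewrite gt_eqF // sqrtQ_gt0. Qed.

Let gam2 : (gam / 2)%:C = (s)%:C / Q.+1%:R.
Proof.
rewrite -[Q.+1%:R](rmorph_nat (real_complex R)) -rmorphV -?rmorphM /=; last first.
  by rewrite unitfE pnatr_eq0.
congr (_%:C); rewrite /gam -[Q.+1%:R]natr1; field.
by rewrite gt_eqF // ltr_wpDl.
Qed.

Lemma neg_laplacian_chebW0 u x :
  neg_laplacian (chebW 0 u) x = chebW 0 u x - (gam / 2)%:C * chebW 1 u x.
Proof.
rewrite neg_laplacianE; congr (_ - _); rewrite gam2 /chebW chebU0 chebU1.
rewrite expr0 expr1 invr1 rmorph1 /adjop.
under eq_bigr do rewrite mul1r.
rewrite [RHS]mulrACA -rmorphM mulfV // rmorph1 mul1r //.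
Qed.

Lemma neg_laplacian_chebW n u x :
  neg_laplacian (chebW n.+1 u) x =
  chebW n.+1 u x - (gam / 2)%:C * (chebW n.+2 u x + chebW n u x).
Proof.
rewrite neg_laplacianE; congr (_ - _); rewrite gam2 /chebW chebUSS /adjop.
rewrite -mulr_sumr -!mulrA; set S := \sum_(z <- _) _; set U := chebU _ _ _ _ _.
have -> : (Q%:R : C) = (s)%:C * (s)%:C.
  by rewrite -rmorphM /= -expr2 sqr_sqrtQ rmorph_nat.
have e : (s)%:C != 0 by rewrite (fmorph_eq0 (real_complex R)).
rewrite !exprS !fmorphV !rmorphM /= !rmorphXn /=; field.
by rewrite expf_neq0 // e addrC natr1 pnatr_eq0.
Qed.

(** An algebraic identity for arbitrary u, by induction on k from the two matching recursions. N is
    any number above k, so that all monomials of a polynomial can share one range of summation. *)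
Lemma iter_neg_laplacian k u : forall N, (k < N)%N -> forall x,
  iter k neg_laplacian u x =
  \sum_(n < N) (cheb_coef gam n.+1 (fun l => l ^+ k))%:C * chebW n u x.
Proof.
have cX j : continuous (fun l : R => l ^+ j).
  have := @continuous_horner R 'X^j; rewrite (_ : (fun l => _) = (fun l => l ^+ j)) //.
  by apply: funext => l; rewrite hornerXn.
pose c j n := cheb_coef gam n (fun l => l ^+ j).
have c1 n : c 0%N n.+1 = (n == 0%N)%:R.
  by rewrite /c -(cheb_coef1 gam n); congr cheb_coef; apply: funext => l; rewrite expr0.
have cS j n : c j.+1 n.+1 = c j n.+1 - gam / 2 * (c j n.+2 + c j n).
  rewrite -(cheb_coef_mul gam n (cX j)).
  by rewrite /c; congr cheb_coef; apply: funext => l; rewrite exprS.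
have c0 j : c j 0%N = 0 by exact: cheb_coef0.
(* l^j has degree j, hence no component on U_n for n > j; this is read off the recursion [cS]. *)
have vanish j n : (j < n)%N -> c j n.+1 = 0.
  elim: j n => [|j IH] n jn; first by rewrite c1 gtn_eqF.
  rewrite cS IH; last by lia.
  rewrite IH; last by lia.
  case: n jn => // n jn; rewrite IH; last by lia.
  by rewrite addr0 mulr0 subr0.
elim: k => [|k IH] N kN x.
  case: N kN => // N _; rewrite big_ord_recl -/(c 0%N 1%N) c1 rmorph1 mul1r.
  rewrite big1 ?addr0 => [|i _]; first by rewrite /chebW expr0 invr1 rmorph1 mul1r.
  by rewrite -/(c 0%N _) c1 /= rmorph0 mul0r.
rewrite iterS.
have -> : iter k neg_laplacian u =
    (fun x => \sum_(n <- enum 'I_N) (c k n.+1)%:C * chebW n u x).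
  by apply: funext => z; rewrite (IH N (ltnW kN)) big_enum.
rewrite neg_laplacian_lin big_enum /=.
case: N kN => // N; rewrite ltnS => kN.
pose W n := chebW n u x.
have recl (a : nat -> C) : \sum_(i < N.+1) a i = a 0%N + \sum_(i < N) a i.+1.
  by rewrite big_ord_recl.
have -> : \sum_(i < N.+1) (c k i.+1)%:C * neg_laplacian (chebW i u) x =
   \sum_(i < N.+1) (c k i.+1)%:C * W i -
   (gam / 2)%:C * (\sum_(i < N.+1) (c k i.+1)%:C * W i.+1 +
     \sum_(i < N) (c k i.+2)%:C * W i).
  rewrite (recl (fun i => (c k i.+1)%:C * neg_laplacian (chebW i u) x)).
  rewrite (recl (fun i => (c k i.+1)%:C * W i)) (recl (fun i => (c k i.+1)%:C * W i.+1)).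
  rewrite neg_laplacian_chebW0 -/(W 0%N) -/(W 1%N).
  have -> : \sum_(i < N) (c k i.+2)%:C * neg_laplacian (chebW i.+1 u) x =
    \sum_(i < N) (c k i.+2)%:C * W i.+1 - (gam / 2)%:C * (\sum_(i < N) (c k i.+2)%:C * W i.+2
      + \sum_(i < N) (c k i.+2)%:C * W i).
    rewrite -big_split mulr_sumr -sumrB; apply: eq_bigr => i _ /=.
    by rewrite neg_laplacian_chebW -/(W i) -/(W i.+1) -/(W i.+2); ring.
  by ring.
have recr (a : nat -> C) : \sum_(i < N.+1) a i = \sum_(i < N) a i + a N.
  by rewrite big_ord_recr.
have -> : \sum_(n < N.+1) (cheb_coef gam n.+1 (fun l => l ^+ k.+1))%:C * chebW n u x =
    \sum_(n < N.+1) (c k n.+1)%:C * W n - (gam / 2)%:C *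
      (\sum_(n < N.+1) (c k n.+2)%:C * W n + \sum_(n < N.+1) (c k n)%:C * W n).
  rewrite -big_split mulr_sumr -sumrB; apply: eq_bigr => n _ /=.
  have -> : (cheb_coef gam n.+1 (fun l => l ^+ k.+1))%:C =
      (c k n.+1)%:C - (gam / 2)%:C * ((c k n.+2)%:C + (c k n)%:C).
    by rewrite -rmorphD -rmorphM -rmorphB -cS.
  by rewrite -/(W n); ring.
(* The two sides now differ by shifts of index. The boundary terms vanish: c k 0 = 0 at the bottom,
   and at the top the index exceeds the degree. *)
rewrite (recr (fun n => (c k n.+1)%:C * W n)) (recr (fun n => (c k n.+2)%:C * W n)).
rewrite (recr (fun n => (c k n.+1)%:C * W n.+1)) (recl (fun n => (c k n)%:C * W n)).
rewrite c0 (vanish k N kN) (vanish k N.+1 (leqW kN)) rmorph0; ring.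
Qed.

End laplacian_polynomials.

Section complex_modulus.
Context {R : realType}.
Local Notation C := R[i].
Local Notation normc := Normc.normc.

Lemma normc_ge0 (z : C) : 0 <= normc z.
Proof. by case: z => a b; apply: sqrtr_ge0. Qed.

Lemma normc_conj (z : C) : normc z^* = normc z.
Proof. by case: z => a b; rewrite /normc /= sqrrN. Qed.

Lemma normc_real (a : R) : normc a%:C = `|a|.
Proof. by rewrite /normc /= expr0n /= addr0 sqrtr_sqr. Qed.

Lemma normc_sum (I : Type) (r : seq I) (f : I -> C) :
  normc (\sum_(i <- r) f i) <= \sum_(i <- r) normc (f i).
Proof.
elim: r => [|i r IH]; first by rewrite !big_nil Normc.normc0.
by rewrite !big_cons (le_trans (le_normcD _ _)) // lerD2l.
Qed.

Lemma conjc_mulE (z : C) : z * z^* = (normc z ^+ 2)%:C.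
Proof.
case: z => a b; rewrite /normc /= sqr_sqrtr ?addr_ge0 ?sqr_ge0 //.
by apply/eqP; rewrite eq_complex /=; apply/andP; split; apply/eqP; ring.
Qed.

End complex_modulus.

(** * The sesquilinear form of a polynomial in the Laplacian *)

Section polynomial_form.
Context {R : realType} {V : pointedType} (Q : nat) (adj : rel V).
Hypotheses (Q2 : (2 <= Q)%N) (ht : homogeneous_tree Q adj).

Local Notation s := (Num.sqrt (Q%:R : R)).
Local Notation C := R[i].
Local Notation gam := (spectral_gap (R := R) Q).
Local Notation normc := Normc.normc.
Local Notation lap := (neg_laplacian (R := R) Q adj).

Definition polyop (T : (V -> C) -> V -> C) (p : {poly R}) (u : V -> C) (x : V) : C :=
  \sum_(i < size p) (p`_i)%:C * iter i T u x.

Lemma polyop_chebW p u x : polyop lap p u x =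
  \sum_(n < size p) (cheb_coef gam n.+1 (fun l => p.[l]))%:C * chebW Q adj n u x.
Proof.
rewrite /polyop; under eq_bigr => i _ do
  rewrite (iter_neg_laplacian Q2 ht u (ltn_ord i)) mulr_sumr.
rewrite exchange_big; apply: eq_bigr => n _ /=.
rewrite cheb_coef_horner rmorph_sum mulr_suml; apply: eq_bigr => i _ /=.
by rewrite mulrA -rmorphM.
Qed.

Lemma treeker_real n x y : treeker adj n x y = (treeker adj n x y : R)%:C :> C.
Proof. by rewrite /treeker /level; case: (_ && _). Qed.

Variables (th : R) (u v : V -> C) (A B : V -> R).
Hypotheses (th01 : 0 < th < 1) (A0 : forall x, 0 <= A x) (B0 : forall x, 0 <= B x).
Hypotheses (uA : forall x, normc (u x) = A x `^ (1 - th / 2))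
  (vB : forall x, normc (v x) = B x `^ (1 - th / 2)).
Hypothesis A1 : forall F : seq V, uniq F -> \sum_(y <- F) A y <= 1.

(** With th = 2 / r one has 1 - th / 2 = 1 / r', so A and B are |u|^r' and |v|^r', and the two sum
    conditions put u and v in the unit ball of l^r'. *)
Lemma chebW_form_bound n (G : seq V) : uniq G -> \sum_(x <- G) B x <= 1 ->
  normc (\sum_(x <- G) chebW Q adj n u x * (v x)^*) <=
    n.+1%:R * (s `^ (th - 1)) ^+ n.
Proof.
move=> uG B1; pose L := undup (flatten [seq ball adj n x | x <- G]).
have uL : uniq L by exact: undup_uniq.
have inL x : x \in G -> forall y, (gdist adj x y <= n)%N -> y \in L.
  move=> xG y /(mem_ball ht) h; rewrite mem_undup; apply/flatten_mapP.
  by exists x.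
apply: le_trans (treeker_interpolation Q2 ht n th01 uL uG A0 B0 (A1 uL) B1).
apply: le_trans (normc_sum _ _) _; rewrite mulr_sumr [leLHS]big_seq [leRHS]big_seq.
apply: ler_sum => x xG; rewrite Normc.normcM normc_conj /chebW Normc.normcM normc_real.
rewrite ger0_norm ?invr_ge0 ?exprn_ge0 ?sqrtr_ge0 // -mulrA.
apply: ler_wpM2l; first by rewrite invr_ge0 exprn_ge0 ?sqrtr_ge0.
rewrite (chebU_kernel ht u uL (inL x xG)) vB.
apply: le_trans (ler_wpM2r (powR_ge0 _ _) (normc_sum _ _)) _.
rewrite mulr_suml; apply: ler_sum => y _.
rewrite Normc.normcM uA treeker_real normc_real ger0_norm ?treeker_ge0 //.
by rewrite powRM // mulrA.
Qed.

Lemma polyop_form_bound p (G : seq V) : uniq G -> \sum_(x <- G) B x <= 1 ->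
  normc (\sum_(x <- G) polyop lap p u x * (v x)^*) <=
  \sum_(n < size p) `|cheb_coef gam n.+1 (fun l => p.[l])| *
    (n.+1%:R * (s `^ (th - 1)) ^+ n).
Proof.
move=> uG B1.
under eq_bigr do rewrite polyop_chebW mulr_suml.
rewrite exchange_big; apply: le_trans (normc_sum _ _) _; apply: ler_sum => n _.
under eq_bigr do rewrite -mulrA.
rewrite -mulr_sumr Normc.normcM normc_real ler_wpM2l //.
exact: chebW_form_bound.
Qed.

End polynomial_form.

(** * The Hilbert space l^2 *)

Lemma poweR_inv_le {R : realType} (X : \bar R) (p M : R) : 0 < p -> (0 <= X)%E ->
  0 <= M -> (X `^ p^-1 <= M%:E)%E = (X <= (M `^ p)%:E)%E.
Proof.
move=> p0; case: X => [x||] //= x0 M0; last first.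
  by rewrite invr_eq0 gt_eqF // !leye_eq.
rewrite !lee_fin in x0 *.
have e : (x `^ p^-1) `^ p = x.
  by rewrite -powRrM mulVf ?powRr1 // gt_eqF.
apply/idP/idP => h.
  rewrite -e; apply: ge0_ler_powR; rewrite ?nnegrE ?powR_ge0 //; exact: ltW.
rewrite -[M]powRr1 // -(@mulfV _ p) ?gt_eqF // powRrM.
by apply: ge0_ler_powR; rewrite ?nnegrE ?powR_ge0 // invr_ge0 ltW.
Qed.

Section counting_integral.
Context {R : realType} {V : pointedType}.
Local Notation T := (discrete V).
Local Notation cnt := (@counting T R).
Implicit Types (f : T -> \bar R).

Lemma measurable_fun_discrete d (U : sigmaRingType d) (A : set T) (f : T -> U) :
  measurable_fun A f.
Proof. by move=> ? Y _. Qed.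

Lemma counting1 (x : T) : cnt [set x] = 1%E.
Proof.
rewrite /counting; case: ifPn => [_|]; first by rewrite fset_set1 cardfs1.
by move=> /asboolP; case; exact: finite_set1.
Qed.

Lemma integral_counting1 (x : T) f : (\int[cnt]_(y in [set x]) f y = f x)%E.
Proof.
rewrite (eq_integral (cst (f x))); last by move=> y /set_mem ->.
by apply: etrans (integral_cst _ _ _) _ => //; rewrite -[RHS]mule1 -(counting1 x).
Qed.

Lemma integral_counting_seq (F : seq T) f : uniq F -> (forall x, (0 <= f x)%E) ->
  (\int[cnt]_(x in [set` F]) f x = \sum_(x <- F) f x)%E.
Proof.
move=> uF f0; elim: F uF => [_|x F IH /= /andP[xF uF]].
  have -> : [set` [::]] = set0 :> set T by apply/seteqP; split.
  by rewrite integral_set0 big_nil.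
have -> : [set` x :: F] = [set x] `|` [set` F] :> set T.
  apply/seteqP; split=> y /=; rewrite inE.
    by move=> /orP[/eqP ->|]; [left|right].
  by case=> [->|->]; rewrite ?eqxx ?orbT.
rewrite ge0_integral_setU //; last first.
  apply/disj_setPS => y [/= -> yF]; by rewrite yF in xF.
by rewrite big_cons integral_counting1 IH.
Qed.

Lemma sum_le_integral_counting (F : seq T) f : uniq F -> (forall x, (0 <= f x)%E) ->
  (\sum_(x <- F) f x <= \int[cnt]_x f x)%E.
Proof.
by move=> uF f0; rewrite -integral_counting_seq //; apply: ge0_subset_integral.
Qed.

(** An increasing family of finite sets that covers V: by monotone convergence, bounds on finite
    sums along it pass to integrals against the counting measure. *)
Definition exhaustion (E : nat -> seq V) := [/\ forall n, uniq (E n),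
  forall n m, (n <= m)%N -> {subset E n <= E m} & forall x, exists n, x \in E n].

Lemma integral_counting_le (E : nat -> seq V) f (M : \bar R) : exhaustion E ->
  (forall x, (0 <= f x)%E) -> (forall n, (\sum_(x <- E n) f x <= M)%E) ->
  (\int[cnt]_x f x <= M)%E.
Proof.
move=> [uE mE cE] f0 h.
have c := @ge0_nondecreasing_set_cvg_integral _ T R (fun n => [set` E n]) f cnt.
have bigE : (\bigcup_i [set` E i]) = [set: T].
  by apply/seteqP; split=> // x _; have [n xn] := cE x; exists n.
have {}c := c _ _ _ _; rewrite bigE in c.
have {}c : (\int[cnt]_(x in [set` E i]) f x)%E @[i --> \oo] --> (\int[cnt]_x f x)%E.
  by apply: c => // n m nm; apply/subsetPset => x; apply: mE.
rewrite -(cvg_lim _ c) //; apply: lime_le; first by apply/cvg_ex; exists (\int[cnt]_x f x)%E.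
by apply: nearW => n; rewrite integral_counting_seq.
Qed.

Lemma lnorm_sum_le1 (p : R) (u : V -> R[i]) (F : seq V) : 0 < p -> uniq F ->
  (lnorm p%:E u <= 1)%E -> \sum_(x <- F) Normc.normc (u x) `^ p <= 1.
Proof.
move=> p0 uF; rewrite /lnorm unlock => h.
rewrite -lee_fin -sumEFin.
have -> : (\sum_(x <- F) (Normc.normc (u x) `^ p)%:E =
   \sum_(x <- F) (fun x : T => `|(Normc.normc (u x))%:E| `^ p) x)%E.
  by apply: eq_bigr => x _; rewrite /= ger0_norm ?normc_ge0.
apply: le_trans (sum_le_integral_counting uF _) _ => [x|]; first exact: poweR_ge0.
rewrite (_ : 1%E = (1 `^ p)%:E); last by rewrite powR1.
rewrite -poweR_inv_le //; apply: integral_ge0 => x _; exact: poweR_ge0.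
Qed.

Lemma lnorm_le_of_sums (E : nat -> seq V) (r : \bar R) (M : R) (w : V -> R[i]) :
  exhaustion E -> (1 <= r)%E -> 0 <= M ->
  (forall x, Normc.normc (w x) <= M) ->
  (forall p, r = p%:E -> forall n, \sum_(x <- E n) Normc.normc (w x) `^ p <= M `^ p) ->
  (lnorm r w <= M%:E)%E.
Proof.
move=> exE; case: r => [p||] //.
  rewrite lee_fin => p1 M0 _ /(_ _ erefl) h; have p0 : 0 < p by apply: lt_le_trans p1.
  rewrite /lnorm unlock.
  have : (\int[cnt]_x (`|(Normc.normc (w x))%:E| `^ p) <= (M `^ p)%:E)%E.
    apply: (integral_counting_le exE) => [x|n]; first exact: poweR_ge0.
    rewrite (eq_bigr (fun x => (Normc.normc (w x) `^ p)%:E)); last first.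
      by move=> x _; rewrite /= ger0_norm ?normc_ge0.
    by rewrite sumEFin lee_fin.
  by rewrite -poweR_inv_le //; apply: integral_ge0 => x _; exact: poweR_ge0.
move=> _ M0 h _; rewrite /lnorm unlock; case: ifPn => [_|_]; last by rewrite lee_fin.
apply/ess_supP; apply: nearW => x /=.
by rewrite lee_fin ger0_norm ?normc_ge0.
Qed.

End counting_integral.

Section complex_integral.
Context d (T : measurableType d) (R : realType) (mu : {measure set T -> \bar R}).

Lemma Rintegral_lin (D : set T) (f g : T -> R) (a b : R) : measurable D ->
  mu.-integrable D (fun x => (f x)%:E) -> mu.-integrable D (fun x => (g x)%:E) ->
  mu.-integrable D (fun x => (a * f x + b * g x)%:E) /\
  Rintegral mu D (fun x => a * f x + b * g x) =
  a * Rintegral mu D f + b * Rintegral mu D g.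
Proof.
move=> mD hf hg.
have ha : mu.-integrable D (fun x => (a * f x)%:E).
  by rewrite (_ : (fun x => _) = (fun x => a%:E * (f x)%:E)%E) //; exact: integrableZl.
have hb : mu.-integrable D (fun x => (b * g x)%:E).
  by rewrite (_ : (fun x => _) = (fun x => b%:E * (g x)%:E)%E) //; exact: integrableZl.
split; last by rewrite RintegralD // !RintegralZl.
rewrite (_ : (fun x => _) = ((fun x => (a * f x)%:E) \+ (fun x => (b * g x)%:E))%E) //.
exact: integrableD.
Qed.

Local Notation integrable f := (mu.-integrable setT (fun x => (f x)%:E)).

Lemma Cintegral_lin (f g : T -> R[i]) (a : R[i]) :
  Cintegrable mu f -> Cintegrable mu g ->
  Cintegrable mu (fun x => a * f x + g x) /\
  Cintegral mu (fun x => a * f x + g x) = a * Cintegral mu f + Cintegral mu g.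
Proof.
move=> [f1 f2] [g1 g2]; case: a => p q.
have [i1 e1] := Rintegral_lin p (- q) measurableT f1 f2.
have [i2 e2] := Rintegral_lin 1 1 measurableT i1 g1.
have [i3 e3] := Rintegral_lin p q measurableT f2 f1.
have [i4 e4] := Rintegral_lin 1 1 measurableT i3 g2.
have eR : (fun x => complex.Re ((p +i* q) * f x + g x)) =
  (fun x => 1 * (p * complex.Re (f x) + - q * complex.Im (f x)) + 1 * complex.Re (g x)).
  by apply: funext => x; case: (f x) => ? ?; case: (g x) => ? ? /=; ring.
have eI : (fun x => complex.Im ((p +i* q) * f x + g x)) =
  (fun x => 1 * (p * complex.Im (f x) + q * complex.Re (f x)) + 1 * complex.Im (g x)).
  by apply: funext => x; case: (f x) => ? ?; case: (g x) => ? ? /=; ring.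
split.
  split.
    exact: (eq_ind _ (fun h => integrable h) i2 _ (esym eR)).
  exact: (eq_ind _ (fun h => integrable h) i4 _ (esym eI)).
rewrite /Cintegral eR eI e2 e4 e1 e3.
by apply/eqP; rewrite eq_complex /=; apply/andP; split; apply/eqP; ring.
Qed.

Lemma Cintegral_conj (f : T -> R[i]) : Cintegrable mu f ->
  Cintegral mu (fun x => (f x)^*) = (Cintegral mu f)^*.
Proof.
move=> [f1 f2].
have [_ e] := Rintegral_lin (-1) 0 measurableT f2 f2.
rewrite /Cintegral /=.
have -> : (fun x => complex.Re (f x)^*) = (fun x => complex.Re (f x)).
  by apply: funext => x; case: (f x).
have -> : (fun x => complex.Im (f x)^*) =
    (fun x => -1 * complex.Im (f x) + 0 * complex.Im (f x)).
  by apply: funext => x; case: (f x) => ? ? /=; ring.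
by rewrite e mul0r addr0 mulN1r.
Qed.

End complex_integral.

Section hilbert.
Context {R : realType} {V : pointedType}.
Local Notation T := (discrete V).
Local Notation cnt := (@counting T R).
Local Notation C := R[i].
Local Notation normc := Normc.normc.
Implicit Types (u v w : V -> C).

Lemma normc_sqr (z : C) : normc z ^+ 2 = complex.Re z ^+ 2 + complex.Im z ^+ 2.
Proof. by case: z => a b; rewrite /normc sqr_sqrtr // addr_ge0 // sqr_ge0. Qed.

Lemma lnorm2E u :
  lnorm 2%:E u = ((\int[cnt]_x (normc (u x) ^+ 2)%:E) `^ 2^-1)%E.
Proof.
rewrite /lnorm unlock; congr (_ `^ _)%E; apply: eq_integral => x _ /=.
by rewrite ger0_norm ?normc_ge0 // powR_mulrn ?normc_ge0.
Qed.

Lemma ell2P u : ell2 u <-> cnt.-integrable setT (fun x : T => (normc (u x) ^+ 2)%:E).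
Proof.
have e : (\int[cnt]_x `|(normc (u x) ^+ 2)%:E| = \int[cnt]_x (normc (u x) ^+ 2)%:E)%E.
  by apply: eq_integral => x _ /=; rewrite ger0_norm // sqr_ge0.
rewrite /ell2 lnorm2E; split => h.
  apply/integrableP; split; first exact: measurable_fun_discrete.
  by rewrite e; apply: lty_poweRy h; rewrite invr_eq0 pnatr_eq0.
by apply: poweR_lty; rewrite -e; case/integrableP: h.
Qed.

Lemma integrable_dominated (f g : T -> R) :
  (forall x, `|f x| <= g x) -> cnt.-integrable setT (fun x => (g x)%:E) ->
  cnt.-integrable setT (fun x => (f x)%:E).
Proof.
move=> fg ig; apply: (le_integrable measurableT _ _ ig); first exact: measurable_fun_discrete.
by move=> x _ /=; rewrite lee_fin (le_trans (fg x)) // ler_norm.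
Qed.

Lemma normcM_le (y z : C) : normc (y * z^*) <= normc y ^+ 2 + normc z ^+ 2.
Proof.
rewrite Normc.normcM normc_conj; have := sqr_ge0 (normc y - normc z).
by have := sqr_ge0 (normc y + normc z); nra.
Qed.

Lemma normRe_le (z : C) : `|complex.Re z| <= normc z.
Proof.
rewrite -(@ler_pXn2r _ 2) ?nnegrE ?normc_ge0 // normc_sqr real_normK ?num_real //.
by rewrite lerDl sqr_ge0.
Qed.

Lemma normIm_le (z : C) : `|complex.Im z| <= normc z.
Proof.
rewrite -(@ler_pXn2r _ 2) ?nnegrE ?normc_ge0 // normc_sqr real_normK ?num_real //.
by rewrite lerDr sqr_ge0.
Qed.

Lemma Cintegrable_inner u v : ell2 u -> ell2 v ->
  Cintegrable cnt (fun x : T => u x * (v x)^*).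
Proof.
move=> /ell2P hu /ell2P hv.
have [i _] := Rintegral_lin 1 1 measurableT hu hv.
have h z : normc (u z * (v z)^*) <= 1 * normc (u z) ^+ 2 + 1 * normc (v z) ^+ 2.
  by rewrite !mul1r normcM_le.
by split; apply: (integrable_dominated _ i) => x; apply: le_trans (h x);
  [exact: normRe_le | exact: normIm_le].
Qed.

Lemma ell2_lin u v (a : C) : ell2 u -> ell2 v -> ell2 (fun x => a * u x + v x).
Proof.
move=> /ell2P hu /ell2P hv; apply/ell2P.
have [i _] := Rintegral_lin (2 * normc a ^+ 2) 2 measurableT hu hv.
apply: (integrable_dominated _ i) => x; rewrite ger0_norm ?sqr_ge0 //.
have h := le_normcD (a * u x) (v x).
have h1 : normc (a * u x + v x) ^+ 2 <= (normc (a * u x) + normc (v x)) ^+ 2.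
  by rewrite ler_pXn2r ?nnegrE ?addr_ge0 ?normc_ge0.
apply: le_trans h1 _; rewrite Normc.normcM.
by have := sqr_ge0 (normc a * normc (u x) - normc (v x)); nra.
Qed.

Lemma inner_linl u v w (a : C) : ell2 u -> ell2 v -> ell2 w ->
  inner (fun x => a * u x + v x) w = a * inner u w + inner v w.
Proof.
move=> hu hv hw; have [_ e] := Cintegral_lin a (Cintegrable_inner hu hw)
  (Cintegrable_inner hv hw).
rewrite /inner -[RHS]e; congr Cintegral; apply: funext => x.
by rewrite mulrDl mulrA.
Qed.

Lemma inner_conj u v : ell2 u -> ell2 v -> inner v u = (inner u v)^*.
Proof.
move=> hu hv; rewrite -[RHS](Cintegral_conj (Cintegrable_inner hu hv)).
congr Cintegral; apply: funext => x; rewrite rmorphM.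
by rewrite mulrC; congr (_ * _); case: (v x) => a b; rewrite /= opprK.
Qed.

Definition sqnorm u : R := Rintegral cnt setT (fun x : T => normc (u x) ^+ 2).

Lemma inner_self u : inner u u = (sqnorm u)%:C.
Proof.
rewrite /inner /Cintegral /sqnorm.
have -> : (fun x : T => complex.Re (u x * (u x)^*)) = (fun x => normc (u x) ^+ 2).
  by apply: funext => x; rewrite conjc_mulE.
have -> : (fun x : T => complex.Im (u x * (u x)^*)) = (fun x => 0).
  by apply: funext => x; rewrite conjc_mulE.
by rewrite Rintegral_cst // mul0r.
Qed.

Lemma sqnorm_ge0 u : 0 <= sqnorm u.
Proof. by apply: Rintegral_ge0 => x _; rewrite sqr_ge0. Qed.

Lemma integral_sqnorm u : ell2 u ->
  (\int[cnt]_x (normc (u x) ^+ 2)%:E = (sqnorm u)%:E)%E.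
Proof. by move=> /ell2P h; rewrite /sqnorm /Rintegral fineK //; exact: integrable_fin_num. Qed.

Lemma lnorm2_sqnorm u : ell2 u -> lnorm 2%:E u = (Num.sqrt (sqnorm u))%:E.
Proof.
by move=> hu; rewrite lnorm2E integral_sqnorm // poweR_EFin powR12_sqrt ?sqnorm_ge0.
Qed.

Lemma sum_le_sqnorm u (F : seq V) : ell2 u -> uniq F ->
  \sum_(x <- F) normc (u x) ^+ 2 <= sqnorm u.
Proof.
move=> hu uF; rewrite -lee_fin -integral_sqnorm // -sumEFin.
by apply: sum_le_integral_counting => // x; rewrite lee_fin sqr_ge0.
Qed.

Lemma ell2_of_sums (E : nat -> seq V) u (M : R) : exhaustion E ->
  (forall n, \sum_(x <- E n) normc (u x) ^+ 2 <= M) -> ell2 u /\ sqnorm u <= M.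
Proof.
move=> exE h.
have hM : (\int[cnt]_x (normc (u x) ^+ 2)%:E <= M%:E)%E.
  apply: (integral_counting_le exE) => [x|n]; first by rewrite lee_fin sqr_ge0.
  by rewrite sumEFin lee_fin.
have hu : ell2 u.
  by rewrite /ell2 lnorm2E; apply: poweR_lty; apply: le_lt_trans hM _; rewrite ltry.
by split=> //; rewrite -lee_fin -integral_sqnorm.
Qed.

Definition delta (x : V) : V -> C := fun y => (y == x)%:R.

Lemma Rintegral_counting1 (f : T -> R) (x : V) :
  Rintegral cnt setT (fun y : T => f y * (y == x)%:R) = f x.
Proof.
rewrite (_ : (fun y => _) = f \_ [set x]).
  by rewrite -Rintegral_mkcond /Rintegral integral_counting1.
apply: funext => y; rewrite /patch /=; case: ifPn => [/set_mem ->|/negP yx].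
  by rewrite eqxx mulr1.
by have [e|_] := eqVneq y x; [case: yx; apply/mem_set | rewrite mulr0].
Qed.

Lemma ell2_delta x : ell2 (delta x).
Proof.
rewrite /ell2 lnorm2E; apply: poweR_lty.
have -> : (\int[cnt]_y (normc (delta x y) ^+ 2)%:E = \int[cnt]_(y in [set x]) 1%E)%E.
  rewrite [RHS]integral_mkcond; apply: eq_integral => y _; rewrite /patch /delta.
  case: ifPn => [/set_mem ->|/negP yx]; first by rewrite eqxx Normc.normc1 expr1n.
  have [e|_] := eqVneq y x; first by case: yx; apply/mem_set.
  by rewrite Normc.normc0 expr0n.
by rewrite integral_counting1 ltry.
Qed.

Lemma inner_delta u x : inner u (delta x) = u x.
Proof.
rewrite /inner /Cintegral.
have e (y : T) : u y * (delta x y)^* = u y * (y == x)%:R.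
  by rewrite /delta; case: (y == x); rewrite ?rmorph1 ?rmorph0.
have -> : (fun y : T => complex.Re (u y * (delta x y)^*)) =
    (fun y => complex.Re (u y) * (y == x)%:R).
  apply: funext => y; rewrite e; case: (y == x); rewrite ?mulr1 ?mulr0 //.
have -> : (fun y : T => complex.Im (u y * (delta x y)^*)) =
    (fun y => complex.Im (u y) * (y == x)%:R).
  apply: funext => y; rewrite e; case: (y == x); rewrite ?mulr1 ?mulr0 //.
by rewrite !(Rintegral_counting1 (fun y => _)); case: (u x).
Qed.

End hilbert.

(** * Polarization, operator bounds and truncation *)

Section hilbert_algebra.
Context {R : realType} {V : pointedType}.
Local Notation C := R[i].
Local Notation normc := Normc.normc.
Implicit Types (u v w : V -> C).

Lemma ell2_0 : ell2 (fun=> 0 : C) (V := V).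
Proof.
have e : (fun=> 0 : C) = (fun x => -1 * delta point x + delta point x) :> (V -> C).
  by apply: funext => x; ring.
by rewrite e; apply: ell2_lin; exact: ell2_delta.
Qed.

Lemma ell2Z u (a : C) : ell2 u -> ell2 (fun x => a * u x).
Proof.
move=> hu; rewrite (_ : (fun x => _) = (fun x => a * u x + 0)).
  by apply: ell2_lin => //; exact: ell2_0.
by apply: funext => x; rewrite addr0.
Qed.

Lemma ell2D u v : ell2 u -> ell2 v -> ell2 (fun x => u x + v x).
Proof.
move=> hu hv; rewrite (_ : (fun x => _) = (fun x => 1 * u x + v x)).
  exact: ell2_lin.
by apply: funext => x; rewrite mul1r.
Qed.

Lemma ell2B u v : ell2 u -> ell2 v -> ell2 (fun x => u x - v x).
Proof.
move=> hu hv; rewrite (_ : (fun x => _) = (fun x => -1 * v x + u x)).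
  exact: ell2_lin.
by apply: funext => x; ring.
Qed.

Lemma ell2_sum (I : Type) (r : seq I) (f : I -> V -> C) :
  (forall i, ell2 (f i)) -> ell2 (fun x => \sum_(i <- r) f i x).
Proof.
move=> h; elim: r => [|i r IH].
  rewrite (_ : (fun x => _) = (fun=> 0)); first exact: ell2_0.
  by apply: funext => x; rewrite big_nil.
rewrite (_ : (fun x => _) = (fun x => f i x + \sum_(i <- r) f i x)).
  exact: ell2D.
by apply: funext => x; rewrite big_cons.
Qed.

Lemma inner0l u : ell2 u -> inner (fun=> 0) u = 0.
Proof.
move=> hu; rewrite (_ : (fun=> 0) = (fun x => -1 * u x + u x)).
  by rewrite inner_linl //; ring.
by apply: funext => x; ring.
Qed.

Lemma innerZl u v (a : C) : ell2 u -> ell2 v ->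
  inner (fun x => a * u x) v = a * inner u v.
Proof.
move=> hu hv; rewrite (_ : (fun x => _) = (fun x => a * u x + 0)).
  by rewrite inner_linl ?inner0l ?addr0 //; exact: ell2_0.
by apply: funext => x; rewrite addr0.
Qed.

Lemma innerDl u v w : ell2 u -> ell2 v -> ell2 w ->
  inner (fun x => u x + v x) w = inner u w + inner v w.
Proof.
move=> hu hv hw; rewrite (_ : (fun x => _) = (fun x => 1 * u x + v x)).
  by rewrite inner_linl ?mul1r.
by apply: funext => x; rewrite mul1r.
Qed.

Lemma innerBl u v w : ell2 u -> ell2 v -> ell2 w ->
  inner (fun x => u x - v x) w = inner u w - inner v w.
Proof.
move=> hu hv hw; rewrite (_ : (fun x => _) = (fun x => -1 * v x + u x)).
  by rewrite inner_linl //; ring.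
by apply: funext => x; ring.
Qed.

Lemma inner_suml (I : Type) (r : seq I) (f : I -> V -> C) v :
  (forall i, ell2 (f i)) -> ell2 v ->
  inner (fun x => \sum_(i <- r) f i x) v = \sum_(i <- r) inner (f i) v.
Proof.
move=> h hv; elim: r => [|i r IH].
  rewrite big_nil -[RHS](inner0l hv); congr inner.
  by apply: funext => x; rewrite big_nil.
rewrite big_cons -IH -innerDl //; last exact: ell2_sum.
by congr inner; apply: funext => x; rewrite big_cons.
Qed.

Lemma inner_linr u v w (a b : C) : a^* = b -> ell2 u -> ell2 v -> ell2 w ->
  inner w (fun x => a * u x + v x) = b * inner w u + inner w v.
Proof.
move=> <- hu hv hw; have huv := ell2_lin a hu hv.
rewrite (inner_conj huv hw) inner_linl // rmorphD rmorphM.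
by rewrite (inner_conj hu hw) (inner_conj hv hw).
Qed.

Lemma inner_linear_comb u v (a : C) : ell2 u -> ell2 v ->
  inner (fun x => a * v x + u x) (fun x => a * v x + u x) =
  a * a^* * inner v v + a * inner v u + a^* * inner u v + inner u u.
Proof.
move=> hu hv; have h := ell2_lin a hv hu.
rewrite inner_linl // (inner_linr (erefl _) hv hu hv).
by rewrite (inner_linr (erefl _) hv hu hu); ring.
Qed.

Lemma sqnorm_linear_comb u v (a b : C) : a^* = b -> ell2 u -> ell2 v ->
  (sqnorm (fun x => a * v x + u x))%:C =
  a * b * (sqnorm v)%:C + a * inner v u + b * inner u v + (sqnorm u)%:C.
Proof. by move=> <- hu hv; rewrite -!inner_self inner_linear_comb. Qed.

Let conj1 : (1 : C)^* = 1.
Proof. by apply/eqP; rewrite eq_complex /= oppr0 !eqxx. Qed.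

Let conjN1 : (-1 : C)^* = -1.
Proof. by apply/eqP; rewrite eq_complex /= !oppr0 !eqxx. Qed.

(** A spectral integral is known only through its diagonal entries. Polarization over u + a v with
    a^4 = 1 recovers the others, without self-adjointness of H, and the four squared norms add up to
    4 (|u|^2 + |v|^2). *)
Lemma polarization_bound (H : (V -> C) -> V -> C) (eps : R) u v :
  (forall w, ell2 w -> ell2 (H w)) ->
  (forall (a : C) w z, ell2 w -> ell2 z ->
    H (fun x => a * w x + z x) = (fun x => a * H w x + H z x)) ->
  (forall w, ell2 w -> normc (inner (H w) w) <= eps * sqnorm w) ->
  ell2 u -> ell2 v ->
  normc (inner (H u) v) <= eps * (sqnorm u + sqnorm v).
Proof.
move=> H2 Hl hb hu hv.
pose z (a : C) := (fun x => a * v x + u x) : V -> C.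
have z2 a : ell2 (z a) by apply: ell2_lin.
have Hz a b : a^* = b -> inner (H (z a)) (z a) = a * b * inner (H v) v
    + a * inner (H v) u + b * inner (H u) v + inner (H u) u.
  move=> <-; rewrite Hl // /z (inner_linl a (H2 v hv) (H2 u hu) (z2 a)).
  rewrite (inner_linr (erefl _) hv hu (H2 v hv)) (inner_linr (erefl _) hv hu (H2 u hu)); ring.
have Nz a b : a^* = b -> (sqnorm (z a))%:C = a * b * (sqnorm v)%:C + a * inner v u +
    b * inner u v + (sqnorm u)%:C by move=> ab; exact: sqnorm_linear_comb.
pose im : C := 0 +i* 1.
have i2 : im * im = -1.
  by apply/eqP; rewrite eq_complex /= !mulr0 !mul0r mulr1 sub0r addr0 oppr0 !eqxx.
have ni : normc im = 1 by rewrite /normc /= expr0n expr1n add0r sqrtr1.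
have ci : im^* = - im by apply/eqP; rewrite eq_complex /= !oppr0 !eqxx.
have cNi : (- im)^* = im by apply/eqP; rewrite eq_complex /= !oppr0 opprK !eqxx.
have pol : 4 * inner (H u) v = (inner (H (z 1)) (z 1) - inner (H (z (-1))) (z (-1)))
   + (im * inner (H (z im)) (z im) - im * inner (H (z (- im))) (z (- im))).
  rewrite (Hz _ _ conj1) (Hz _ _ conjN1) (Hz _ _ ci) (Hz _ _ cNi).
  move: (inner (H v) v) (inner (H v) u) (inner (H u) v) (inner (H u) u) => p q r t.
  transitivity (2 * r + 2 * q - 2 * (im * im) * r + 2 * (im * im) * q).
    by rewrite i2; ring.
  by ring.
have polN : sqnorm (z 1) + sqnorm (z (-1)) + (sqnorm (z im) + sqnorm (z (- im))) =
    4 * (sqnorm u + sqnorm v).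
  apply: (@complexI R); rewrite !rmorphD /= (Nz _ _ conj1) (Nz _ _ conjN1) (Nz _ _ ci) (Nz _ _ cNi).
  have e4 : (4 : R)%:C = 4 := rmorph_nat (real_complex R) 4.
  have -> : (4 * (sqnorm u + sqnorm v))%:C = 4 * ((sqnorm u)%:C + (sqnorm v)%:C).
    by rewrite -e4 -rmorphD -rmorphM.
  move: (inner v u) (inner u v) => q r.
  transitivity (4 * (sqnorm u)%:C + (2 - 2 * (im * im)) * (sqnorm v)%:C); first by ring.
  by rewrite i2; ring.
have n4 : normc (4 * inner (H u) v) = 4 * normc (inner (H u) v).
  by rewrite Normc.normcM -(rmorph_nat (real_complex R)) normc_real ger0_norm.
rewrite -(ler_pM2l (_ : 0 < 4 :> R)) // -n4 pol mulrCA -polN mulrDr.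
apply: le_trans (le_normcD _ _) _; apply: lerD.
  apply: le_trans (le_normcD _ _) _; rewrite normcN mulrDr.
  by apply: lerD; apply: hb.
apply: le_trans (le_normcD _ _) _; rewrite normcN mulrDr !Normc.normcM ni !mul1r.
by apply: lerD; apply: hb.
Qed.

(** A weak Cauchy-Schwarz inequality, polarization with H the identity; rescaling one vector then
    gives the form with a parameter used for limits. *)
Lemma inner_le u v : ell2 u -> ell2 v -> normc (inner u v) <= sqnorm u + sqnorm v.
Proof.
move=> hu hv; rewrite -[leRHS]mul1r.
apply: (@polarization_bound id) => // w hw; rewrite inner_self normc_real mul1r.
by rewrite ger0_norm // sqnorm_ge0.
Qed.

Lemma sqnormZ (a : C) u : ell2 u ->
  sqnorm (fun x => a * u x) = normc a ^+ 2 * sqnorm u.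
Proof.
move=> /ell2P hu; rewrite /sqnorm -RintegralZl //.
by congr Rintegral; apply: funext => x; rewrite Normc.normcM exprMn.
Qed.

Lemma inner_le_scaled u v (d : R) : 0 < d -> ell2 u -> ell2 v ->
  normc (inner u v) <= sqnorm u / d + d * sqnorm v.
Proof.
move=> d0 hu hv.
have := inner_le (ell2Z (d^-1)%:C hu) hv.
rewrite innerZl // sqnormZ // Normc.normcM normc_real.
rewrite ger0_norm ?invr_ge0 ?(ltW d0) // => h.
rewrite -(ler_pM2l (_ : 0 < d^-1)) ?invr_gt0 //; apply: le_trans h _.
by rewrite [leRHS](_ : _ = d^-1 ^+ 2 * sqnorm u + sqnorm v) //; field; rewrite gt_eqF.
Qed.

Lemma sqnormD_le u v : ell2 u -> ell2 v ->
  sqnorm (fun x => u x + v x) <= 2 * sqnorm u + 2 * sqnorm v.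
Proof.
move=> hu hv.
have e1 := sqnorm_linear_comb conj1 hu hv; have e2 := sqnorm_linear_comb conjN1 hu hv.
have e : sqnorm (fun x => 1 * v x + u x) + sqnorm (fun x => -1 * v x + u x) =
    2 * sqnorm u + 2 * sqnorm v.
  apply: (@complexI R); rewrite rmorphD /= e1 e2 !mulr_natl.
  rewrite rmorphD /= !rmorphMn /=; ring.
rewrite -e (_ : (fun x => u x + v x) = (fun x => 1 * v x + u x)).
  by rewrite lerDl sqnorm_ge0.
by apply: funext => x; ring.
Qed.

(** The norm is at most twice the numerical radius: polarization is applied to u and c H u, and c =
    1 / (2 eps) lets half of the left-hand side absorb the term in |H u|^2. *)
Lemma sqnorm_op_le (H : (V -> C) -> V -> C) (eps : R) u : 0 < eps ->
  (forall w, ell2 w -> ell2 (H w)) ->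
  (forall (a : C) w z, ell2 w -> ell2 z ->
    H (fun x => a * w x + z x) = (fun x => a * H w x + H z x)) ->
  (forall w, ell2 w -> normc (inner (H w) w) <= eps * sqnorm w) ->
  ell2 u -> sqnorm (H u) <= 4 * eps ^+ 2 * sqnorm u.
Proof.
move=> e0 H2 Hl hb hu; have hHu := H2 u hu.
pose c : R := (2 * eps)^-1; have c0 : 0 < c by rewrite invr_gt0 mulr_gt0.
have := polarization_bound H2 Hl hb hu (ell2Z c%:C hHu).
have hc := ell2Z c%:C hHu.
rewrite (inner_conj hc hHu) normc_conj innerZl // inner_self Normc.normcM !normc_real.
rewrite sqnormZ // normc_real (ger0_norm (ltW c0)) (ger0_norm (sqnorm_ge0 _)).
have ce : 2 * eps * c = 1 by rewrite mulfV // gt_eqF // mulr_gt0.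
set N := sqnorm (H u); set M := sqnorm u => h.
have : 4 * eps * (c * N) <= 4 * eps * (eps * (M + c ^+ 2 * N)).
  by rewrite ler_pM2l // mulr_gt0.
rewrite (_ : 4 * eps * (c * N) = 2 * (2 * eps * c) * N); last by ring.
rewrite (_ : 4 * eps * (_ * _) = 4 * eps ^+ 2 * M + (2 * eps * c) ^+ 2 * N); last by ring.
by rewrite ce; lra.
Qed.

Definition trunc (F : seq V) v : V -> C := fun x => \sum_(y <- F) v y * delta y x.

Lemma ell2_trunc F v : ell2 (trunc F v).
Proof. by apply: ell2_sum => y; apply: ell2Z; exact: ell2_delta. Qed.

Lemma inner_trunc F u v : ell2 u ->
  inner u (trunc F v) = \sum_(x <- F) u x * (v x)^*.
Proof.
move=> hu; rewrite (inner_conj (ell2_trunc F v) hu) inner_suml //; last first.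
  by move=> y; apply: ell2Z; exact: ell2_delta.
rewrite rmorph_sum; apply: eq_bigr => y _.
apply: etrans (congr1 (@conjc _) (innerZl (v y) (ell2_delta y) hu)) _.
rewrite rmorphM mulrC; congr (_ * _).
by rewrite -[RHS](inner_delta u y) (inner_conj (ell2_delta y) hu).
Qed.

Lemma trunc_eval F v x : uniq F -> trunc F v x = if x \in F then v x else 0.
Proof.
move=> uF; rewrite /trunc; case: ifPn => xF.
  rewrite (bigD1_seq x) //= {1}/delta eqxx mulr1 big1 ?addr0 // => y yx.
  by rewrite /delta eq_sym (negbTE yx) mulr0.
rewrite big_seq big1 // => y yF; rewrite /delta.
by have [e|_] := eqVneq x y; rewrite ?mulr0 //; rewrite e yF in xF.
Qed.

Lemma sqnorm_trunc F v : ell2 v -> uniq F ->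
  sqnorm (trunc F v) = \sum_(x <- F) normc (v x) ^+ 2.
Proof.
move=> hv uF; apply: (@complexI R); rewrite -inner_self inner_trunc; last exact: ell2_trunc.
rewrite rmorph_sum big_seq [RHS]big_seq; apply: eq_bigr => x xF /=.
by rewrite trunc_eval // xF conjc_mulE.
Qed.

Lemma sqnorm_sub_trunc F v : ell2 v -> uniq F ->
  sqnorm (fun x => v x - trunc F v x) = sqnorm v - \sum_(x <- F) normc (v x) ^+ 2.
Proof.
move=> hv uF; have ht := ell2_trunc F v.
have it : inner v (trunc F v) = (\sum_(x <- F) normc (v x) ^+ 2)%:C.
  rewrite inner_trunc // rmorph_sum; apply: eq_bigr => x _ /=; exact: conjc_mulE.
have := sqnorm_linear_comb conjN1 hv ht.
rewrite (inner_conj hv ht) it sqnorm_trunc // conjc_real => e.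
apply: (@complexI R).
rewrite (_ : (fun x => _) = (fun x => -1 * trunc F v x + v x)); last first.
  by apply: funext => x; ring.
by rewrite e rmorphB /=; ring.
Qed.

Lemma inner_partial_le (E : nat -> seq V) u v (M : R) : exhaustion E ->
  ell2 u -> ell2 v ->
  (forall n, normc (\sum_(x <- E n) u x * (v x)^*) <= M) -> normc (inner u v) <= M.
Proof.
move=> exE hu hv h; apply/ler_addgt0Pr => e e0.
have uE n : uniq (E n) by case: exE.
(* Once the tail of v has squared norm below d^2, [inner_le_scaled] bounds the truncation error by d
   + d |u|^2, which is e. *)
pose d := e / (sqnorm u + 1).
have Nu := sqnorm_ge0 u; have N1 : 0 < sqnorm u + 1 by lra.
have d0 : 0 < d by rewrite divr_gt0.
have [n hn] : exists n, sqnorm v - d * d < \sum_(x <- E n) normc (v x) ^+ 2.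
  apply: contrapT => hN.
  have : sqnorm v <= sqnorm v - d * d.
    have [] := @ell2_of_sums R V E v (sqnorm v - d * d) exE => // n.
    by rewrite leNgt; apply/negP => c; apply: hN; exists n.
  have := mulr_gt0 d0 d0; lra.
have ht := ell2_trunc (E n) v; have hb := ell2B hv ht.
have e1 : inner u v = inner u (trunc (E n) v) + inner u (fun x => v x - trunc (E n) v x).
  rewrite (_ : (fun x => v x - _) = (fun x => -1 * trunc (E n) v x + v x)).
    by rewrite (inner_linr conjN1) //; ring.
  by apply: funext => x; ring.
rewrite e1; apply: le_trans (le_normcD _ _) _; apply: lerD.
  by rewrite inner_trunc.
rewrite (inner_conj hb hu) normc_conj.
apply: le_trans (inner_le_scaled d0 hb hu) _.
rewrite sqnorm_sub_trunc //.
have : (sqnorm v - \sum_(x <- E n) normc (v x) ^+ 2) / d <= d.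
  by rewrite ler_pdivrMr //; lra.
have : d * (sqnorm u + 1) = e by rewrite /d mulfVK // gt_eqF.
lra.
Qed.

Lemma ell2_sqnorm0 u : ell2 u -> sqnorm u = 0 -> u = (fun=> 0).
Proof.
move=> hu u0; apply: funext => x; apply: Normc.eq0_normc.
have := @sum_le_sqnorm R V u [:: x] hu isT; rewrite u0 big_seq1 => h.
by apply/eqP; rewrite -sqrf_eq0 eq_le h sqr_ge0.
Qed.

End hilbert_algebra.

(** * Spectral bounds for the Laplacian *)

Section laplacian_form.
Context {R : realType} {V : pointedType} (Q : nat) (adj : rel V).
Hypotheses (Q2 : (2 <= Q)%N) (ht : homogeneous_tree Q adj).
Local Notation s := (Num.sqrt (Q%:R : R)).
Local Notation C := R[i].
Local Notation gam := (spectral_gap (R := R) Q).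
Local Notation normc := Normc.normc.
Local Notation lap := (neg_laplacian (R := R) Q adj).
Local Notation ker n x y := (treeker (K := R) adj n x y).

Lemma tree_exhaustion : exists E, exhaustion (V := V) E.
Proof.
pose B n := [set y | (gdist adj point y <= n)%N].
have fB n : finite_set (B n).
  apply: (@sub_finite_set _ _ [set` ball adj n point]); last exact: finite_seq.
  by move=> y /= /(mem_ball ht).
exists (fun n => fset_set (B n)); split.
- by move=> n; exact: fset_uniq.
- move=> n m nm x; rewrite !in_fset_set // => /set_mem h; apply/mem_set.
  exact: leq_trans h nm.
- move=> x; exists (gdist adj point x); rewrite in_fset_set //.
  by apply/mem_set; rewrite /B /=.
Qed.

Let adj_part (v : V -> C) x : C := v x - lap v x.

(** Schur's test at n = 1, where (n + 1) s^n = 2 s; division by Q + 1 gives exactly gam. That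
    [lap v] lies in l^2 will come from the boundedness contained in [spectral_integral]. *)
Lemma adj_part_bound (v : V -> C) : ell2 v -> ell2 (lap v) ->
  normc (inner (adj_part v) v) <= gam * sqnorm v.
Proof.
move=> hv hlv; have [E exE] := tree_exhaustion.
apply: (inner_partial_le exE (ell2B hv hlv) hv) => n.
have uG : uniq (E n) by case: exE.
set G := E n; pose L := undup (flatten [seq ball adj 1 x | x <- G]).
have uL : uniq L by exact: undup_uniq.
have inL x : x \in G -> forall y, (gdist adj x y <= 1)%N -> y \in L.
  move=> xG y /(mem_ball ht) h; rewrite mem_undup; apply/flatten_mapP.
  by exists x.
have Q1 : 0 < Q.+1%:R :> R by rewrite ltr0n.
pose A x := normc (v x) ^+ 2.
have A0 x : 0 <= A x by rewrite sqr_ge0.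
pose w := ground_state (R := R) Q adj point.
have wp x : 0 < w x by apply: ground_state_gt0.
apply: (@le_trans _ _ (Q.+1%:R^-1 * \sum_(x <- G) \sum_(y <- L) ker 1 x y *
     ((A y * (w x / w y) + A x * (w y / w x)) / 2))).
  apply: le_trans (normc_sum _ _) _; rewrite mulr_sumr [leLHS]big_seq [leRHS]big_seq.
  apply: ler_sum => x xG; rewrite Normc.normcM normc_conj /adj_part neg_laplacianE //.
  rewrite opprB addrC subrK Normc.normcM.
  have -> : normc (Q.+1%:R : C)^-1 = Q.+1%:R^-1.
    by rewrite -(rmorph_nat (real_complex R)) -fmorphV normc_real ger0_norm // invr_ge0 ltW.
  rewrite -mulrA; apply: ler_wpM2l; first by rewrite invr_ge0 ltW.
  rewrite -(chebU1 Q) (chebU_kernel ht v uL (inL x xG)).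
  apply: le_trans (ler_wpM2r (normc_ge0 _) (normc_sum _ _)) _.
  rewrite mulr_suml; apply: ler_sum => y _.
  rewrite Normc.normcM treeker_real normc_real ger0_norm ?treeker_ge0 // -mulrA.
  apply: ler_wpM2l; first exact: treeker_ge0.
  have r0 : 0 < w x / w y by rewrite divr_gt0.
  have rr : (w x / w y) * (w y / w x) = 1 by field; rewrite !gt_eqF.
  rewrite -[w y / w x](mulKf (_ : w x / w y != 0)) ?gt_eqF // rr mulr1.
  set r := w x / w y in r0 *; rewrite /A.
  have -> : (normc (v y) ^+ 2 * r + normc (v x) ^+ 2 * r^-1) / 2 =
     normc (v y) * normc (v x) + (normc (v y) * r - normc (v x)) ^+ 2 / (2 * r).
    by field; rewrite gt_eqF.
  by rewrite lerDl divr_ge0 ?sqr_ge0 // mulr_ge0 // ltW.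
apply: le_trans (ler_wpM2l _ (treeker_schur Q2 ht 1 point uL uG A0 A0)) _.
  by rewrite invr_ge0 ltW.
have hG := sum_le_sqnorm hv uG; have hL := sum_le_sqnorm hv uL.
rewrite (_ : gam = Q.+1%:R^-1 * (2 * s)); last first.
  by rewrite /spectral_gap -[Q.+1%:R]natr1 mulrC.
rewrite -[leRHS]mulrA; apply: ler_wpM2l; first by rewrite invr_ge0 ltW.
rewrite expr1; apply: ler_wpM2l; first by rewrite mulr_ge0 // sqrtr_ge0.
rewrite /A; lra.
Qed.

Lemma neg_laplacian_form_bounds (v : V -> C) : ell2 v -> ell2 (lap v) ->
  (1 - gam) * sqnorm v <= complex.Re (inner (lap v) v) <= (1 + gam) * sqnorm v.
Proof.
move=> hv hlv; have h := adj_part_bound hv hlv.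
have := le_trans (normRe_le _) h.
rewrite innerBl // inner_self; case: (inner (lap v) v) => a b /=.
by rewrite ler_norml => /andP[]; lra.
Qed.

End laplacian_form.

(** * Spectral measures *)

Section bounded_integrands.
Context d (T : measurableType d) (R : realType) (mu : {measure set T -> \bar R}).
Variable D : set T.
Hypotheses (mD : measurable D) (finD : (mu D < +oo)%E).
Implicit Types f g : T -> R.

Lemma bounded_integrable f (M : R) : measurable_fun D f ->
  (forall x, D x -> `|f x| <= M) -> mu.-integrable D (fun x => (f x)%:E).
Proof.
move=> mf fM; apply: measurable_bounded_integrable => //.
exists M; split; first exact: num_real.
by move=> y My x Dx /=; rewrite (le_trans (fM x Dx)) // ltW.
Qed.

Lemma Rintegral_le_bound f (M : R) : mu.-integrable D (fun x => (f x)%:E) ->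
  (forall x, D x -> f x <= M) -> Rintegral mu D f <= M * fine (mu D).
Proof.
move=> fi fM; rewrite -Rintegral_cst //; apply: le_Rintegral => //.
by apply: (@bounded_integrable _ `|M|) => //; exact: measurable_cst.
Qed.

Lemma Rintegral_norm_le_bound f (M : R) : mu.-integrable D (fun x => (f x)%:E) ->
  (forall x, D x -> `|f x| <= M) -> `|Rintegral mu D f| <= M * fine (mu D).
Proof.
move=> fi fM; apply: le_trans (le_normr_Rintegral mD fi) _.
apply: Rintegral_le_bound => //.
by move: (integrable_abse fi).
Qed.

Lemma Rintegral_carrier f (E : set T) : measurable E -> E `<=` D -> mu (D `\` E) = 0%E ->
  mu.-integrable D (fun x => (f x)%:E) -> Rintegral mu D f = Rintegral mu E f.
Proof.
move=> mE ED n0 fi; rewrite /Rintegral (@negligible_integral _ _ _ mu D (D `\` E)) //.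
  by rewrite setDD setIidr.
exact: measurableD.
Qed.

Lemma Rintegral_sum_indic (I : Type) (r : seq I) (c : I -> R) (S : I -> set T) :
  (forall i, measurable (S i)) -> (forall i, S i `<=` D) ->
  mu.-integrable D (fun x => (\sum_(i <- r) c i * \1_(S i) x)%:E) /\
  Rintegral mu D (fun x => \sum_(i <- r) c i * \1_(S i) x) =
    \sum_(i <- r) c i * fine (mu (S i)).
Proof.
move=> mS SD.
have i1 i : mu.-integrable D (fun x => (\1_(S i) x)%:E).
  apply: (@bounded_integrable _ 1); first exact: measurable_realfun.measurable_indic.
  by move=> x _; rewrite indicE ger0_norm ?lern1 ?leq_b1 ?ler0n.
elim: r => [|i r [IH1 IH2]].
  have -> : (fun x => \sum_(i <- [::]) c i * \1_(S i) x) = fun=> 0.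
    by apply: funext => x; rewrite big_nil.
  split; last by rewrite big_nil Rintegral_cst // mul0r.
  rewrite (_ : (fun x => _) = (fun x => (0 : R)%:E)).
    by apply: (@bounded_integrable _ 0) => [|x _]; [exact: measurable_cst | rewrite normr0].
  by apply: funext => x; rewrite big_nil.
have [j1 j2] := Rintegral_lin (c i) 1 mD (i1 i) IH1.
have e : (fun x => \sum_(k <- i :: r) c k * \1_(S k) x) =
    (fun x => c i * \1_(S i) x + 1 * \sum_(k <- r) c k * \1_(S k) x).
  by apply: funext => x; rewrite big_cons mul1r.
split; first exact: (eq_ind _ (fun h => mu.-integrable D (fun x => (h x)%:E)) j1 _ (esym e)).
rewrite e j2 IH2 big_cons mul1r; congr (_ * _ + _).
by rewrite /Rintegral integral_indic // setIidl.
Qed.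

End bounded_integrands.

(** * Projection-valued measures *)

Section projection_valued.
Context {R : realType} {V : pointedType}.
Local Notation C := R[i].
Local Notation normc := Normc.normc.
Local Notation RR := (measurableTypeR R).
Variable P : set R -> (V -> C) -> (V -> C).
Hypothesis hP : projection_valued_measure P.
Implicit Types (u v : V -> C) (B S : set RR).

Lemma pvm_ell2 B u : measurable B -> ell2 u -> ell2 (P B u).
Proof. by case: hP => h _ _ _ mB; have [[h1 _ _] _ _] := h B mB; apply: h1. Qed.

Lemma pvm_lin B (a : C) u v : measurable B -> ell2 u -> ell2 v ->
  P B (fun x => a * u x + v x) = (fun x => a * P B u x + P B v x).
Proof. by case: hP => h _ _ _ mB; have [[_ h1 _] _ _] := h B mB; apply: h1. Qed.

Lemma pvm_capI B S u : measurable B -> measurable S -> ell2 u ->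
  P (B `&` S) u = P B (P S u).
Proof. by case: hP => _ _ h _ mB mS hu; exact: h. Qed.

Lemma pvm_inner B u : measurable B -> ell2 u -> inner (P B u) u = (sqnorm (P B u))%:C.
Proof.
case: hP => h _ _ _ mB hu; have [_ idem sa] := h B mB.
by rewrite -inner_self -[in LHS](idem u hu) sa //; exact: pvm_ell2.
Qed.

Lemma diag_measureE u (mu : {measure set RR -> \bar R}) B : ell2 u ->
  diag_measure P u mu -> measurable B -> mu B = (sqnorm (P B u))%:E.
Proof. by move=> hu hmu mB; rewrite hmu // pvm_inner. Qed.

Lemma diag_measureT u (mu : {measure set RR -> \bar R}) : ell2 u ->
  diag_measure P u mu -> mu setT = (sqnorm u)%:E.
Proof.
by move=> hu hmu; rewrite (diag_measureE hu hmu) //; case: hP => _ -> .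
Qed.

Lemma diag_measure_exists u : ell2 u ->
  exists mu : {measure set RR -> \bar R}, diag_measure P u mu.
Proof. by case: hP => _ _ _ h; apply: h. Qed.

Lemma pvm0 u : ell2 u -> P set0 u = (fun=> 0).
Proof.
move=> hu; have [mu hmu] := diag_measure_exists hu.
have m0 : measurable (set0 : set RR) by exact: measurable0.
apply: ell2_sqnorm0; first exact: pvm_ell2.
have := diag_measureE hu hmu m0.
by rewrite measure0 => -[<-].
Qed.

Lemma pvm_disjoint B S u : measurable B -> measurable S -> ell2 u ->
  B `&` S = set0 -> P B (P S u) = (fun=> 0).
Proof. by move=> mB mS hu BS; rewrite -pvm_capI // BS pvm0. Qed.

Lemma spectral_real_part (A : (V -> C) -> V -> C) (f : R -> C) v
    (mu : {measure set RR -> \bar R}) :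
  spectral_integral P f A -> ell2 v -> diag_measure P v mu ->
  mu.-integrable setT (fun l => (complex.Re (f l))%:E) /\
  complex.Re (inner (A v) v) = Rintegral mu setT (fun l => complex.Re (f l)).
Proof.
by move=> [_ h] hv hmu; have [[h1 _] ->] := h v hv mu hmu.
Qed.

(* sg = 1 and sg = -1 give the two ends of the spectrum. *)
Lemma pvm_null_outside (A : (V -> C) -> V -> C) (sg c e : R) S :
  spectral_integral P (fun l => l%:C) A -> measurable S ->
  (forall v, ell2 v -> c * sqnorm v <= sg * complex.Re (inner (A v) v)) ->
  e < c -> (forall l, S l -> sg * l <= e) ->
  forall u, ell2 u -> P S u = (fun=> 0).
Proof.
(* The spectral measure of v = P S u is carried by S, so sg times the form at v is at most e |v|^2.
   It is also at least c |v|^2 with e < c, hence v = 0. *)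
move=> hA mS hc ec hS u hu; pose v := P S u.
have hv : ell2 v by exact: pvm_ell2.
have [mu hmu] := diag_measure_exists hv.
have mSC : measurable (~` S) by exact: measurableC.
have muT := diag_measureT hv hmu.
have muSC : mu (setT `\` S) = 0%E.
  rewrite setTD (diag_measureE hv hmu mSC) /v pvm_disjoint // ?setICl //.
  by rewrite /sqnorm (_ : (fun x => _) = fun=> 0) ?Rintegral_cst ?mul0r //;
    apply: funext => x; rewrite Normc.normc0 expr0n.
have muS : mu S = (sqnorm v)%:E.
  by rewrite (diag_measureE hv hmu mS) /v -pvm_capI // setIid.
have [ig eg] := spectral_real_part hA hv hmu.
have finS : (mu S < +oo)%E by rewrite muS ltry.
have := hc v hv; rewrite eg (Rintegral_carrier measurableT (E := S)) // => h.
have igS := integrableS measurableT mS (@subsetT _ S) ig.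
have [i1 e1] := Rintegral_lin sg 0 mS igS igS.
have h2 : sg * Rintegral mu S (fun l => complex.Re l%:C) <= e * sqnorm v.
  have -> : sqnorm v = fine (mu S) by rewrite muS.
  rewrite -[leLHS]addr0 -[X in _ + X](mul0r (Rintegral mu S (fun l => complex.Re l%:C))).
  rewrite -e1; apply: Rintegral_le_bound => // l Sl.
  by rewrite /= mul0r addr0; apply: hS.
apply: ell2_sqnorm0 => //; apply/eqP; rewrite eq_le sqnorm_ge0 andbT.
by have := le_trans h h2; rewrite -subr_le0 -mulrBl pmulr_rle0 // subr_gt0.
Qed.

End projection_valued.

Lemma le0_of_le_inv {R : realType} (X C : R) :
  (forall n : nat, X <= C / n.+1%:R) -> X <= 0.
Proof.
move=> h; rewrite leNgt; apply/negP => X0.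
have := h (Num.trunc (C / X)); rewrite leNgt => /negP; apply.
have := truncnS_gt (C / X).
by rewrite ltr_pdivrMr // ltr_pdivrMr ?ltr0n // mulrC.
Qed.

Lemma exprB_le {R : realType} (x y B d : R) m : 1 <= B -> `|x| <= B -> `|y| <= B ->
  `|x - y| <= d -> `|x ^+ m - y ^+ m| <= m%:R * B ^+ m * d.
Proof.
move=> B1 xB yB xyd; have d0 : 0 <= d by apply: le_trans xyd.
have B0 : 0 <= B by apply: le_trans B1.
elim: m => [|m IH]; first by rewrite !expr0 subrr normr0 !mul0r.
rewrite (_ : x ^+ m.+1 - y ^+ m.+1 = x * (x ^+ m - y ^+ m) + (x - y) * y ^+ m); last first.
  by rewrite !exprS; ring.
apply: le_trans (ler_normD _ _) _; rewrite !normrM normrX.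
have h1 := ler_pM (normr_ge0 _) (normr_ge0 _) xB IH.
have yBm : `|y| ^+ m <= B ^+ m by apply: lerXn2r; rewrite ?nnegrE.
have h2 := ler_pM (normr_ge0 _) (exprn_ge0 m (normr_ge0 y)) xyd yBm.
apply: le_trans (lerD h1 h2) _.
have Bm : d * B ^+ m <= d * (B * B ^+ m).
  by rewrite ler_wpM2l // ler_peMl // exprn_ge0.
rewrite exprS -natr1; lra.
Qed.

(** * Moments of the spectral measures *)

Section spectral_moments.
Context {R : realType} {V : pointedType}.
Local Notation C := R[i].
Local Notation normc := Normc.normc.
Local Notation RR := (measurableTypeR R).
Variable P : set R -> (V -> C) -> (V -> C).
Hypothesis hP : projection_valued_measure P.
Variable A : (V -> C) -> V -> C.
Hypothesis hA : spectral_integral P (fun l => l%:C) A.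
Variables a b : R.
Hypothesis ab : a < b.
Local Notation K := ([set` `[a, b[] : set RR).
Hypothesis hK : forall u, ell2 u -> P (~` K) u = (fun=> 0).
Implicit Types (u v w : V -> C).

Let mK : measurable K. Proof. exact: measurable_itv. Qed.

Let A2 u : ell2 u -> ell2 (A u).
Proof. by case: hA => [[h _ _] _]; apply: h. Qed.

Let Alin (z : C) u v : ell2 u -> ell2 v ->
  A (fun x => z * u x + v x) = (fun x => z * A u x + A v x).
Proof. by case: hA => [[_ h _] _]; apply: h. Qed.

Let Abound : exists2 M, 0 <= M & forall u, ell2 u -> sqnorm (A u) <= M * sqnorm u.
Proof.
case: hA => [[_ _ [M hM]] _]; exists (M ^+ 2); first exact: sqr_ge0.
move=> u hu; have := hM u hu; rewrite (lnorm2_sqnorm (A2 hu)) (lnorm2_sqnorm hu) -EFinM lee_fin => h.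
have h0 := sqrtr_ge0 (sqnorm (A u)).
have := ler_pM h0 h0 h h; rewrite -!expr2 sqr_sqrtr ?sqnorm_ge0 //.
by rewrite exprMn sqr_sqrtr ?sqnorm_ge0.
Qed.

Lemma ell2_iter (T : (V -> C) -> V -> C) k u :
  (forall w, ell2 w -> ell2 (T w)) -> ell2 u -> ell2 (iter k T u).
Proof. by move=> h hu; elim: k => //= k; apply: h. Qed.

Section with_measure.
Variables (u : V -> C) (mu : {measure set RR -> \bar R}).
Hypotheses (hu : ell2 u) (hmu : diag_measure P u mu).

Lemma diag_measure_finite : (mu setT < +oo)%E.
Proof. by rewrite (diag_measureT hP hu hmu) ltry. Qed.

Lemma diag_measure_null_outside : mu (setT `\` K) = 0%E.
Proof.
rewrite setTD (diag_measureE hP hu hmu) ?hK //; last exact: measurableC.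
rewrite /sqnorm (_ : (fun x => _) = fun=> 0) ?Rintegral_cst ?mul0r //.
by apply: funext => x; rewrite Normc.normc0 expr0n.
Qed.

Lemma diag_measure_carrier_finite : (mu K < +oo)%E.
Proof.
apply: le_lt_trans diag_measure_finite; apply: le_measure; rewrite ?inE //.
Qed.

Lemma diag_measure_carrier : fine (mu K) = sqnorm u.
Proof.
have i1 : mu.-integrable setT (fun l => (1 : R)%:E).
  apply: (@bounded_integrable _ _ _ mu setT measurableT diag_measure_finite _ 1).
    exact: measurable_cst.
  by move=> x _; rewrite normr1.
have := Rintegral_carrier measurableT mK (@subsetT _ K) diag_measure_null_outside i1.
by rewrite !Rintegral_cst // !mul1r (diag_measureT hP hu hmu) /= => <-.
Qed.

Lemma inner_spectral : inner (A u) u = (Rintegral mu K (fun l => l))%:C.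
Proof.
have [_ h] := hA; have [[h1 _] ->] := h u hu mu hmu.
rewrite /Cintegral (Rintegral_carrier measurableT mK _ diag_measure_null_outside h1) //.
by rewrite [X in _ +i* X]Rintegral_cst ?mul0r.
Qed.

End with_measure.

Let dl n : R := (b - a) / n.+1%:R.
Let c n (j : nat) : R := a + j%:R * dl n.
(** Half-open cells tile the half-open interval K without overlap, and truncation gives the index of
    the cell of a point. *)
Let cell n (j : nat) : set RR := [set` `[c n j, c n j.+1[].
Let idx n (l : R) := Num.trunc ((l - a) / dl n).

Let dl_gt0 n : 0 < dl n.
Proof. by rewrite divr_gt0 ?subr_gt0. Qed.

Let mcell n j : measurable (cell n j).
Proof. exact: measurable_itv. Qed.

Let cellP n j l : a <= l -> (l \in cell n j) = (idx n l == j).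
Proof.
move=> al; have d0 := dl_gt0 n.
have x0 : 0 <= (l - a) / dl n by rewrite divr_ge0 ?subr_ge0 // ltW.
have e : (l \in cell n j) = (j%:R <= (l - a) / dl n < j.+1%:R).
  rewrite ler_pdivlMr // ltr_pdivrMr // lerBrDl ltrBlDl.
  by apply/idP/idP => [/set_mem|h]; [|apply/mem_set]; rewrite /cell /= in_itv.
rewrite e; apply/idP/eqP => [/truncn_def //|<-].
exact: truncn_itv.
Qed.

Let cell_sub n j : (j < n.+1)%N -> cell n j `<=` K.
Proof.
move=> jn l; rewrite /cell /= !in_itv /= => /andP[h1 h2]; have d0 := dl_gt0 n.
apply/andP; split; first by apply: le_trans h1; rewrite /c lerDl mulr_ge0 // ltW.
apply: lt_le_trans h2 _; have -> : b = a + n.+1%:R * dl n.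
  by rewrite /dl mulrCA mulfV ?pnatr_eq0 // mulr1 addrC subrK.
by rewrite /c lerD2l ler_pM2r // ler_nat.
Qed.

Let cell_ge n j l : cell n j l -> a <= l.
Proof.
rewrite /cell /= in_itv /= => /andP[h _]; apply: le_trans h.
by rewrite /c lerDl mulr_ge0 // ltW.
Qed.

Let cell_disj n i j : i != j -> cell n i `&` cell n j = set0.
Proof.
move=> ij; apply/seteqP; split=> // l [hi hj].
have al := cell_ge hi; move: hi hj => /mem_set + /mem_set.
by rewrite !cellP // => /eqP -> /eqP e; rewrite e eqxx in ij.
Qed.

Let idx_lt n l : K l -> (idx n l < n.+1)%N.
Proof.
rewrite /= in_itv /= => /andP[al lb]; have d0 := dl_gt0 n.
have x0 : 0 <= (l - a) / dl n by rewrite divr_ge0 ?subr_ge0 // ltW.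
rewrite truncn_lt_nat // ltr_pdivrMr // /dl mulrCA mulfV ?pnatr_eq0 // mulr1.
by rewrite ltrD2r.
Qed.

Let idx_close n l : K l -> `|l - c n (idx n l)| <= dl n.
Proof.
move=> Kl; have al : a <= l by move: Kl; rewrite /= in_itv /= => /andP[].
have : l \in cell n (idx n l) by rewrite cellP.
move=> /set_mem; rewrite /cell /= in_itv /= => /andP[h1 h2].
rewrite ger0_norm ?subr_ge0 // lerBlDl ltW //.
by move: h2; rewrite /c -natr1 mulrDl mul1r addrA.
Qed.

Let step n k (l : R) : R := \sum_(j < n.+1) c n j ^+ k * \1_(cell n j) l.

Let stepE n k l : K l -> step n k l = c n (idx n l) ^+ k.
Proof.
move=> Kl; have al : a <= l by move: Kl; rewrite /= in_itv /= => /andP[].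
rewrite /step (bigD1 (Ordinal (idx_lt n Kl))) //= indicE cellP // eqxx mulr1.
rewrite big1 ?addr0 // => j jn; rewrite indicE cellP //.
by rewrite eq_sym -(inj_eq val_inj) /= in jn; rewrite (negbTE jn) mulr0.
Qed.

(** A Riemann sum of the spectral integral of l, with the left endpoints of the cells as sample
    points. *)
Let D n (u : V -> C) (x : V) : C := \sum_(j < n.+1) (c n j)%:C * P (cell n j) u x.

Let D2 n u : ell2 u -> ell2 (D n u).
Proof.
move=> hu; apply: ell2_sum => j; apply: ell2Z.
by apply: pvm_ell2.
Qed.

Let Dlin n (z : C) u v : ell2 u -> ell2 v ->
  D n (fun x => z * u x + v x) = (fun x => z * D n u x + D n v x).
Proof.
move=> hu hv; apply: funext => x; rewrite /D mulr_sumr -big_split.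
apply: eq_bigr => j _ /=; rewrite pvm_lin //; ring.
Qed.

Let pvm_sum B (I : Type) (r : seq I) (z : I -> C) (f : I -> V -> C) : measurable B ->
  (forall i, ell2 (f i)) ->
  P B (fun x => \sum_(i <- r) z i * f i x) = (fun x => \sum_(i <- r) z i * P B (f i) x).
Proof.
move=> mB hf; have z0 := @ell2_0 R V.
have P0 : P B (fun=> 0) = (fun=> 0).
  have := @pvm_lin _ _ _ hP B 1 _ _ mB z0 z0.
  rewrite (_ : (fun x => _) = (fun=> 0)) => [h|]; last first.
    by apply: funext => x; rewrite mul1r addr0.
  apply: funext => x; have /(congr1 (fun g => g x)) := h.
  by rewrite mul1r => /eqP; rewrite addrC -subr_eq subrr => /eqP <-.
elim: r => [|i r IH].
  rewrite (_ : (fun x => _) = (fun=> 0)) ?P0.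
    by apply: funext => x; rewrite big_nil.
  by apply: funext => x; rewrite big_nil.
rewrite (_ : (fun x => _) = (fun x => z i * f i x + \sum_(i <- r) z i * f i x)).
  rewrite pvm_lin //; last by apply: ell2_sum => j; apply: ell2Z.
  by apply: funext => x; rewrite big_cons IH.
by apply: funext => x; rewrite big_cons.
Qed.

(** Projections onto disjoint cells annihilate each other, so powers act on the sample values.
    Exponent 0 is left out: it would say that the projections onto the cells sum to the identity. *)
Let iterD n k u : ell2 u ->
  iter k.+1 (D n) u = (fun x => \sum_(j < n.+1) (c n j ^+ k.+1)%:C * P (cell n j) u x).
Proof.
move=> hu; elim: k => [|k IH].
  by apply: funext => x; rewrite /= /D; apply: eq_bigr => j _; rewrite expr1.
rewrite iterS IH; apply: funext => x; rewrite /D; apply: eq_bigr => j _.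
rewrite (pvm_sum _ _ (mcell n j)); last by move=> i; apply: pvm_ell2.
rewrite (bigD1 j) //= big1 ?addr0 => [|i ij].
  by rewrite -pvm_capI // setIid mulrA -rmorphM -exprS.
rewrite (pvm_disjoint hP (mcell n j) (mcell n i) hu) ?mulr0 //; apply: cell_disj.
by rewrite eq_sym (inj_eq val_inj).
Qed.

Let inner_iterD n k u (mu : {measure set RR -> \bar R}) : ell2 u ->
  diag_measure P u mu ->
  inner (iter k.+1 (D n) u) u = (Rintegral mu K (step n k.+1))%:C.
Proof.
move=> hu hmu; rewrite iterD //.
have [_ e] := @Rintegral_sum_indic _ _ _ mu K mK (diag_measure_carrier_finite hu hmu) _
  (index_enum 'I_n.+1) (fun j => c n j ^+ k.+1) (cell n) (mcell n)
  (fun j => cell_sub (ltn_ord j)).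
rewrite /step e rmorph_sum inner_suml //; last first.
  by move=> j; apply: ell2Z; apply: pvm_ell2.
apply: eq_bigr => j _; rewrite innerZl //; last exact: pvm_ell2.
by rewrite pvm_inner // (diag_measureE hP hu hmu) //= -rmorphM.
Qed.

Let step_integrable n k (mu : {measure set RR -> \bar R}) u : ell2 u ->
  diag_measure P u mu -> mu.-integrable K (fun l => (step n k l)%:E).
Proof.
move=> hu hmu.
by have [] := @Rintegral_sum_indic _ _ _ mu K mK (diag_measure_carrier_finite hu hmu) _
  (index_enum 'I_n.+1) (fun j => c n j ^+ k) (cell n) (mcell n)
  (fun j => cell_sub (ltn_ord j)).
Qed.

Let Bd := 1 + `|a| + `|b|.

Let Bd1 : 1 <= Bd.
Proof. by rewrite /Bd; have := normr_ge0 a; have := normr_ge0 b; lra. Qed.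

Let Bd_bound l : a <= l -> l <= b -> `|l| <= Bd.
Proof.
move=> al lb; rewrite /Bd ler_norml; have := ler_norm a; have := ler_norm b.
by have := ler_norm (- a); have := ler_norm (- b); rewrite !normrN; lra.
Qed.

Let K_bound l : K l -> `|l| <= Bd.
Proof.
by rewrite /= in_itv /= => /andP[al lb]; apply: Bd_bound => //; exact: ltW.
Qed.

Let c_bound n l : K l -> `|c n (idx n l)| <= Bd.
Proof.
move=> Kl; have al : a <= l by move: Kl; rewrite /= in_itv /= => /andP[].
have : l \in cell n (idx n l) by rewrite cellP.
move=> /set_mem; rewrite /cell /= in_itv /= => /andP[h1 h2].
apply: Bd_bound; first by rewrite /c lerDl mulr_ge0 // ltW.
by apply: le_trans h1 _; move: Kl; rewrite /= in_itv /= => /andP[_ /ltW].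
Qed.

Lemma integrable_exprn k u (mu : {measure set RR -> \bar R}) : ell2 u ->
  diag_measure P u mu -> mu.-integrable K (fun l => (l ^+ k)%:E).
Proof.
move=> hu hmu.
apply: (@bounded_integrable _ _ _ mu K mK (diag_measure_carrier_finite hu hmu) _ (Bd ^+ k)).
  exact: measurable_realfun.exprn_measurable.
by move=> l Kl; rewrite normrX; apply: lerXn2r; rewrite ?nnegrE // ?K_bound //
  (le_trans ler01) // Bd1.
Qed.

Let step_close n k u (mu : {measure set RR -> \bar R}) : ell2 u ->
  diag_measure P u mu ->
  `|Rintegral mu K (fun l => l ^+ k) - Rintegral mu K (step n k)| <=
    k%:R * Bd ^+ k * dl n * sqnorm u.
Proof.
move=> hu hmu; have i1 := integrable_exprn k hu hmu; have i2 := step_integrable n k hu hmu.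
have [i3 e3] := Rintegral_lin 1 (-1) mK i1 i2.
rewrite -[X in `|X + _|]mul1r -mulN1r -e3 -(diag_measure_carrier hu hmu).
apply: Rintegral_norm_le_bound => //; first exact: diag_measure_carrier_finite hu hmu.
move=> l Kl; rewrite mul1r mulN1r stepE //; apply: exprB_le => //.
- exact: K_bound.
- exact: c_bound.
- exact: idx_close.
Qed.

Let H n (u : V -> C) (x : V) : C := A u x - D n u x.

Let H_form n u : ell2 u -> normc (inner (H n u) u) <= Bd * dl n * sqnorm u.
Proof.
move=> hu; have [mu hmu] := diag_measure_exists hP hu.
rewrite (innerBl (A2 hu) (D2 n hu) hu) (inner_spectral hu hmu).
have -> : inner (D n u) u = (Rintegral mu K (step n 1))%:C := @inner_iterD n 0 u mu hu hmu.
rewrite -rmorphB normc_real.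
have := step_close n 1 hu hmu; rewrite mul1r expr1.
by have -> : (fun l : RR => l ^+ 1) = (fun l => l) by apply: funext => l; rewrite expr1.
Qed.

Let H_bound n u : ell2 u -> sqnorm (H n u) <= 4 * (Bd * dl n) ^+ 2 * sqnorm u.
Proof.
move=> hu; apply: sqnorm_op_le => //.
- by rewrite mulr_gt0 // (lt_le_trans ltr01).
- by move=> w hw; apply: ell2B; [exact: A2 | exact: D2].
- move=> z w y hw hy; apply: funext => x; rewrite /H Alin // Dlin //; ring.
- by move=> w hw; apply: H_form.
Qed.

Let dl_le n : dl n <= b - a.
Proof. by rewrite /dl ler_pdivrMr // ler_peMr ?ler1n // subr_ge0 ltW. Qed.

Let iter_close k u : ell2 u -> exists2 M, 0 <= M & forall n,
  sqnorm (fun x => iter k A u x - iter k (D n) u x) <= M * dl n ^+ 2.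
Proof.
move=> hu; elim: k => [|k [M M0 IH]].
  exists 0 => // n; rewrite mul0r /sqnorm (_ : (fun x => _) = fun=> 0).
    by rewrite Rintegral_cst // mul0r.
  by apply: funext => x; rewrite /= subrr Normc.normc0 expr0n.
(* The induction uses A^(k+1) - D^(k+1) = A (A^k - D^k) + (A - D) D^k. N0 bounds |D^k u|^2 for all n
   at once, through [dl_le] and the induction hypothesis. *)
have [L L0 hL] := Abound.
pose N0 := 2 * sqnorm (iter k A u) + 2 * (M * (b - a) ^+ 2).
have hA_k := ell2_iter k A2 hu.
have N00 : 0 <= N0.
  apply: addr_ge0; first by rewrite mulr_ge0 // sqnorm_ge0.
  by rewrite mulr_ge0 // mulr_ge0 // sqr_ge0.
exists (2 * (L * M) + 2 * (4 * Bd ^+ 2 * N0)) => [|n].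
  apply: addr_ge0; first by rewrite mulr_ge0 // mulr_ge0.
  by rewrite mulr_ge0 // mulr_ge0 // mulr_ge0 // sqr_ge0.
have hD_k := ell2_iter k (@D2 n) hu.
have hdiff := ell2B hA_k hD_k.
have e : (fun x => iter k.+1 A u x - iter k.+1 (D n) u x) =
   (fun x => A (fun y => iter k A u y - iter k (D n) u y) x + H n (iter k (D n) u) x).
  apply: funext => x; rewrite /H /=.
  have -> : (fun y => iter k A u y - iter k (D n) u y) =
      (fun y => -1 * iter k (D n) u y + iter k A u y) by apply: funext => y; ring.
  by rewrite Alin //; ring.
rewrite e; apply: le_trans (sqnormD_le (A2 hdiff) _) _.
  by apply: ell2B; [exact: A2 | exact: D2].
rewrite [leRHS]mulrDl; apply: lerD.
  rewrite -!mulrA ler_wpM2l //; apply: le_trans (hL _ hdiff) _.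
  by rewrite ler_wpM2l.
rewrite -!mulrA ler_wpM2l //; apply: le_trans (H_bound n hD_k) _.
rewrite exprMn [leRHS](_ : _ = 4 * (Bd ^+ 2 * dl n ^+ 2) * N0); last by ring.
apply: ler_wpM2l; first by rewrite mulr_ge0 // mulr_ge0 // sqr_ge0.
have e2 : iter k (D n) u = (fun x => iter k A u x + -1 * (iter k A u x - iter k (D n) u x)).
  by apply: funext => x; ring.
rewrite e2; apply: le_trans (sqnormD_le hA_k (ell2Z _ hdiff)) _.
rewrite sqnormZ // normcN Normc.normc1 expr1n mul1r.
rewrite lerD2l ler_wpM2l //; apply: le_trans (IH n) _.
rewrite ler_wpM2l // ler_pXn2r ?nnegrE ?dl_le // ?subr_ge0; exact: ltW.
Qed.

(** Multiplicativity of the functional calculus is not contained in the weak definition of A. The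
    Riemann sums D converge to A in norm, by [sqnorm_op_le], and their powers are explicit; the two
    errors are of order dl n. *)
Lemma inner_iter_spectral k u (mu : {measure set RR -> \bar R}) : ell2 u ->
  diag_measure P u mu ->
  inner (iter k A u) u = (Rintegral mu K (fun l => l ^+ k))%:C.
Proof.
move=> hu hmu; case: k => [|k].
  have -> : (fun l : RR => l ^+ 0) = fun=> 1 by apply: funext => l; rewrite expr0.
  by rewrite inner_self Rintegral_cst // mul1r (diag_measure_carrier hu hmu).
apply/eqP; rewrite -subr_eq0; apply/eqP/Normc.eq0_normc/eqP.
rewrite eq_le normc_ge0 andbT.
have [M M0 hM] := iter_close k.+1 hu.
pose L := M + sqnorm u + k.+1%:R * Bd ^+ k.+1 * sqnorm u.
apply: (@le0_of_le_inv _ _ (L * (b - a))) => n.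
have hA_k := ell2_iter k.+1 A2 hu.
have hD_k := ell2_iter k.+1 (@D2 n) hu.
have hdiff := ell2B hA_k hD_k.
rewrite -mulrA -/(dl n).
rewrite (_ : inner _ u - _ = inner (fun x => iter k.+1 A u x - iter k.+1 (D n) u x) u
  - (Rintegral mu K (fun l => l ^+ k.+1) - Rintegral mu K (step n k.+1))%:C); last first.
  by rewrite (innerBl hA_k hD_k hu) (inner_iterD n k hu hmu) rmorphB /=; ring.
apply: le_trans (le_normcD _ _) _; rewrite normcN normc_real /L mulrDl; apply: lerD.
  apply: le_trans (inner_le_scaled (dl_gt0 n) hdiff hu) _.
  rewrite mulrDl [sqnorm u * _]mulrC lerD2r ler_pdivrMr // -mulrA -expr2.
  exact: hM.
by rewrite mulrAC; apply: step_close.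
Qed.
End spectral_moments.

Lemma Rintegral_lin_sum d (T : measurableType d) (R : realType)
    (mu : {measure set T -> \bar R}) (D : set T) (I : Type) (r : seq I)
    (c : I -> R) (f : I -> T -> R) : measurable D -> (mu D < +oo)%E ->
  (forall i, mu.-integrable D (fun x => (f i x)%:E)) ->
  mu.-integrable D (fun x => (\sum_(i <- r) c i * f i x)%:E) /\
  Rintegral mu D (fun x => \sum_(i <- r) c i * f i x) =
    \sum_(i <- r) c i * Rintegral mu D (f i).
Proof.
move=> mD finD hf; elim: r => [|i r [IH1 IH2]].
  have e : (fun x => \sum_(i <- [::]) c i * f i x) = fun=> 0.
    by apply: funext => x; rewrite big_nil.
  split; last by rewrite e big_nil Rintegral_cst // mul0r.
  apply: (eq_ind _ (fun h => mu.-integrable D (fun x => (h x)%:E)) _ _ (esym e)).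
  apply: (@bounded_integrable _ _ _ mu D mD finD _ 0) => [|x _].
    exact: measurable_cst.
  by rewrite normr0.
have [j1 j2] := Rintegral_lin (c i) 1 mD (hf i) IH1.
have e : (fun x => \sum_(k <- i :: r) c k * f k x) =
    (fun x => c i * f i x + 1 * \sum_(k <- r) c k * f k x).
  by apply: funext => x; rewrite big_cons mul1r.
split; first exact: (eq_ind _ (fun h => mu.-integrable D (fun x => (h x)%:E)) j1 _ (esym e)).
by rewrite e j2 IH2 big_cons mul1r.
Qed.

(** * Approximating a function of the Laplacian by polynomials *)

Section spectral_approximation.
Context {R : realType} {V : pointedType}.
Local Notation C := R[i].
Local Notation normc := Normc.normc.
Local Notation RR := (measurableTypeR R).
Variable P : set R -> (V -> C) -> (V -> C).
Hypothesis hP : projection_valued_measure P.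
Variables (A T : (V -> C) -> V -> C) (f : R -> C).
Hypotheses (hA : spectral_integral P (fun l => l%:C) A) (hT : spectral_integral P f T).
Variables a b : R.
Hypothesis ab : a < b.
Local Notation K := ([set` `[a, b[] : set RR).
Hypothesis hK : forall u, ell2 u -> P (~` K) u = (fun=> 0).
Implicit Types (u v w : V -> C) (p : {poly R}).

Let mK : measurable K. Proof. exact: measurable_itv. Qed.

Let A2 u : ell2 u -> ell2 (A u).
Proof. by case: hA => [[h _ _] _]; apply: h. Qed.

Let Alin (z : C) u v : ell2 u -> ell2 v ->
  A (fun x => z * u x + v x) = (fun x => z * A u x + A v x).
Proof. by case: hA => [[_ h _] _]; apply: h. Qed.

Let T2 u : ell2 u -> ell2 (T u).
Proof. by case: hT => [[h _ _] _]; apply: h. Qed.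

Let Tlin (z : C) u v : ell2 u -> ell2 v ->
  T (fun x => z * u x + v x) = (fun x => z * T u x + T v x).
Proof. by case: hT => [[_ h _] _]; apply: h. Qed.

Lemma ell2_polyop p u : ell2 u -> ell2 (polyop A p u).
Proof. by move=> hu; apply: ell2_sum => i; apply: ell2Z; apply: ell2_iter. Qed.

Let iter_lin k (z : C) u v : ell2 u -> ell2 v ->
  iter k A (fun x => z * u x + v x) = (fun x => z * iter k A u x + iter k A v x).
Proof.
move=> hu hv; elim: k => //= k ->.
by rewrite Alin //; apply: ell2_iter.
Qed.

Let polyop_lin p (z : C) u v : ell2 u -> ell2 v ->
  polyop A p (fun x => z * u x + v x) = (fun x => z * polyop A p u x + polyop A p v x).
Proof.
move=> hu hv; apply: funext => x; rewrite /polyop mulr_sumr -big_split.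
by apply: eq_bigr => i _ /=; rewrite iter_lin //; ring.
Qed.

Lemma inner_polyop p u (mu : {measure set RR -> \bar R}) : ell2 u ->
  diag_measure P u mu ->
  mu.-integrable K (fun l => (p.[l])%:E) /\
  inner (polyop A p u) u = (Rintegral mu K (fun l => p.[l]))%:C.
Proof.
move=> hu hmu.
have [i1 e1] := @Rintegral_lin_sum _ _ _ mu K _ (index_enum 'I_(size p)) (fun i => p`_i)
  (fun i l => l ^+ i) mK (diag_measure_carrier_finite hP a b hu hmu)
  (fun i => integrable_exprn hP a b (i : nat) hu hmu).
have e : (fun l => p.[l]) = (fun l => \sum_(i < size p) p`_i * l ^+ i).
  by apply: funext => l; rewrite horner_coef.
split; first exact: (eq_ind _ (fun h => mu.-integrable K (fun x => (h x)%:E)) i1 _ (esym e)).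
rewrite e e1 inner_suml //; last by move=> i; apply: ell2Z; apply: ell2_iter.
rewrite rmorph_sum; apply: eq_bigr => i _; rewrite innerZl //; last exact: ell2_iter.
by rewrite (inner_iter_spectral hP hA ab hK i hu hmu) -rmorphM.
Qed.

Variables (p1 p2 : {poly R}) (eps : R).
Hypotheses (hp1 : forall l, a <= l <= b -> `|complex.Re (f l) - p1.[l]| <= eps)
  (hp2 : forall l, a <= l <= b -> `|complex.Im (f l) - p2.[l]| <= eps).

Let im : C := 0 +i* 1.

Let G u x : C := T u x - (polyop A p1 u x + im * polyop A p2 u x).

Let G2 u : ell2 u -> ell2 (G u).
Proof.
move=> hu; apply: ell2B; first exact: T2.
by apply: ell2D; [exact: ell2_polyop | apply: ell2Z; exact: ell2_polyop].
Qed.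

Let G_form u : ell2 u -> normc (inner (G u) u) <= 2 * eps * sqnorm u.
Proof.
move=> hu; have [mu hmu] := diag_measure_exists hP hu.
have h1 := ell2_polyop p1 hu; have h2 := ell2_polyop p2 hu.
have him := ell2Z im h2.
rewrite (innerBl (T2 hu) (ell2D h1 him) hu) (innerDl h1 him hu) (innerZl im h2 hu).
have [i1 ->] := inner_polyop p1 hu hmu; have [i2 ->] := inner_polyop p2 hu hmu.
have [_ hh] := hT; have [[j1 j2] ->] := hh u hu mu hmu.
rewrite /Cintegral (Rintegral_carrier measurableT mK (@subsetT _ K) (diag_measure_null_outside hP hK hu hmu) j1).
rewrite (Rintegral_carrier measurableT mK (@subsetT _ K) (diag_measure_null_outside hP hK hu hmu) j2).
have j1' := integrableS measurableT mK (@subsetT _ K) j1.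
have j2' := integrableS measurableT mK (@subsetT _ K) j2.
have bound g q : mu.-integrable K (fun x => (g x)%:E) ->
    mu.-integrable K (fun x => (q x)%:E) ->
    (forall l, a <= l <= b -> `|g l - q l| <= eps) ->
    `|Rintegral mu K g - Rintegral mu K q| <= eps * sqnorm u.
  move=> ig iq h; have [i3 e3] := Rintegral_lin 1 (-1) mK ig iq.
  rewrite -[X in `|X + _|]mul1r -mulN1r -e3 -(diag_measure_carrier hP hK hu hmu).
  apply: Rintegral_norm_le_bound => //; first by have := diag_measure_carrier_finite hP a b hu hmu.
  move=> l; rewrite /= in_itv /= => /andP[al lb]; rewrite mul1r mulN1r; apply: h.
  by rewrite al ltW.
have b1 := bound _ _ j1' i1 hp1; have b2 := bound _ _ j2' i2 hp2.
move: b1 b2; set r1 := Rintegral mu K (fun l => complex.Re (f l)).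
set r2 := Rintegral mu K (fun l => complex.Im (f l)).
set q1 := Rintegral mu K (fun l => p1.[l]); set q2 := Rintegral mu K (fun l => p2.[l]).
move=> b1 b2.
have -> : r1 +i* r2 - (q1%:C + im * q2%:C) = (r1 - q1)%:C + im * (r2 - q2)%:C.
  by apply/eqP; rewrite eq_complex /=; apply/andP; split; apply/eqP; ring.
apply: le_trans (le_normcD _ _) _; rewrite Normc.normcM !normc_real.
have -> : normc im = 1 by rewrite /normc /= expr0n expr1n add0r sqrtr1.
by rewrite mul1r; lra.
Qed.

(** The diagonal entries of T - p1(A) - i p2(A) are integrals over K of a function of modulus at
    most 2 eps; polarization carries this to the pair (u, v). Real and imaginary parts are
    approximated separately because the polynomials are real. *)
Lemma spectral_approximation u v : ell2 u -> ell2 v ->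
  normc (inner (T u) v) <= normc (inner (polyop A p1 u) v) +
    normc (inner (polyop A p2 u) v) + 2 * eps * (sqnorm u + sqnorm v).
Proof.
move=> hu hv.
have h1 := ell2_polyop p1 hu; have h2 := ell2_polyop p2 hu.
have him := ell2Z im h2; have hG := G2 hu.
have Glin (z : C) w y : ell2 w -> ell2 y ->
    G (fun x => z * w x + y x) = (fun x => z * G w x + G y x).
  by move=> hw hy; apply: funext => x; rewrite /G Tlin // !polyop_lin //; ring.
have hb := polarization_bound G2 Glin G_form hu hv.
have e : inner (T u) v = (inner (polyop A p1 u) v + im * inner (polyop A p2 u) v)
    + inner (G u) v.
  rewrite (innerBl (T2 hu) (ell2D h1 him) hv) (innerDl h1 him hv) (innerZl im h2 hv).
  by ring.
rewrite e; apply: le_trans (le_normcD _ _) _; apply: lerD => //.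
apply: le_trans (le_normcD _ _) _; rewrite Normc.normcM lerD2l.
have -> : normc im = 1 by rewrite /normc /= expr0n expr1n add0r sqrtr1.
by rewrite mul1r.
Qed.

End spectral_approximation.

(** * The dispersive estimate *)

Section dispersive_estimate.
Context {R : realType} (Q : nat) (alpha th : R).
Hypotheses (Q2 : (2 <= Q)%N) (alpha02 : 0 < alpha <= 2) (th01 : 0 < th < 1).
Local Notation s := (Num.sqrt (Q%:R : R)).
Local Notation C := R[i].
Local Notation gam := (spectral_gap (R := R) Q).
Local Notation normc := Normc.normc.

Lemma sqrtQ_powR_lt1 : 0 <= s `^ (th - 1) < 1.
Proof.
rewrite powR_ge0 /=; have /andP[_ t1] := th01.
have s1 := sqrtQ_gt1 (R := R) Q2; have s0 := sqrtQ_gt0 (R := R) Q2.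
rewrite -[th - 1]opprK powRN invf_lt1 ?powR_gt0 //.
have e1 : 1 = 1 `^ (- (th - 1)) :> R by rewrite powR1.
rewrite [ltLHS]e1; apply: gt0_ltr_powR => //.
- by rewrite oppr_gt0 subr_lt0.
- by rewrite nnegrE.
- by rewrite nnegrE ltW.
Qed.

(** Some margin around [1 - gam, 1 + gam] is needed because [pvm_null_outside] asks for a strict
    inequality e < c; half of 1 - gam keeps the left end positive, and 3 exceeds 1 + gam. *)
Lemma spectrum_localized (V : pointedType) (adj : rel V)
    (P : set R -> (V -> C) -> (V -> C)) : homogeneous_tree Q adj ->
  projection_valued_measure P ->
  spectral_integral P (fun l => l%:C) (neg_laplacian Q adj) ->
  forall u, ell2 u -> P (~` [set` `[(1 - gam) / 2, 3[]) u = (fun=> 0).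
Proof.
move=> ht hP hA u hu; have /andP[g0 g1] := spectral_gap01 (R := R) Q2.
have A2 (v : V -> C) : ell2 v -> ell2 (neg_laplacian Q adj v).
  by have [[h _ _] _] := hA; apply: h.
pose S1 : set (measurableTypeR R) := [set` `]-oo, ((1 - gam) / 2)[].
pose S2 : set (measurableTypeR R) := [set` `[3, +oo[].
have m1 : measurable S1 by exact: measurable_itv.
have m2 : measurable S2 by exact: measurable_itv.
have n1 : P S1 u = (fun=> 0).
  apply: (@pvm_null_outside _ _ _ hP _ 1 (1 - gam) ((1 - gam) / 2) S1 hA m1) => //.
  - move=> v hv; rewrite mul1r.
    by have /andP[] := neg_laplacian_form_bounds Q2 ht hv (A2 v hv).
  - by lra.
  - by move=> l; rewrite /S1 /= in_itv /= mul1r => /ltW.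
have n2 : P S2 u = (fun=> 0).
  apply: (@pvm_null_outside _ _ _ hP _ (-1) (- (1 + gam)) (-3) S2 hA m2) => //.
  - move=> v hv; rewrite mulN1r mulNr lerN2.
    by have /andP[] := neg_laplacian_form_bounds Q2 ht hv (A2 v hv).
  - by lra.
  - by move=> l; rewrite /S2 /= in_itv /= mulN1r andbT lerN2.
have -> : ~` [set` `[(1 - gam) / 2, 3[] = S1 `|` S2.
  apply/seteqP; split=> l; rewrite /S1 /S2 /= !in_itv /= andbT.
    move=> h; have [h1|h1] := ltP l ((1 - gam) / 2); [by left | right].
    by rewrite leNgt; apply/negP => h2; apply: h; rewrite h1 h2.
  by case=> h; apply/negP; rewrite negb_and -ltNge -leNgt h ?orbT.
have [mu hmu] := diag_measure_exists hP hu.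
have m12 : measurable (S1 `|` S2) by exact: measurableU.
have z0 : sqnorm (fun=> 0 : C) (V := V) = 0.
  rewrite /sqnorm (_ : (fun x => _) = fun=> 0) ?Rintegral_cst ?mul0r //.
  by apply: funext => x; rewrite Normc.normc0 expr0n.
apply: ell2_sqnorm0; first exact: pvm_ell2.
apply/eqP; rewrite eq_le sqnorm_ge0 andbT -lee_fin -(diag_measureE hP hu hmu m12).
apply: le_trans (@measureU2 _ _ _ mu _ _ m1 m2) _.
have E1 : mu S1 = 0%E by rewrite (diag_measureE hP hu hmu m1) n1 z0.
have E2 : mu S2 = 0%E by rewrite (diag_measureE hP hu hmu m2) n2 z0.
by rewrite [X in (X + _ <= _)%E]E1 [X in (_ + X <= _)%E]E2 adde0.
Qed.

(** The degrees of the approximating polynomials are not controlled, but C3 bounds the partial sums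
    of every length; l^2 norms enter only the error term, which tends to 0. *)
Lemma dispersive_form_bound : exists2 C1 : R, 0 < C1 &
  forall (V : pointedType) (adj : rel V) (t : R) (T : (V -> C) -> V -> C),
  homogeneous_tree Q adj ->
  spectral_function (neg_laplacian Q adj)
        (fun l : R => expi (t * l `^ (alpha / 2))) T ->
  forall (u v : V -> C) (A B : V -> R) (G : seq V), ell2 u ->
  (forall x, 0 <= A x) -> (forall x, 0 <= B x) ->
  (forall x, normc (u x) = A x `^ (1 - th / 2)) ->
  (forall x, normc (v x) = B x `^ (1 - th / 2)) ->
  (forall F : seq V, uniq F -> \sum_(y <- F) A y <= 1) ->
  uniq G -> \sum_(x <- G) B x <= 1 ->
  normc (\sum_(x <- G) T u x * (v x)^*) <= C1 * (1 + `|t|) `^ (- (3 / 2)).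
Proof.
have g01 := spectral_gap01 (R := R) Q2; have /andP[g0 g1] := g01.
have /andP[a0 a2] := alpha02; have pi0 := pi_gt0 R.
have [C2 C20 hC2] := dispersive_coefficients g01 alpha02.
have [C3 C30 hC3] := cubic_geometric_bounded sqrtQ_powR_lt1.
(* The outer 2 counts the real and imaginary parts, 2 / pi is the normalization of the coefficients,
   C2 their decay and C3 the sum over n. *)
exists (2 * (2 / pi * C2 * C3)); first by rewrite !mulr_gt0 ?invr_gt0.
move=> V adj t T ht [P [hP hA hT]] u v A B G hu A0 B0 uA vB A1 uG B1.
set tau := (1 + `|t|) `^ _.
pose a := (1 - gam) / 2; have ag : 0 < a by rewrite /a; lra.
have a3 : a < 3 by rewrite /a; lra.
have hK := spectrum_localized ht hP hA.
have c01 : 0 < alpha / 2 <= 1 by lra.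
have T2 : ell2 (T u) by case: hT => [[h _ _] _]; apply: h.
have s1 (x : R) : `|sin x| <= 1 by rewrite ler_norml sin_geN1 sin_le1.
have c1 (x : R) : `|cos x| <= 1 by rewrite ler_norml cos_geN1 cos_le1.
have sN1 (x : R) : `|- sin x| <= 1 by rewrite normrN.
have [L1 L10 hL1] := lipschitz_oscillation t ag c01 derives_cos sN1.
have [L2 L20 hL2] := lipschitz_oscillation t ag c01 derives_sin c1.
have cbase : continuous (fun x : R => t * (1 - gam * cos x) `^ (alpha / 2)).
  apply: fun_continuousM; first exact: cst_continuous.
  apply: derives_continuous (derives_powR _ _ (derivesD (derives_cst 1)
    (derivesN (derivesM (derives_cst gam) derives_cos)))).
  by move=> x; have := cos_geN1 x; have := cos_le1 x; nra.
pose N := sqnorm u + sqnorm (trunc G v).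
have N0 : 0 <= N by rewrite addr_ge0 // sqnorm_ge0.
apply/ler_addgt0Pr => e e0.
(* Replacing h by a polynomial costs 2 eps C3 in each of the two forms, and the spectral
   approximation costs 2 eps N. *)
pose eps := e / (4 * C3 + 2 * N + 1).
have den0 : 0 < 4 * C3 + 2 * N + 1 by lra.
have eps0 : 0 < eps by rewrite divr_gt0.
have [p1 hp1] := lipschitz_poly_approx a3 L10 eps0 hL1.
have [p2 hp2] := lipschitz_poly_approx a3 L20 eps0 hL2.
have inK l : 1 - gam <= l <= 1 + gam -> a <= l <= 3 by rewrite /a; lra.
have form (p : {poly R}) (h : R -> R) : continuous (fun x : R => h (1 - gam * cos x)) ->
    (forall l, a <= l <= 3 -> `|h l - p.[l]| <= eps) ->
    (forall n : nat, `|cheb_coef gam n.+1 h| <= 2 / pi * C2 * tau * n.+1%:R ^+ 2) ->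
    normc (inner (polyop (neg_laplacian Q adj) p u) (trunc G v)) <=
      (2 / pi * C2 * tau + 2 * eps) * C3.
  move=> ch hp hc; rewrite inner_trunc; last by apply: (ell2_polyop hA).
  apply: le_trans (polyop_form_bound Q2 ht th01 A0 B0 uA vB A1 p uG B1) _.
  have k0 : 0 <= 2 / pi * C2 * tau + 2 * eps.
    have t0 : 0 <= tau by exact: powR_ge0.
    apply: addr_ge0; last by rewrite mulr_ge0 // ltW.
    by apply: mulr_ge0 t0; apply: mulr_ge0 (ltW C20); rewrite divr_ge0 // ltW.
  apply: le_trans (_ : (2 / pi * C2 * tau + 2 * eps) *
     (\sum_(n < size p) n.+1%:R ^+ 3 * (s `^ (th - 1)) ^+ n) <= _); last first.
    by rewrite ler_wpM2l.
  rewrite mulr_sumr; apply: ler_sum => n _.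
  have r0 : 0 <= n.+1%:R * (s `^ (th - 1)) ^+ n.
    by rewrite mulr_ge0 // exprn_ge0 // powR_ge0.
  rewrite [leRHS](_ : _ = ((2 / pi * C2 * tau + 2 * eps) * n.+1%:R ^+ 2) *
     (n.+1%:R * (s `^ (th - 1)) ^+ n)); last by rewrite !exprS; ring.
  apply: ler_wpM2r => //.
  have := cheb_coef_close g01 n.+1 ch (@continuous_horner R p) (fun l hl => hp l (inK l hl)).
  have := hc n; have n1 : 1 <= n.+1%:R ^+ 2 :> R by rewrite exprn_ege1 // ler1n.
  set z1 := cheb_coef _ _ _; set z2 := cheb_coef _ _ _ => h1 h2.
  have : `|z2| <= `|z1| + `|z1 - z2|.
    by rewrite -[in leLHS](subKr z1 z2); exact: ler_normB.
  have : 2 * eps <= 2 * eps * n.+1%:R ^+ 2 by rewrite ler_peMr // mulr_ge0 // ltW.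
  rewrite mulrDl; lra.
have coef (F : R -> R) :
    (forall n : nat, `|int0pi (fun x => F (t * (1 - gam * cos x) `^ (alpha / 2)) *
       (sin x * sin (n.+1%:R * x)))| <= C2 * n.+1%:R ^+ 2 * tau) ->
    forall n : nat, `|cheb_coef gam n.+1 (fun l => F (t * l `^ (alpha / 2)))| <=
      2 / pi * C2 * tau * n.+1%:R ^+ 2.
  move=> h n; rewrite /cheb_coef normrM ger0_norm ?divr_ge0 ?(ltW pi0) //.
  rewrite -!mulrA ler_wpM2l // ler_wpM2l ?invr_ge0 ?(ltW pi0) //.
  by apply: le_trans (h n) _; rewrite -mulrA [tau * _]mulrC.
have ccos := derives_continuous (@derives_cos R).
have csin := derives_continuous (@derives_sin R).
have F1 := form p1 _ (fun_continuous_comp ccos cbase) hp1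
  (coef cos (fun n => (hC2 t n).1)).
have F2 := form p2 _ (fun_continuous_comp csin cbase) hp2
  (coef sin (fun n => (hC2 t n).2)).
have := spectral_approximation hP hA hT a3 hK hp1 hp2 hu (ell2_trunc G v).
rewrite inner_trunc // -/N => /le_trans; apply.
have : eps * (4 * C3 + 2 * N + 1) = e by rewrite /eps mulfVK // gt_eqF.
have := mulr_ge0 (ltW eps0) N0; have := mulr_ge0 (ltW eps0) (ltW C30); lra.
Qed.

End dispersive_estimate.

(** * Duality and the choice of exponents *)

Lemma powR_antimono {R : realType} (x p q : R) : 0 <= x <= 1 -> 0 < p -> p <= q ->
  x `^ q <= x `^ p.
Proof.
move=> /andP[x0 x1] p0 pq; have [->|xn] := eqVneq x 0.
  by rewrite !powR0 // gt_eqF // (lt_le_trans p0).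
have -> : q = p + (q - p) by rewrite addrC subrK.
rewrite powRD ?xn ?implybT // -[leRHS]mulr1 ler_wpM2l ?powR_ge0 //.
have e1 : 1 = 1 `^ (q - p) :> R by rewrite powR1.
by rewrite [leRHS]e1 ge0_ler_powR ?nnegrE ?subr_ge0.
Qed.

(* The test function v is w |w|^(r - 2), normalized in l^r'. *)
Lemma sum_powR_le_of_dual {R : realType} {V : pointedType} (w : V -> R[i]) (r M : R)
    (G : seq V) : 1 < r -> 0 <= M ->
  (forall (v : V -> R[i]) (B : V -> R), (forall x, 0 <= B x) ->
    (forall x, Normc.normc (v x) = B x `^ (1 - r^-1)) -> \sum_(x <- G) B x <= 1 ->
    Normc.normc (\sum_(x <- G) w x * (v x)^*) <= M) ->
  \sum_(x <- G) Normc.normc (w x) `^ r <= M `^ r.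
Proof.
move=> r1 M0 h; have r0 : 0 < r by apply: lt_trans r1.
pose b x := Normc.normc (w x); have b0 x : 0 <= b x by exact: normc_ge0.
set S := \sum_(x <- G) _; have S0 : 0 <= S by apply: sumr_ge0 => x _; exact: powR_ge0.
have [->|Sn] := eqVneq S 0; first exact: powR_ge0.
have Sp : 0 < S by rewrite lt_neqAle eq_sym Sn.
pose e := 1 - r^-1; have e0 : 0 < e by rewrite subr_gt0 invf_lt1.
pose B x := b x `^ r / S.
have B0 x : 0 <= B x by rewrite divr_ge0 ?powR_ge0.
(* v has the phase of w and the modulus B^e; where w vanishes so does v, whatever the quotient
   is. *)
pose v x := (B x `^ e / b x)%:C * w x.
have Be x : B x `^ e * b x = b x `^ r / S `^ e.
  rewrite /B powRM ?powR_ge0 ?invr_ge0 // -powRrM.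
  rewrite -[S^-1]powR_inv1 // -powRrM mulN1r powRN mulrAC; congr (_ / _).
  have [bx|bx] := eqVneq (b x) 0; first by rewrite bx mulr0 powR0 // gt_eqF.
  rewrite -[X in _ * X](powRr1 (b0 x)) -powRD ?bx ?implybT //.
  by congr (_ `^ _); rewrite /e mulrBr mulr1 mulfV ?gt_eqF // subrK.
have vB x : Normc.normc (v x) = B x `^ e.
  rewrite /v Normc.normcM normc_real ger0_norm ?divr_ge0 ?powR_ge0 // -/(b x).
  have [bx|bx] := eqVneq (b x) 0; last by rewrite mulfVK.
  by rewrite bx mulr0 /B bx powR0 ?gt_eqF // mul0r powR0 // gt_eqF.
have B1 : \sum_(x <- G) B x <= 1 by rewrite -mulr_suml mulfV.
have := h v B B0 vB B1.
have -> : \sum_(x <- G) w x * (v x)^* = (S `^ r^-1)%:C.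
  have -> : S `^ r^-1 = \sum_(x <- G) b x `^ r / S `^ e.
    rewrite -mulr_suml -/S -{2}[S](powRr1 S0) -powRB ?Sn ?implybT //.
    by congr (_ `^ _); rewrite /e; ring.
  rewrite rmorph_sum; apply: eq_bigr => x _; rewrite -Be.
  have cv : conjc (v x) = (B x `^ e / b x)%:C * (w x)^*.
    rewrite /v; case: (w x) => y z; apply/eqP; rewrite eq_complex /=.
    by apply/andP; split; apply/eqP; ring.
  apply: etrans (congr1 (fun z => w x * z) cv) _.
  rewrite mulrCA conjc_mulE -rmorphM; congr (_%:C); rewrite -/(b x).
  have [bx|bx] := eqVneq (b x) 0; first by rewrite bx expr0n !mulr0.
  by field.
rewrite normc_real ger0_norm ?powR_ge0 // => hS.
have -> : S = (S `^ r^-1) `^ r by rewrite -powRrM mulVf ?powRr1 // gt_eqF.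
by apply: ge0_ler_powR; rewrite ?nnegrE ?powR_ge0 // ltW.
Qed.

(** One exponent serves both ends: the diagonal estimate from l^r' to l^r implies the one sought.
    The value 3 is an arbitrary choice when both exponents are infinite. *)
Lemma exponent_below {R : realType} (q qt : \bar R) : (2%:E < q)%E -> (2%:E < qt)%E ->
  exists r : R, [/\ 2 < r, (r%:E <= q)%E & (r%:E <= qt)%E].
Proof.
case: q => [q||] //; case: qt => [qt||] //; rewrite ?lte_fin => hq hqt.
- exists (Num.min q qt); rewrite lt_min hq hqt !lee_fin !ge_min !lexx orbT.
  by split.
- by exists q; rewrite lexx leey.
- by exists qt; rewrite lexx leey.
- by exists 3; rewrite !leey; split=> //; lra.
Qed.

Lemma hoelder_conjugate_below {R : realType} (q : \bar R) (r : R) : 2 < r ->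
  (r%:E <= q)%E ->
  exists p : R, [/\ hoelder_conjugate q = p%:E, 1 <= p & p <= (1 - r^-1)^-1].
Proof.
move=> r2; have r0 : 0 < r by lra.
have rV : 0 < r^-1 by rewrite invr_gt0.
have rV1 : r^-1 < 1 by rewrite invf_lt1 //; lra.
have eV : 0 < 1 - r^-1 by lra.
case: q => [q||] //.
  rewrite lee_fin => rq; have q0 : 0 < q by lra.
  exists (q / (q - 1)); split.
  - rewrite /hoelder_conjugate /= eqe gt_eqF // -EFinB inver gt_eqF ?subr_gt0; last by lra.
    by rewrite -EFinM.
  - by rewrite ler_pdivlMr ?mul1r; lra.
  - have -> : q / (q - 1) = (1 - q^-1)^-1.
      by field; rewrite gt_eqF //= subr_eq0 gt_eqF //; lra.
    rewrite lef_pV2 ?posrE // ?lerB // ?lef_pV2 ?posrE //.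
    by rewrite subr_gt0 invf_lt1 //; lra.
move=> _; exists 1; split; [by [] | by [] | ].
by rewrite invf_ge1 //; lra.
Qed.

(** As r <= q and r <= qt, the unit ball of l^q' lies in that of l^r', and l^r norms dominate l^qt
    norms; th = 2 / r is below 1 because r > 2. *)
Theorem theorem1p2 (R : realType) (Q : nat) (alpha : R) (q qt : \bar R)
    (HQ : (2 <= Q)%N) (Halpha : 0 < alpha <= 2)
    (Hq : (2%:E < q)%E) (Hqt : (2%:E < qt)%E) :
  exists2 C : R, 0 < C &
    forall (V : pointedType) (adj : rel V), homogeneous_tree Q adj ->
    forall t : R, t != 0 ->
    forall T : (V -> R[i]) -> (V -> R[i]),
      spectral_function (fun u x => - laplacian Q adj u x)
        (fun l : R => expi (t * l `^ (alpha / 2))) T ->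
      (opnorm (hoelder_conjugate q) qt T <=
         (C * (1 + `|t|) `^ (- (3 / 2)))%:E)%E.
Proof.
have [r [r2 rq rqt]] := exponent_below Hq Hqt.
have r0 : 0 < r by lra.
have rn : r != 0 by rewrite gt_eqF.
have th01 : 0 < 2 / r < 1 by rewrite divr_gt0 //= ltr_pdivrMr // mul1r.
have thE : 1 - 2 / r / 2 = 1 - r^-1 by field.
have [p [-> p1 pr]] := hoelder_conjugate_below r2 rq.
have p0 : 0 < p by lra.
have rV : r^-1 < 2^-1 by rewrite ltf_pV2 ?posrE.
(* sg is the conjugate exponent r'. Both p <= sg and sg <= 2 matter: the first gives the sum
   condition on |u|^sg, the second that u is in l^2. *)
pose sg := (1 - r^-1)^-1.
have sg2 : sg <= 2 by rewrite /sg invf_ple ?posrE //; lra.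
have sge : sg * (1 - r^-1) = 1 by rewrite mulVf // gt_eqF //; lra.
have [C1 C10 hC] := dispersive_form_bound HQ Halpha th01.
exists C1 => // V adj ht t _ T hT.
set M := C1 * _; have M0 : 0 <= M by rewrite mulr_ge0 ?powR_ge0 // ltW.
have [E exE] := tree_exhaustion ht.
apply: ub_ereal_sup => _ [u /= hu <-].
have usum F : uniq F -> \sum_(x <- F) Normc.normc (u x) `^ p <= 1.
  by move=> uF; exact: lnorm_sum_le1.
have u01 x : 0 <= Normc.normc (u x) <= 1.
  rewrite normc_ge0 /=; have := usum [:: x] isT; rewrite big_seq1 => h.
  rewrite leNgt; apply/negP => c; move: h; rewrite leNgt => /negP; apply.
  have e1 : 1 = 1 `^ p :> R by rewrite powR1.
  by rewrite [ltLHS]e1; apply: gt0_ltr_powR => //; rewrite nnegrE ?normc_ge0.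
have usum_le z F : p <= z -> uniq F -> \sum_(x <- F) Normc.normc (u x) `^ z <= 1.
  move=> pz uF; apply: le_trans (usum F uF); apply: ler_sum => x _.
  exact: powR_antimono.
have uE n : uniq (E n) by case: exE.
have u2 : ell2 u.
  have [] // := @ell2_of_sums R V E u 1 exE.
  move=> n; have := usum_le 2 (E n) (le_trans pr sg2) (uE n).
  apply: le_trans; rewrite le_eqVlt; apply/orP; left; apply/eqP; apply: eq_bigr => x _.
  by rewrite powR_mulrn ?normc_ge0.
have dual G : uniq G -> \sum_(x <- G) Normc.normc (T u x) `^ r <= M `^ r.
  move=> uG; apply: sum_powR_le_of_dual => //; first by lra.
  move=> v B B0 vB B1.
  apply: (hC V adj t T ht hT u v (fun x => Normc.normc (u x) `^ sg) B G u2) => //.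
  - by move=> x; exact: powR_ge0.
  - by move=> x; rewrite thE -powRrM sge powRr1 // normc_ge0.
  - by move=> x; rewrite thE.
  - by move=> F uF; apply: usum_le.
have pt x : Normc.normc (T u x) <= M.
  have := dual [:: x] isT; rewrite big_seq1 => h.
  rewrite leNgt; apply/negP => c; move: h; rewrite leNgt => /negP; apply.
  by apply: gt0_ltr_powR => //; rewrite nnegrE ?normc_ge0.
apply: (lnorm_le_of_sums exE) => //.
  by apply: le_trans rqt; rewrite lee_fin; lra.
(* For finite z = qt, |T u|^z is at most M^(z - r) |T u|^r by the pointwise bound [pt], and the l^r
   bound concludes. *)
move=> z zE n; move: rqt; rewrite zE lee_fin => rz.
have [M00|Mn] := eqVneq M 0.
  rewrite big1 ?powR_ge0 // => x _.
  have -> : Normc.normc (T u x) = 0.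
    by apply/eqP; rewrite eq_le normc_ge0 andbT -M00.
  by rewrite powR0 // gt_eqF; lra.
have -> : M `^ z = M `^ (z - r) * M `^ r by rewrite -powRD ?Mn ?implybT // subrK.
apply: le_trans (ler_wpM2l (powR_ge0 _ _) (dual (E n) (uE n))).
rewrite mulr_sumr; apply: ler_sum => x _.
have [b0|bn] := eqVneq (Normc.normc (T u x)) 0.
  by rewrite b0 powR0 ?mulr_ge0 ?powR_ge0 // gt_eqF //; lra.
have -> : z = (z - r) + r by rewrite subrK.
rewrite powRD ?bn ?implybT // addrK ler_wpM2r ?powR_ge0 //.
by apply: ge0_ler_powR; rewrite ?nnegrE ?normc_ge0 ?subr_ge0.
Qed.
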